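(* Let $p$ be a prime and let $G$ be a $2$-closed subgroup of $S_{p^2}$ such that $G$ contains the left regular representation of $\mathbb{Z}_p^2$. Then, after replacing $G$ by a conjugate in $S_{p^2}$, the following hold. (1) If $G$ is doubly transitive, then $G=S_{p^2}$. (2) If $G$ is simply primitive and solvable, then $G\le\mathrm{AGL}(2,p)$. (3) If $G$ is simply primitive and nonsolvable, then $G\le\mathrm{AGL}(2,p)$ or $G=S_2\wr S_p$ in its product action. (4) If $G$ is imprimitive, solvable, and has elementary abelian Sylow $p$-subgroup, then either $G<\mathrm{AGL}(1,p)\times\mathrm{AGL}(1,p)$ (a proper subgroup) or $G=S_3\times S_3$ (and $p=3$). (5) If $G$ is imprimitive, nonsolvable, and has elementary abelian Sylow $p$-subgroup, then either $G=S_p\times S_p$ or $G=S_p\times A$, where $A<\mathrm{AGL}(1,p)$ (a proper subgroup). (6) If $G$ is imprimitive with Sylow $p$-subgroup of order at least $p^3$, then $G=G_1\wr G_2$, where $G_1$ and $G_2$ are $2$-closed permutation groups of degree $p$.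
   Context: For a transitive group $G$ on $\Omega$, let $G$ act on $\Omega\times\Omega$ by $g(\alpha,\beta)=(g(\alpha),g(\beta))$. For each orbit $\mathcal{O}$ other than the diagonal, the digraph with vertex set $\Omega$ and arc set $\mathcal{O}$ is an orbital digraph of $G$. The $2$-closure $\mathrm{cl}(G)$ is the intersection of the automorphism groups of all orbital digraphs of $G$, and $G$ is $2$-closed if $\mathrm{cl}(G)=G$. Simply primitive means primitive but not doubly transitive. $S_{p^2}$ acts on $\mathbb{Z}_p\times\mathbb{Z}_p=\mathbb{F}_p^2$; the left regular representation of $\mathbb{Z}_p^2$ is its group of translations. Products $A\times B$ of subgroups of $S_p$ act coordinatewise. $\mathrm{AGL}(d,p)$ is the group of affine transformations of $\mathbb{F}_p^d$. $S_2\wr S_p$ in its product action is $(S_p\times S_p)\rtimes S_2$, with $S_p\times S_p$ acting coordinatewise and $S_2$ interchanging the two coordinates. For $G_1,G_2\le S_p$, $G_1\wr G_2$ is the imprimitive wreath product: all permutations $(i,j)\mapsto(g(i),h_i(j))$ with $g\in G_1$ and $h_i\in G_2$ for each $i\in\mathbb{Z}_p$.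
   Formalization: Clause (4) also allows G = S_2 × S_2 when p = 2: the translation group of F_2^2 is 2-closed, imprimitive, solvable and elementary abelian, but has order 4 = |AGL(1,2) × AGL(1,2)|, so it is not conjugate to a proper subgroup. *)

(* Defs.v *)
From mathcomp Require Import all_boot all_order all_fingroup all_algebra.
From mathcomp Require Import all_solvable.

Set Implicit Arguments.
Unset Strict Implicit.
Unset Printing Implicit Defensive.

Local Open Scope group_scope.

Section TwoClosure.

Variable T : finType.

Definition pair_fun (x : T * T) (g : {perm T}) : T * T := (g x.1, g x.2).

Lemma pair_fun1 : pair_fun^~ 1 =1 id.
Proof. by case=> a b; rewrite /pair_fun !perm1. Qed.

Lemma pair_funM (x : T * T) : act_morph pair_fun x.
Proof. by move=> g h; rewrite /pair_fun /= !permM. Qed.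

Canonical pair_action := TotalAction pair_fun1 pair_funM.

Definition diagonal : {set T * T} := [set x | x.1 == x.2].

(* A digraph on T is identified with its arc set. *)
Definition orbital_digraphs (G : {set {perm T}}) : {set {set T * T}} :=
  [set E in orbit pair_action G @: setT | E != diagonal].

Definition digraph_aut (E : {set T * T}) : {set {perm T}} :=
  'N(E | pair_action).

Definition two_closure (G : {set {perm T}}) : {set {perm T}} :=
  \bigcap_(E in orbital_digraphs G) digraph_aut E.

(* 2-closedness is a notion for transitive groups only, so transitivity is
   part of the definition. *)
Definition two_closed (G : {set {perm T}}) : bool :=
  [transitive G, on setT | 'P] && (two_closure G == G).

Definition doubly_transitive (G : {set {perm T}}) : bool :=
  [transitive^2 G, on setT | 'P].

Definition simply_primitive (G : {set {perm T}}) : bool :=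
  [primitive G, on setT | 'P] && ~~ doubly_transitive G.

Definition imprimitive (G : {set {perm T}}) : bool :=
  [transitive G, on setT | 'P] && ~~ [primitive G, on setT | 'P].

End TwoClosure.

Section Products.

Variables S T : finType.

Definition prod_fun (a : {perm S}) (b : {perm T}) (x : S * T) : S * T :=
  (a x.1, b x.2).

Lemma prod_fun_inj a b : injective (prod_fun a b).
Proof. by move=> [x y] [x' y'] [/perm_inj-> /perm_inj->]. Qed.

Definition prod_perm a b : {perm S * T} := perm (@prod_fun_inj a b).

Definition coord_prod (A : {set {perm S}}) (B : {set {perm T}}) :
  {set {perm S * T}} := [set prod_perm a b | a in A, b in B].

Definition wreath_fun (g : {perm S}) (h : {ffun S -> {perm T}}) (x : S * T) :
  S * T := (g x.1, h x.1 x.2).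

Lemma wreath_fun_inj g h : injective (wreath_fun g h).
Proof. by move=> [x y] [x' y'] [/perm_inj-> /perm_inj->]. Qed.

Definition wreath_perm g h : {perm S * T} := perm (@wreath_fun_inj g h).

Definition imprimitive_wreath (G1 : {set {perm S}}) (G2 : {set {perm T}}) :
  {set {perm S * T}} :=
  [set wreath_perm g h | g in G1, h in ffun_on (mem G2)].

End Products.

Section ProductAction.

Variable T : finType.

Definition swap_fun (x : T * T) : T * T := (x.2, x.1).

Lemma swap_fun_inj : injective swap_fun.
Proof. by move=> [x y] [x' y'] [-> ->]. Qed.

Definition swap_perm : {perm T * T} := perm swap_fun_inj.

(* S_2 wr Sym(T) in its product action on T * T *)
Definition product_wreath_S2 : {set {perm T * T}} :=
  coord_prod [set: {perm T}] [set: {perm T}] * <[swap_perm]>.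

End ProductAction.

(* 'F_p has p elements only when p is prime. *)
Notation plane p := ('F_p * 'F_p)%type.

Section Affine.

Variable p : nat.

Local Open Scope ring_scope.

Local Notation plane := (plane p).

Definition translation (v : plane) : {perm plane} := perm (@GRing.addrI plane v).

Definition translations : {set {perm plane}} :=
  [set translation v | v in [set: plane]].

Definition mulMv (A : 'M['F_p]_2) (x : plane) : plane :=
  (A 0 0 * x.1 + A 0 1 * x.2, A 1 0 * x.1 + A 1 1 * x.2).

Definition AGL1 : {set {perm 'F_p}} :=
  [set g : {perm 'F_p} | [exists a : 'F_p, [exists b : 'F_p,
     (a != 0) && [forall x, g x == a * x + b]]]].

Definition AGL2 : {set {perm plane}} :=
  [set g : {perm plane} | [exists A : 'M['F_p]_2, [exists b : plane,
     (A \in unitmx) && [forall x : plane, g x == mulMv A x + b]]]].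

End Affine.

(* Main.v *)
Require Import Defs.
From mathcomp Require Import all_boot all_order all_fingroup all_algebra.
From mathcomp Require Import all_solvable.
From HB Require Import structures.
From mathcomp Require Import all_field.
From mathcomp Require Import zify ring.

Set Implicit Arguments.
Unset Strict Implicit.
Unset Printing Implicit Defensive.

Import GRing.Theory.

Local Open Scope ring_scope.

(* The group G contains the translations of V = F_p^2, so its orbitals are given by
   the suborbits S = {g v - g 0}, and by Schur's multiplier theorem every scalar
   multiple of S is again a suborbit.  Let X be a union of suborbits closed under
   multiplication by scalars, with at most (p^2 - 1) / 2 nonzero elements.  By the
   Redei-Megyesi theorem on the slopes of a function on F_p, the elements of G map
   lines with direction in X to parallel lines.  Three such directions make G affine;
   two make it act on coordinates, possibly interchanging them; a single one is a
   system of imprimitivity.  If G is primitive, not 2-transitive and there is no such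
   X, then V \ 0 is the union of the multiples of any suborbit, so that G preserves a
   multiplicative character f (v) of v, some power of which is a binary form of degree
   k < p - 1.  By apolarity, there is a linear form l whose powers of exponent at most
   k / 2 are combinations of translates of that form; hence these powers of l o g have
   degree < k on every line, which forces l o g, and finally g, to be affine.  On each
   coordinate of a group that acts coordinatewise, Burnside's theorem and
   2-closedness leave the symmetric group or a subgroup of AGL(1, p).  If p^3
   divides the order of an imprimitive G, a p-element normalising the translations is a
   transvection, and 2-closedness yields the wreath product. *)

(** * Sums and polynomials over the prime field *)

(** The threshold (p^2 - 1) / 2 fits Redei-Megyesi: each direction of X accounts for p - 1 vectors,
    so a small X has at most (p + 1) / 2 directions, and a function whose differences lie in X
    misses at least (p - 1) / 2 slopes. X and its complement in V \ 0 are stable together, and one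
    of them is small; the method only fails when the small one is empty, that is, when the multiples
    of each suborbit fill V \ 0. In that case two powers of the character with weights adding up to
    p - 1 have a convolution that is constant off 0. A moment of degree p - 1 of this constant shows
    that one of the two powers is orthogonal to all monomials of complementary degree, which makes
    it a form. The two weights are taken as equal as possible, because the degree argument for l o g
    tolerates only a small excess of k over (p - 1) / 2. The form l comes from a root of a
    polynomial, hence lives over an algebraic closure, and it may vanish on a line of V: primitivity
    is needed once more to recover g from all the functions l o g. *)

Section PrimeField.

Variables (p : nat) (hp : prime p).
Local Notation F := 'F_p.

Lemma Fp_natr0 (R : nzRingType) (iota : {rmorphism F -> R}) : p%:R = 0 :> R.
Proof.
rewrite -(rmorph_nat iota) -(rmorph0 iota); congr (iota _).
by have /andP[_ /eqP] := pchar_Fp hp.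
Qed.

Lemma Fp_natr_eq0 (n : nat) : ((n%:R : F) == 0) = (p %| n)%N.
Proof. by rewrite (dvdn_pcharf (pchar_Fp hp)). Qed.

Lemma Fp_expr_pred (x : F) : x != 0 -> x ^+ p.-1 = 1.
Proof.
move=> x0; apply: (mulfI x0); rewrite mulr1 -exprS prednK ?prime_gt0 //.
by have := expf_card x; rewrite card_Fp.
Qed.

Lemma Fp_expr_neq1 (i : nat) : (0 < i < p.-1)%N -> exists2 x : F, x != 0 & x ^+ i != 1.
Proof.
move=> /andP[i0 ip]; apply/exists_inP; apply: contraLR ip.
rewrite negb_exists -leqNgt => /forallP all1.
have := @max_unity_roots F i (enum [set~ (0 : F)]) i0.
rewrite -cardE cardsC1 card_Fp // => -> //; last exact: enum_uniq.
apply/allP=> x; rewrite mem_enum !inE => x0.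
by have := all1 x; rewrite x0 /= negbK unity_rootE.
Qed.

(** For [i = 0] the convention [0 ^+ 0 = 1] makes the sum equal to [p], that is 0. For an exponent
    that [p.-1] does not divide, some non-zero [c] has [c ^+ i != 1], and the substitution of
    [c * x] multiplies the sum by [c ^+ i]. *)
Lemma sum_Fp_expr (i : nat) :
  \sum_(x : F) x ^+ i = if (0 < i)%N && (p.-1 %| i)%N then -1 else 0.
Proof.
have p1 : (0 < p.-1)%N by rewrite -ltnS prednK ?prime_gt1 ?prime_gt0.
case: ifPn => [/andP[i0 /dvdnP[m im]]|].
  rewrite (bigD1 0) //= expr0n (gtn_eqF i0) add0r.
  rewrite (eq_bigr (fun=> 1)) => [|x x0]; last first.
    by rewrite im mulnC exprM Fp_expr_pred // expr1n.
  rewrite sumr_const cardC1 card_Fp // -[RHS]add0r -(Fp_natr0 idfun).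
  by rewrite -subn1 natrB ?prime_gt0.
rewrite negb_and -eqn0Ngt => /orP[/eqP->|ndvd].
  by rewrite (eq_bigr (fun=> 1)) // sumr_const card_Fp // (Fp_natr0 idfun).
have [|x x0 xi] := @Fp_expr_neq1 (i %% p.-1).
  by rewrite ltn_mod p1 andbT lt0n.
have xi1 : x ^+ i != 1.
  by rewrite (divn_eq i p.-1) exprD mulnC exprM Fp_expr_pred // expr1n mul1r.
apply/eqP; rewrite -(mulrI_eq0 _ (mulfI (_ : 1 - x ^+ i != 0))); last first.
  by rewrite subr_eq0 eq_sym.
rewrite mulrBl mul1r subr_eq0 mulr_sumr [eqbLHS](reindex_inj (mulfI x0)) /=.
by apply/eqP; apply: eq_bigr => y _; rewrite exprMn.
Qed.

Section Extension.

Variables (K : fieldType) (iota : {rmorphism F -> K}).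

Lemma sum_Fp_horner (P : {poly K}) : (size P <= p.-1)%N ->
  \sum_(x : F) P.[iota x] = 0.
Proof.
move=> sP; under eq_bigr do rewrite horner_coef.
rewrite exchange_big /= big1 // => i _; rewrite -mulr_sumr.
under eq_bigr do rewrite -rmorphXn.
rewrite -rmorph_sum sum_Fp_expr; case: ifPn => [/andP[i0 /dvdn_leq]|].
  by move=> /(_ i0); rewrite leqNgt (leq_trans (ltn_ord i)).
by rewrite rmorph0 mulr0.
Qed.

Lemma poly_Fp_eq (P Q : {poly K}) : (size P <= p)%N -> (size Q <= p)%N ->
  (forall x : F, P.[iota x] = Q.[iota x]) -> P = Q.
Proof.
move=> sP sQ PQ; apply/eqP; rewrite -subr_eq0; apply/negPn/negP=> /max_poly_roots.
move=> /(_ [seq iota x | x <- enum F]).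
rewrite size_map -cardE card_Fp // map_inj_uniq ?enum_uniq; last exact: fmorph_inj.
case/(_ _ isT)/wrap=> [|]; last first.
  rewrite ltnNge (leq_trans (size_polyD _ _)) // geq_max size_polyN sP sQ //.
by apply/allP=> _ /mapP[x _ ->]; rewrite rootE !hornerE PQ subrr.
Qed.

End Extension.

Lemma Fp_interpolation (f : F -> F) :
  exists2 P : {poly F}, (size P <= p)%N & forall x, P.[x] = f x.
Proof.
exists (\sum_v f v *: (1 - ('X - v%:P) ^+ p.-1)).
  apply: (leq_trans (size_sum _ _ _)); apply/bigmax_leqP=> v _.
  apply: (leq_trans (size_scale_leq _ _)).
  rewrite (leq_trans (size_polyD _ _)) // size_polyN size_poly1 size_exp_XsubC.
  by rewrite prednK ?prime_gt0 // geq_max prime_gt0 /=.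
move=> x; rewrite horner_sum (bigD1 x) //= big1 ?addr0 => [|v vx].
  have p1 : (0 < p.-1)%N by rewrite -ltnS prednK ?prime_gt1 ?prime_gt0.
  by rewrite !hornerE subrr expr0n (gtn_eqF p1) subr0 mulr1.
by rewrite !hornerE Fp_expr_pred ?subrr ?mulr0 // subr_eq0 eq_sym.
Qed.

End PrimeField.

Lemma prime_odd_half (p : nat) : prime p -> (2 < p)%N -> p.-1 = (p.-1./2 * 2)%N.
Proof. by move=> hp p2; case: (even_prime hp) => [|po]; lia. Qed.

(** * Slopes of a function on F_p *)

Section Redei.

Variables (p : nat) (hp : prime p).
Local Notation F := 'F_p.

Lemma prime_ndvd_fact (n : nat) : (n < p)%N -> ~~ (p %| n`!)%N.
Proof.
elim: n => [|n IHn] np; first by rewrite fact0 dvdn1 gtn_eqF ?prime_gt1.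
rewrite factS Euclid_dvdM // negb_or IHn 1?ltnW // andbT.
by apply/negP=> /dvdn_leq; lia.
Qed.

Lemma bin_Fp_neq0 (R : fieldType) (iota : {rmorphism F -> R}) (n i : nat) :
  (i <= n < p)%N -> ('C(n, i))%:R != 0 :> R.
Proof.
move=> /andP[ni np]; rewrite -(rmorph_nat iota) fmorph_eq0 Fp_natr_eq0 //.
by apply: contra (prime_ndvd_fact np) => Cp; rewrite -(bin_fact ni) dvdn_mulr.
Qed.

Lemma sum_Fp_horner_max (Q : {poly F}) : (size Q <= p)%N ->
  \sum_(x : F) Q.[x] = - Q`_p.-1.
Proof.
move=> sQ; have p1 := prime_gt1 hp.
have {1}-> : Q = take_poly p.-1 Q + Q`_p.-1 *: 'X^(p.-1).
  apply/polyP=> i; rewrite coefD coefZ coefXn coef_take_poly.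
  case: ltngtP => ip; rewrite ?ip ?(mulr0, addr0, mulr1, add0r) //=.
  by rewrite nth_default // (leq_trans sQ) //; lia.
under eq_bigr do rewrite hornerD hornerZ hornerXn.
rewrite big_split /= (@sum_Fp_horner p hp F idfun) ?size_take_poly // add0r.
by rewrite -mulr_sumr sum_Fp_expr // dvdnn andbT (_ : (0 < p.-1)%N) ?mulrN1 //; lia.
Qed.

(* Redei--Megyesi, following Lovasz and Schrijver: the sums of the powers of
   f x - c x vanish for too many c. *)
Lemma few_slopes_affine (f : F -> F) (C : {set F}) :
    {in C, forall c, injective (fun x => f x - c * x)} ->
    (p.-1 <= #|C| * 2)%N ->
  exists a b, forall x, f x = a * x + b.
Proof.
move=> injC cardC; have [P sP Pf] := Fp_interpolation hp f.
have [sP2|sP2] := leqP (size P) 2.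
  exists P`_1, P`_0 => x; rewrite -Pf (horner_coef_wide _ sP2).
  by rewrite !big_ord_recl big_ord0 /= expr0 mulr1 expr1 addr0 addrC.
exfalso; have p2 : (2 < p)%N by lia.
have ph := prime_odd_half hp p2; set h := (p.-1./2)%N in ph.
have sum0 (i j : nat) : (i + j <= h)%N -> \sum_(x : F) x ^+ i * f x ^+ j = 0.
  set w := (i + j)%N => wh; have [w0|w0] := posnP w.
    have [-> ->] : i = 0%N /\ j = 0%N by lia.
    by under eq_bigr do rewrite mulr1; rewrite sum_Fp_expr.
  pose R := \poly_(k < w.+1) ((\sum_x f x ^+ (w - k) * (- x) ^+ k) *+ 'C(w, k)).
  have Rc c : R.[c] = \sum_x (f x - c * x) ^+ w.
    rewrite horner_poly; under [RHS]eq_bigr do rewrite exprDn.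
    rewrite exchange_big /=; apply: eq_bigr => k _.
    rewrite mulrnAl mulr_suml sumrMnl; congr (_ *+ _); apply: eq_bigr => x _.
    by rewrite -mulrN (mulrC c) exprMn mulrA.
  (* For [c] in [C] the map [f x - c * x] is a permutation, so [R] vanishes on [C]. Its coefficient
     of degree [w] is, up to sign, a power sum of exponent [w < p.-1], hence zero; the degree of [R]
     is thus below [w], which is at most [#|C|]. *)
  have R0 : R = 0.
    apply/eqP/negPn/negP=> /max_poly_roots /(_ _ (enum_uniq C)).
    rewrite -cardE => HR; have {}HR : (#|C| < size R)%N.
      apply: HR; apply/allP=> c; rewrite mem_enum rootE Rc => /injC injc.
      rewrite -(@reindex_inj _ _ _ _ (fun x => f x - c * x) xpredT (fun y => y ^+ w)) //.
      rewrite sum_Fp_expr // w0 /= ifN //.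
      by apply/negP=> /dvdn_leq; lia.
    have sR : (size R <= w)%N.
      apply/leq_sizeP=> k; rewrite leq_eqVlt coef_poly => /predU1P[<-|wk].
        rewrite ltnSn subnn binn mulr1n.
        under eq_bigr do rewrite mul1r -[- _]mulN1r exprMn.
        rewrite -mulr_sumr sum_Fp_expr // w0 /= ifN ?mulr0 //.
        by apply/negP=> /dvdn_leq; lia.
      by rewrite ltnS leqNgt wk.
    lia.
  have := coef0 F i; rewrite -{1}R0 coef_poly ifT; last lia.
  rewrite (_ : w - i = j)%N; last lia.
  rewrite -mulr_natr; move/eqP; rewrite mulf_eq0 (negbTE (bin_Fp_neq0 idfun _)) ?orbF; last lia.
  under eq_bigr do rewrite -[- _]mulN1r exprMn mulrCA.
  rewrite -mulr_sumr mulf_eq0 signr_eq0 /= => /eqP E; rewrite -[RHS]E.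
  by apply: eq_bigr => x _; rewrite mulrC.
(* The polynomial ['X^b * P ^+ a] has degree exactly [p - 1], so its values have a non-zero sum;
   [n >= 2] keeps [a + b] within the range of [sum0]. *)
pose n := (size P).-1; pose a := (p.-1 %/ n)%N; pose b := (p.-1 %% n)%N.
have P0 : P != 0 by rewrite -size_poly_gt0; lia.
have nab : p.-1 = (a * n + b)%N by exact: divn_eq.
have bn : (b < n)%N by rewrite ltn_mod; lia.
have abh : (b + a <= h)%N.
  have : (0 < a)%N by rewrite divn_gt0; lia.
  have : (2 <= n)%N by lia.
  case: (ltngtP a 1) => [|a2|a1] ?; first lia; last lia.
  by have [|] := leqP n 2; nia.
have sQ : size ('X^b * P ^+ a) = p.
  rewrite size_monicM ?monicXn ?expf_neq0 // size_polyXn.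
  rewrite -(@prednK (size (P ^+ a))) ?size_poly_gt0 ?expf_neq0 // size_exp -/n.
  by rewrite addnS /= addSn (mulnC n) addnC -nab; apply: prednK (prime_gt0 hp).
have := @sum_Fp_horner_max ('X^b * P ^+ a); rewrite sQ => /(_ (leqnn _)).
under eq_bigr do rewrite hornerM hornerXn horner_exp Pf.
rewrite sum0 // => /esym/eqP; rewrite oppr_eq0.
have {1}-> : p.-1 = (size ('X^b * P ^+ a)).-1 by rewrite sQ.
rewrite -lead_coefE.
by rewrite lead_coef_eq0 mulf_eq0 -size_poly_eq0 size_polyXn /= expf_eq0 (negbTE P0) andbF.
Qed.

End Redei.

Lemma exists_kernel_row (K : fieldType) (m n : nat) (A : 'M[K]_(m, n)) :
  (n < m)%N -> exists2 c : 'rV[K]_m, c != 0 & c *m A = 0.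
Proof.
move=> nm; have : kermx A != 0.
  by rewrite kermx_eq0 /row_free neq_ltn (leq_ltn_trans (rank_leq_col A)).
case/rowV0Pn=> c /sub_kermxP cA c0; by exists c.
Qed.

(** * Functions on F_p whose first powers all have small degree *)

Section BoundedPowers.

Variables (p : nat) (hp : prime p) (K : fieldType).
Local Notation F := 'F_p.
Variables (iota : {rmorphism F -> K}) (f : F -> K) (k E : nat).

Hypothesis powers : forall e, (e <= E)%N ->
  exists2 Q : {poly K}, (size Q <= k)%N & forall s, Q.[iota s] = f s ^+ e.
Hypothesis kp : (k < p)%N.

Lemma powers_compose (c : {poly K}) : (size c <= E.+1)%N ->
  exists2 Q : {poly K}, (size Q <= k)%N & forall s, Q.[iota s] = c.[f s].
Proof.
move=> sc; have Qex (e : 'I_E.+1) : exists Q : {poly K},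
    (size Q <= k)%N && [forall s, Q.[iota s] == f s ^+ e].
  have [Q sQ Qf] := powers (ltn_ord e : (e <= E)%N); exists Q.
  by rewrite sQ; apply/forallP=> s; rewrite Qf.
pose Q e := xchoose (Qex e).
exists (\sum_(e < E.+1) c`_e *: Q e).
  apply: (leq_trans (size_sum _ _ _)); apply/bigmax_leqP=> e _.
  apply: (leq_trans (size_scale_leq _ _)).
  by have /andP[] := xchooseP (Qex e).
move=> s; rewrite horner_sum (horner_coef_wide _ sc); apply: eq_bigr => e _.
by rewrite hornerZ; have /andP[_ /forallP/(_ s)/eqP->] := xchooseP (Qex e).
Qed.

(** The representative of degree below [p] is unique, hence is the one of degree below [k]: no
    polynomial of degree at most [E] in [f] has a degree in the gap from [k] to [p - 1]. *)
Lemma powers_gap (c : {poly K}) (P : {poly K}) : (size c <= E.+1)%N ->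
  (forall s, P.[iota s] = c.[f s]) -> (size P <= p)%N -> (size P <= k)%N.
Proof.
move=> /powers_compose[Q sQ Qc] Pc sP; rewrite (_ : P = Q) //.
apply: (poly_Fp_eq hp (iota := iota)) => // [|s]; last by rewrite Pc Qc.
by rewrite (leq_trans sQ) // ltnW.
Qed.

(** If [c] killed all values of [f], its cofactor [q] after removal of the root [f 0] would vanish
    wherever [f] differs from [f 0]. The values of [q] along [f] would then add up to [q.[f 0]]
    times a number strictly between 0 and [p], whereas a polynomial of degree below [p - 1] has sum
    zero. *)
Lemma powers_free (c : {poly K}) : (size c <= E.+1)%N -> c != 0 ->
  (exists s, f s != f 0) -> exists s, c.[f s] != 0.
Proof.
move=> sc c0 [s0 fs0]; apply/existsP; rewrite -negb_forall; apply/negP => /forallP cf0.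
have [n [q]] := multiplicity_XsubC c (f 0).
rewrite c0 /= => qf0 cq.
have q0 : q != 0 by apply: contraNneq qf0 => ->; rewrite root0.
have sq : (size q <= E.+1)%N.
  rewrite (leq_trans _ sc) // cq size_Mmonic ?monic_exp ?monicXsubC //.
  by rewrite size_exp_XsubC addnS leq_addr.
have [Q sQ Qq] := powers_compose sq.
have := @sum_Fp_horner p hp K iota Q; rewrite (leq_trans sQ) => [/(_ isT)|]; last lia.
under eq_bigr do rewrite Qq.
rewrite (bigID (fun s => f s == f 0)) /= [X in _ + X]big1 ?addr0 => [|s fs]; last first.
  have := cf0 s; rewrite cq hornerM horner_exp hornerXsubC.
  by rewrite mulf_eq0 expf_eq0 subr_eq0 (negbTE fs) andbF orbF => /eqP.
rewrite (eq_bigr (fun=> q.[f 0])) => [|s /eqP->//].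
rewrite sumr_const => /eqP; rewrite -mulr_natr mulf_eq0 -rootE (negbTE qf0) /=.
rewrite -(rmorph_nat iota) fmorph_eq0 Fp_natr_eq0 // => /dvdn_leq.
have card_gt0 : (0 < #|[pred s | f s == f 0%R]|)%N by apply/card_gt0P; exists 0; rewrite inE.
have card_lt : (#|[pred s | f s == f 0%R]| < #|F|)%N.
  by apply/proper_card/properP; split; [apply/subsetP | exists s0; rewrite ?inE].
by rewrite card_Fp // in card_lt => /(_ card_gt0); rewrite leqNgt card_lt.
Qed.

(** These are the degrees of the invariant forms: [k = m * i] with [m * t = p.-1] and [i] equal to
    [t / 2] rounded down or up. The second alternative is [i = (t + 1) / 2] for odd [t >= 3]. *)
Definition small_degree (m : nat) :=
  (k.*2 <= p.-1)%N || [&& ~~ odd m, k.*2 == p.-1 + m & m * 3 <= p.-1]%N.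

(* Let n > 1 be the degree of f.  Unless n > p / 2, some power of f has degree
   in [k, p - 1], which is impossible.  If n > p / 2, then the degrees of the
   polynomials in f of degree at most m / 2 also avoid [k, p - 1], as do their
   sums; this confines these degrees to m / 2 values, although these
   polynomials span a space of dimension m / 2 + 1. *)
Lemma bounded_powers_affine (m : nat) : small_degree m -> (k <= E.*2)%N ->
  exists a b, forall s, f s = a * iota s + b.
Proof.
move=> km kE; have p1 := prime_gt1 hp.
have k0 : (0 < k)%N.
  have [Q sQ Q1] := powers (leq0n E); rewrite (leq_trans _ sQ) // size_poly_gt0.
  by apply: contra_eq_neq (Q1 0) => ->; rewrite horner0 expr0 eq_sym oner_eq0.
have E0 : (0 < E)%N by lia.
have [P sP Pf] := powers E0.
have {}Pf s : P.[iota s] = f s by rewrite Pf expr1.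
have [sP2|sP2] := leqP (size P) 2.
  exists P`_1, P`_0 => s; rewrite -Pf (horner_coef_wide _ sP2).
  by rewrite !big_ord_recl big_ord0 /= expr0 mulr1 expr1 addr0 addrC.
exfalso; pose n := (size P).-1.
have P0 : P != 0 by rewrite -size_poly_gt0; lia.
have gap_power e : (e <= E)%N -> (n * e < p)%N -> (n * e < k)%N.
  move=> eE; rewrite /n -size_exp => sPe.
  have sPe0 : (0 < size (P ^+ e))%N by rewrite size_poly_gt0 expf_neq0.
  have := @powers_gap 'X^e (P ^+ e); rewrite size_polyXn => /(_ eE) gap.
  rewrite prednK //; apply: gap => [s|]; first by rewrite horner_exp Pf hornerXn.
  by rewrite -(prednK sPe0).
have kn : (p < k + n)%N.
  (* The least exponent with [k <= n * e]. If [k + n <= p], then [n * e < p], so the degree of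
     [P ^+ e] lies in the gap; [e <= E] because [n >= 2]. *)
  rewrite ltnNge; apply/negP=> nk; pose e := ((k.-1) %/ n).+1.
  have e1 : (k.-1 = (k.-1 %/ n) * n + k.-1 %% n)%N by exact: divn_eq.
  have e2 : (k.-1 %% n < n)%N by rewrite ltn_mod; lia.
  have eE : (e <= E)%N by rewrite /e; nia.
  have : (n * e < p)%N by rewrite /e mulnS mulnC; lia.
  by move/(gap_power _ eE); rewrite /e mulnS mulnC; lia.
move: km; rewrite /small_degree => /orP[|/and3P[m2 /eqP km mp]]; first lia.
have n2 : (p < n * 2)%N by have := gap_power 2%N; lia.
pose a := m./2.
pose repr (c Q : {poly K}) := [/\ (size c <= a.+1)%N, (size Q <= k)%N &
  forall s, Q.[iota s] = c.[f s]].
(* A product of two such polynomials has degree at most [m] in [f], and [m <= E]: from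
   [2 * k = p - 1 + m] and [3 * m <= p - 1] follows [2 * m <= k]. *)
have repr_gap c1 Q1 c2 Q2 : repr c1 Q1 -> repr c2 Q2 -> Q1 != 0 -> Q2 != 0 ->
    ((size Q1 + size Q2).-1 <= p)%N -> ((size Q1 + size Q2).-1 <= k)%N.
  move=> [sc1 sQ1 Q1c] [sc2 sQ2 Q2c] Q10 Q20; rewrite -size_mul //.
  apply: (@powers_gap (c1 * c2)) => [|s]; last by rewrite !hornerM Q1c Q2c.
  by rewrite (leq_trans (size_polyMleq _ _)) //; rewrite /a in sc1 sc2; lia.
have reprP : repr 'X P.
  by split=> //; [rewrite size_polyX; lia | move=> s; rewrite hornerX].
suff no_max j : forall c Q, repr c Q -> Q != 0 -> (k - size Q)%N = j -> False.
  exact: (no_max _ _ _ reprP P0 erefl).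
elim/ltn_ind: j => j IHj c1 Q1 r1 Q10 jE.
pose h := size Q1; have sQ1 : size Q1 = h by [].
have hmax c Q : repr c Q -> Q != 0 -> (size Q <= h)%N.
  move=> r Q0; rewrite leqNgt; apply/negP=> hQ; apply: (IHj _ _ c Q r Q0 erefl).
  by have [_ sQ _] := r; rewrite -jE; lia.
have hP : (n < h)%N by have := hmax _ _ reprP P0; rewrite /n; lia.
have hk : (h <= k)%N by have [_] := r1; rewrite sQ1.
have Qex (e : 'I_a.+1) : exists Q : {poly K},
    (size Q <= k)%N && [forall s, Q.[iota s] == f s ^+ e].
  have [|Q sQ Qf] := powers (_ : (e <= E)%N).
    by have := ltn_ord e; rewrite /a; lia.
  by exists Q; rewrite sQ; apply/forallP=> s; rewrite Qf.
pose Q e := xchoose (Qex e).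
(* Comparison with [Q1], of maximal size [h], and with itself by [repr_gap] leaves only two ranges
   for the degree of a combination: up to [k - h], or from [(p + 1) / 2] to [h - 1]. As
   [2 * k = p - 1 + m], these are [a] values in all, and [idx] lists them. Some non-trivial
   combination of the [a + 1] powers has zero coefficients there. *)
pose idx (j : nat) := (if j <= k - h then j else j - (k - h).+1 + p.+1./2)%N.
have [c c0 cA] := @exists_kernel_row K a.+1 a (\matrix_(e, j) (Q e)`_(idx j)) (leqnn _).
pose cp := \poly_(e < a.+1) c 0 (inord e).
pose R := \sum_(e < a.+1) c 0 e *: Q e.
have cp0 : cp != 0.
  apply: contraNneq c0 => cp0; apply/eqP/rowP=> e; have := coef0 K e.
  by rewrite -cp0 coef_poly ltn_ord inord_val mxE.
have rR : repr cp R.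
  split; first exact: size_poly.
    apply: (leq_trans (size_sum _ _ _)); apply/bigmax_leqP=> e _.
    apply: (leq_trans (size_scale_leq _ _)).
    by have /andP[] := xchooseP (Qex e).
  move=> s; rewrite horner_sum horner_poly; apply: eq_bigr => e _.
  rewrite hornerZ inord_val.
  by have /andP[_ /forallP/(_ s)/eqP->] := xchooseP (Qex e).
have R0 : R != 0.
  have [sc sR Rc] := rR; have [||s] := @powers_free cp _ cp0.
  - by rewrite (leq_trans sc) // /a; lia.
  - apply/existsP; rewrite -negb_forall; apply/negP=> /forallP fconst.
    have : P = (f 0)%:P.
      apply: (poly_Fp_eq hp (iota := iota)) => [||s]; first lia.
        by rewrite (leq_trans (size_polyC_leq1 _)); lia.
      by rewrite Pf hornerC; move/eqP: (fconst s).
    by move=> PC; move: sP2; rewrite PC; have := size_polyC_leq1 (f 0); lia.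
  by rewrite -Rc; apply: contraNneq => ->; rewrite horner0.
have Ridx (i : 'I_a) : R`_(idx i) = 0.
  have := congr1 (fun M : 'rV_a => M 0 i) cA; rewrite !mxE => cA0.
  by rewrite -[RHS]cA0 coef_sum; apply: eq_bigr => e _; rewrite mxE coefZ.
pose d := (size R).-1.
have sR0 : (0 < size R)%N by rewrite size_poly_gt0.
have Rd : R`_d != 0 by rewrite -lead_coefE lead_coef_eq0.
have dh : (d < h)%N by have := hmax _ _ rR R0; rewrite /d; lia.
have idxd (i : nat) : (i < a)%N -> idx i != d.
  by move=> ia; apply: contraNneq Rd => <-; apply/eqP/(Ridx (Ordinal ia)).
have g1 := repr_gap _ _ _ _ rR r1 R0 Q10.
have g2 := repr_gap _ _ _ _ rR rR R0 R0.
have [dk|dk] := leqP d (k - h).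
  have := idxd d; rewrite /idx dk eqxx.
  move=> /(_ _)/negP; apply=> //; rewrite /a; lia.
have : (p.+1./2 <= d)%N by lia.
move=> dp; have := idxd ((k - h).+1 + (d - p.+1./2))%N.
rewrite /idx ifN; last lia.
by move=> /(_ _)/negP; apply; [rewrite /a; lia | apply/eqP; lia].
Qed.

End BoundedPowers.

HB.instance Definition _ (U V : finZmodType) := Finite.on (U * V)%type.

(** * Suborbits and multipliers *)

Section StableSets.

Variable V : finZmodType.
Implicit Types (G : {group {perm V}}) (X : {set V}).

Definition diff_stable G X := forall g, g \in G ->
  forall x y : V, (g y - g x \in X) = (y - x \in X).

(* When G contains the translations, its blocks containing 0 are the stable
   subsets closed under addition. *)
Definition stable_primitive G := forall B : {set V}, diff_stable G B -> 0 \in B ->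
  {in B &, forall x y, x + y \in B} -> B = setT \/ B = [set 0].

Definition shift (v : V) : {perm V} := perm (@GRing.addrI V v).

Lemma shiftE v x : shift v x = v + x. Proof. by rewrite permE. Qed.

Lemma shift_group : group_set [set shift v | v : V].
Proof.
apply/group_setP; split=> [|_ _ /imsetP[u _ ->] /imsetP[v _ ->]].
  by apply/imsetP; exists 0 => //; apply/permP=> x; rewrite perm1 shiftE add0r.
apply/imsetP; exists (v + u) => //; apply/permP=> x.
by rewrite permM !shiftE addrA.
Qed.

Canonical shift_Group := Group shift_group.

(* When G contains the translations, this is the orbit of v under the stabiliser
   of 0, and the diff_stable sets are the unions of such orbits. *)
Definition suborbit G (v : V) : {set V} := [set g v - g 0 | g : {perm V} in G].

Lemma suborbit_refl G v : v \in suborbit G v.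
Proof. by apply/imsetP; exists 1%g; rewrite ?group1 // !perm1 subr0. Qed.

Lemma sub_suborbit G X v : diff_stable G X -> v \in X -> suborbit G v \subset X.
Proof.
by move=> sX vX; apply/subsetP=> _ /imsetP[g gG ->]; rewrite sX // subr0.
Qed.

Lemma stableC G X : diff_stable G X -> diff_stable G (~: X).
Proof. by move=> sX g gG x y; rewrite !inE sX. Qed.

Lemma stableU G X Y : diff_stable G X -> diff_stable G Y -> diff_stable G (X :|: Y).
Proof. by move=> sX sY g gG x y; rewrite !inE sX // sY. Qed.

Lemma stableD G X Y : diff_stable G X -> diff_stable G Y -> diff_stable G (X :\: Y).
Proof. by move=> sX sY g gG x y; rewrite !inE sX // sY. Qed.

Lemma stable0 G : diff_stable G [set 0].
Proof. by move=> g gG x y; rewrite !inE !subr_eq0 (inj_eq perm_inj). Qed.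

Section Regular.

Variable G : {group {perm V}}.
Hypothesis shiftG : forall v, shift v \in G.

Lemma shift_trans : [transitive G, on setT | 'P].
Proof.
apply/imsetP; exists 0; rewrite ?inE //; apply/esym/setP=> x; rewrite !inE.
by apply/imsetP; exists (shift x) => //=; rewrite apermE shiftE addr0.
Qed.

Lemma suborbit_in (x y w z : V) g : g \in G -> g x = w -> g y = z ->
  z - w \in suborbit G (y - x).
Proof.
move=> gG <- <-; apply/imsetP; exists (shift x * g)%g; first exact: groupM.
by rewrite !permM !shiftE addr0 [x + _]addrC subrK.
Qed.

Lemma suborbit_stable v : diff_stable G (suborbit G v).
Proof.
have sub h x y : h \in G -> y - x \in suborbit G v -> h y - h x \in suborbit G v.
  move=> hG /imsetP[g gG yx]; rewrite -[v]subr0.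
  apply: (@suborbit_in 0 v (h x) (h y) (g * shift (x - g 0) * h)%g).
  - by rewrite !groupM.
  - by rewrite !permM shiftE subrK.
  - by rewrite !permM shiftE addrAC -addrA -yx addrC subrK.
move=> g gG x y; apply/idP/idP; last exact: sub.
by move=> /(sub g^-1%g)-/(_ (groupVr gG)); rewrite !permK.
Qed.

Lemma two_closureP (pi : {perm V}) :
  reflect (forall x y, x != y -> exists g, [/\ g \in G, g x = pi x & g y = pi y])
          (pi \in two_closure G).
Proof.
apply: (iffP bigcapP) => [piG x y xy|piG E].
  pose E := orbit (@pair_action V) G (x, y).
  have EG : E \in orbital_digraphs G.
    rewrite inE imset_f ?inE //=; apply: contraNneq xy => Ed.
    by have : (x, y) \in E by [apply: orbit_refl]; rewrite Ed inE.
  have /astabsP/(_ (x, y)) := piG E EG; rewrite orbit_refl /= => /imsetP[g gG /= []].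
  by rewrite /pair_fun /= => e1 e2; exists g.
rewrite inE => /andP[/imsetP[[x y] _ ->{E}] Ed].
have xy : x != y.
  apply: contraNneq Ed => <-; apply/eqP/setP=> -[u v]; rewrite inE /=.
  apply/imsetP/eqP => [[g gG [-> ->]] //|<-].
  by exists (shift (u - x)) => //; rewrite /= /pair_fun /= shiftE subrK.
rewrite inE; apply/andP; split; rewrite ?inE //; apply/subsetP=> _ /imsetP[g gG ->].
rewrite inE /=; have [|h [hG hx hy]] := piG (g x) (g y).
  by rewrite (inj_eq perm_inj).
apply/imsetP; exists (g * h)%g; first exact: groupM.
by rewrite /= /pair_fun /= !permM hx hy.
Qed.

End Regular.

End StableSets.

Section Multiplier.

Variables (V : finZmodType) (G : {group {perm V}}).

(* Schur's multiplier theorem for a prime q.  The adjacency matrix A of the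
   Cayley digraph of X over 'F_q is a sum of commuting permutation matrices, so
   that A ^+ q is the adjacency matrix of the Cayley digraph of qX. *)
Lemma stable_mulrn_prime (q : nat) (X : {set V}) : prime q ->
    injective (fun x : V => x *+ q) -> diff_stable G X ->
  diff_stable G [set x *+ q | x in X].
Proof.
move=> hq injq sX.
have [n cardV] : exists n, #|V| = n.+1.
  by exists #|V|.-1; rewrite prednK //; apply/card_gt0P; exists 0.
pose d (i : 'I_n.+1) : V := enum_val (cast_ord (esym cardV) i).
pose r (x : V) : 'I_n.+1 := cast_ord cardV (enum_rank x).
have rK x : d (r x) = x by rewrite /d /r cast_ordK enum_rankK.
have dK i : r (d i) = i by rewrite /d /r enum_valK cast_ordKV.
have sum_d (E : V -> 'F_q) : \sum_i E (d i) = \sum_x E x.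
  by rewrite (reindex r) /=; [apply: eq_bigr => x _; rewrite rK | exists d => x _; rewrite ?rK ?dK].
pose A (Y : {set V}) : 'M['F_q]_n.+1 := \matrix_(i, j) (d j - d i \in Y)%:R.
pose P s := A [set s].
have PD s t : P s * P t = P (s + t).
  apply/matrixP=> i j; rewrite !mxE.
  rewrite (eq_bigr (fun k => ((d k == d i + s) && (d j - d k == t))%:R)); last first.
    move=> k _; rewrite !mxE !inE -natrM mulnb; congr ((_ && _)%:R).
    by rewrite subr_eq addrC.
  rewrite (sum_d (fun x => ((x == d i + s) && (d j - x == t))%:R)).
  rewrite (bigD1 (d i + s)) //= big1 => [|x /negbTE->//].
  by rewrite eqxx addr0 inE !subr_eq (addrC (d i) s) addrA (addrC t s).
have PX s k : P s ^+ k = P (s *+ k).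
  elim: k => [|k IHk]; last by rewrite exprS IHk PD mulrS.
  apply/matrixP=> i j; rewrite !mxE inE subr_eq0 (can_eq dK) eq_sym.
  by case: eqP.
have pchar : q \in [pchar 'M['F_q]_n.+1].
  apply/andP; split=> //; apply/eqP/matrixP=> i j.
  by rewrite mulmxnE mxE; have /andP[_ /eqP E] := pchar_Fp hq; rewrite mxE mulrnAC E mul0rn.
have AE Y : A Y = \sum_(s in Y) P s.
  apply/matrixP=> i j; rewrite summxE mxE.
  under eq_bigr do rewrite mxE inE.
  case: (boolP (d j - d i \in Y)) => dY.
    rewrite (bigD1 (d j - d i)) //= eqxx big1 ?addr0 // => s /andP[_].
    by rewrite eq_sym => /negbTE->.
  by rewrite big1 // => s sY; case: eqP dY => // ->; rewrite sY.
have AX : A X ^+ q = A [set x *+ q | x in X].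
  rewrite !AE big_imset /=; last by move=> x y _ _; apply: injq.
  rewrite -(eq_bigr _ (fun s _ => PX s q)).
  rewrite -!big_enum /=; elim: (enum X) => [|s l IHl].
    by rewrite !big_nil expr0n (gtn_eqF (prime_gt0 hq)).
  rewrite !big_cons -IHl -!(pFrobenius_autE pchar) pFrobenius_autD_comm //.
  by apply: commr_sum => t _; rewrite /GRing.comm !PD addrC.
pose M (g : {perm V}) : 'M['F_q]_n.+1 := \matrix_(i, j) (d j == g (d i))%:R.
(* Stability of a set is commutation of its adjacency matrix with the permutation matrices of the
   group, a property that passes from [A X] to its powers. *)
have comm Y g : GRing.comm (M g) (A Y) <-> forall x y, (g y - g x \in Y) = (y - x \in Y).
  have MA i j : (M g * A Y) i j = (d j - g (d i) \in Y)%:R.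
    rewrite mxE (eq_bigr (fun k => (d k == g (d i))%:R * (d j - d k \in Y)%:R)); last first.
      by move=> k _; rewrite !mxE.
    rewrite (sum_d (fun x => (x == g (d i))%:R * (d j - x \in Y)%:R)).
    rewrite (bigD1 (g (d i))) //= eqxx mul1r big1 ?addr0 // => x /negbTE->.
    by rewrite mul0r.
  have AM i j : (A Y * M g) i j = ((g^-1)%g (d j) - d i \in Y)%:R.
    rewrite mxE (eq_bigr (fun k => (d k - d i \in Y)%:R * (d j == g (d k))%:R)); last first.
      by move=> k _; rewrite !mxE.
    rewrite (sum_d (fun x => (x - d i \in Y)%:R * (d j == g x)%:R)).
    rewrite (bigD1 ((g^-1)%g (d j))) //= permKV eqxx mulr1 big1 ?addr0 // => x xg.
    have /negbTE-> : d j != g x by apply: contraNneq xg => ->; rewrite permK.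
    by rewrite mulr0.
  split=> [E x y|E].
    have := congr1 (fun B : 'M_n.+1 => B (r x) (r (g y))) E.
    rewrite /= MA AM !rK permK => /eqP.
    by rewrite (inj_eq (_ : injective (fun b : bool => b%:R : 'F_q))) => [/eqP//|[] []//=] /eqP;
      rewrite ?oner_eq0 // eq_sym oner_eq0.
  apply/matrixP=> i j; rewrite MA AM -{1}(permKV g (d j)) E //.
by move=> g gG; apply/comm; rewrite -AX; apply: commrX; apply/comm/sX.
Qed.

(** Induction on the prime factors of [n]: each is smaller than [p], so multiplication by it is
    injective on a group of exponent [p]. *)
Lemma stable_mulrn (p n : nat) (X : {set V}) : prime p ->
    (forall x : V, x *+ p = 0) -> (0 < n < p)%N -> diff_stable G X ->
  diff_stable G [set x *+ n | x in X].
Proof.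
move=> hp Vp; elim/ltn_ind: n X => n IHn X /andP[n0 np] sX.
have [n1|n1] := leqP n 1.
  have -> : n = 1%N by lia.
  by rewrite (eq_imset _ (fun x => mulr1n x)) imset_id.
have hq := pdiv_prime n1; have nq := divnK (pdiv_dvd n).
set q := pdiv n in hq nq; have q1 := prime_gt1 hq.
have n'0 : (0 < n %/ q)%N by rewrite divn_gt0 ?pdiv_gt0 // dvdn_leq // pdiv_dvd.
have injq : injective (fun x : V => x *+ q).
  move=> x y /eqP; rewrite -subr_eq0 -mulrnBl => /eqP xyq; apply/eqP; rewrite -subr_eq0.
  have [a _] := Bezoutl q (prime_gt0 hp).
  have -> : gcdn p q = 1%N.
    by apply/eqP; rewrite -/(coprime p q) prime_coprime //; apply/negP=> /dvdn_leq; nia.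
  case/dvdnP=> b E; have : (x - y) *+ (1 + a * q) = 0 by rewrite E mulnC mulrnA Vp mul0rn.
  by rewrite mulrnDr mulr1n mulnC mulrnA xyq mul0rn addr0 => ->.
have -> : [set x *+ n | x in X] = [set x *+ (n %/ q) | x in [set x *+ q | x in X]].
  by rewrite -imset_comp; apply: eq_imset => x /=; rewrite -mulrnA mulnC nq.
apply: IHn; [by nia | by nia | exact: stable_mulrn_prime].
Qed.

End Multiplier.

Definition two_transitive (T : finType) (N : {set {perm T}}) :=
  forall x y x' y' : T, x != y -> x' != y' -> exists g, [/\ g \in N, g x = x' & g y = y'].

Section TwoTransitive.

Variables (V : finZmodType) (G : {group {perm V}}).
Hypothesis shiftG : forall v, shift v \in G.

Lemma suborbit_sym v w : w \in suborbit G v -> v \in suborbit G w.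
Proof.
case/imsetP=> g gG ->; rewrite -[X in X \in _]subr0.
by apply: (suborbit_in shiftG (groupVr gG)); rewrite permK.
Qed.

Lemma suborbit_two_transitive :
  (forall v w, v != 0 -> w != 0 -> w \in suborbit G v) -> two_transitive G.
Proof.
move=> all x y x' y'; rewrite eq_sym -subr_eq0 [x' == _]eq_sym -(subr_eq0 y') => xy xy'.
have /imsetP[g gG E] := all _ _ xy xy'.
exists (shift (- x) * g * shift (x' - g 0))%g; split; rewrite ?groupM //.
  by rewrite !permM !shiftE addNr subrK.
by rewrite !permM !shiftE (addrC (- x)) addrAC -addrA -E addrC subrK.
Qed.

End TwoTransitive.

(** * Transitive groups of prime degree *)

Section Burnside.

Variables (p : nat) (hp : prime p).
Local Notation F := 'F_p.

Lemma stable_scale (G : {group {perm F}}) (X : {set F}) (c : F) : c != 0 ->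
  diff_stable G X -> diff_stable G [set c * x | x in X].
Proof.
move=> c0 sX; have -> : [set c * x | x in X] = [set x *+ (c : nat) | x in X].
  by apply: eq_imset => x; rewrite -mulr_natl natr_Zp.
apply: (stable_mulrn hp) => // [x|].
  by rewrite -mulr_natl (Fp_natr0 hp idfun) mul0r.
by rewrite lt0n; have := ltn_ord c; rewrite [X in (_ < X)%N]Fp_cast // => ->; rewrite andbT.
Qed.

(* The ratios (g y - g x) / (y - x) all belong to suborbit N 1, which is a group
   of scalars; if it is proper, it misses enough slopes for g to be affine. *)
Lemma burnside_prime_degree (N : {group {perm F}}) : (forall v, shift v \in N) ->
  two_transitive N \/ N \subset AGL1 p.
Proof.
move=> shiftN; pose S := suborbit N 1.
have S0 : 0 \notin S.
  by apply/imsetP=> -[g _ /eqP]; rewrite eq_sym subr_eq0 (inj_eq perm_inj) oner_eq0.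
have S1 : 1 \in S := suborbit_refl N 1.
have sub_scale d : d != 0 -> suborbit N d \subset [set d * x | x in S].
  move=> d0; apply: sub_suborbit; first exact/stable_scale/suborbit_stable.
  by apply/imsetP; exists 1; rewrite ?mulr1.
(* Symmetry of suborbits gives [S \subset suborbit N c], which lies in [c * S]; equality follows by
   counting, and [S] is closed under multiplication. *)
have scaleS c : c \in S -> [set c * x | x in S] = S.
  move=> cS; have c0 : c != 0 by apply: contraNneq S0 => <-.
  apply/esym/eqP; rewrite eqEcard card_imset ?leqnn ?andbT; last exact: mulfI.
  apply: subset_trans (sub_scale c c0); apply: sub_suborbit; first exact: suborbit_stable.
  exact: suborbit_sym.
have [S_all|] := boolP [forall v : F, (v != 0) ==> (v \in S)].
  left; apply: suborbit_two_transitive => // v w v0 w0.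
  have inS u : u != 0 -> u \in S by move=> u0; exact: (implyP (forallP S_all _)).
  apply: (subsetP (sub_suborbit (suborbit_stable shiftN v) (suborbit_sym shiftN (inS v v0)))).
  exact: inS.
rewrite negb_forall => /existsP[m]; rewrite negb_imply => /andP[m0 mS]; right.
(* The coset of [m] is disjoint from the group [S], so [S] contains at most half of the non-zero
   scalars. *)
have S2 : (#|S| * 2 <= p.-1)%N.
  have dis : [disjoint S & [set m * x | x in S]].
    apply/pred0P=> s /=; apply/negP=> /andP[sS /imsetP[x xS E]].
    move/negP: mS; apply; have x0 : x != 0 by apply: contraNneq S0 => <-.
    rewrite -(scaleS _ xS) in S1; case/imsetP: S1 => y yS E1.
    rewrite -(scaleS _ sS); apply/imsetP; exists y => //.
    by rewrite E -mulrA -E1 mulr1.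
  have sub0 : S :|: [set m * x | x in S] \subset [set~ 0].
    apply/subsetP=> x; rewrite !inE => /orP[xS|/imsetP[y yS ->]].
      by apply: contraNneq S0 => <-.
    by rewrite mulf_neq0 //; apply: contraNneq S0 => <-.
  have := subset_leq_card sub0.
  rewrite cardsU (disjoint_setI0 dis) cards0 subn0 (card_imset _ (mulfI m0)).
  by rewrite cardsC1 card_Fp // addnn -muln2.
apply/subsetP=> g gN; rewrite inE.
have [||a [b gab]] := @few_slopes_affine p hp g (~: S).
- move=> c; rewrite inE => cS x y /eqP E; apply: contraNeq cS => xy.
  have xy0 : y - x != 0 by rewrite subr_eq0 eq_sym.
  have := suborbit_in shiftN gN (erefl (g x)) (erefl (g y)).
  move/(subsetP (sub_scale _ xy0)) => /imsetP[s sS E1].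
  rewrite (_ : c = s) //; apply: (mulfI xy0); rewrite -E1.
  by rewrite -[g y](subrK (c * y)) -(eqP E); ring.
- have half a b q : (a * 2 <= q.-1)%N -> (1 < q)%N -> (a + b)%N = q -> (q.-1 <= b * 2)%N.
    by lia.
  by apply: half S2 (prime_gt1 hp) _; rewrite cardsC card_Fp.
apply/existsP; exists a; apply/existsP; exists b; apply/andP; split.
  apply/eqP=> a0; have := @perm_inj _ g 0 1; rewrite !gab a0 !mul0r => /(_ erefl)/eqP.
  by rewrite eq_sym oner_eq0.
by apply/forallP=> x; rewrite gab.
Qed.

End Burnside.

(** * Line-preserving permutations of the plane *)

Section Plane.

Variables (p : nat) (hp : prime p).
Local Notation F := 'F_p.
Local Notation V := (plane p).
Implicit Types (u v w x : V) (c d : F) (G : {group {perm V}}) (X : {set V}) (g : {perm V}).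

Definition scale2 (c : F) (v : V) : V := (c * v.1, c * v.2).
Definition det2 (u v : V) : F := u.1 * v.2 - u.2 * v.1.

Lemma plane_eq0 v : (v == 0) = (v.1 == 0) && (v.2 == 0).
Proof. by case: v. Qed.

Lemma scale2D c d v : scale2 (c + d) v = scale2 c v + scale2 d v.
Proof. by rewrite /scale2 !mulrDl. Qed.

Lemma scale2B c d v : scale2 (c - d) v = scale2 c v - scale2 d v.
Proof. by rewrite /scale2 !mulrBl. Qed.

Lemma scale2Dr c u v : scale2 c (u + v) = scale2 c u + scale2 c v.
Proof. by rewrite /scale2 !mulrDr. Qed.

Lemma scale2A c d v : scale2 c (scale2 d v) = scale2 (c * d) v.
Proof. by rewrite /scale2 !mulrA. Qed.

Lemma scale21 v : scale2 1 v = v.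
Proof. by case: v => a b; rewrite /scale2 !mul1r. Qed.

Lemma scale20 v : scale2 0 v = 0.
Proof. by rewrite /scale2 !mul0r. Qed.

Lemma scale2r0 c : scale2 c 0 = 0.
Proof. by rewrite /scale2 !mulr0. Qed.

Lemma scale2_natr n v : scale2 n%:R v = v *+ n.
Proof. by elim: n => [|n IHn]; rewrite ?scale20 // mulrSr scale2D IHn scale21 mulrSr. Qed.

Lemma scale2_eq0 c v : (scale2 c v == 0) = (c == 0) || (v == 0).
Proof. by rewrite !plane_eq0 /= !mulf_eq0; case: eqP. Qed.

Lemma scale2K c v : c != 0 -> scale2 c^-1 (scale2 c v) = v.
Proof. by move=> c0; rewrite scale2A mulVf // scale21. Qed.

Lemma det2vv v : det2 v v = 0.
Proof. by rewrite /det2 mulrC subrr. Qed.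

Lemma det2C u v : det2 u v = - det2 v u.
Proof. by rewrite /det2; ring. Qed.

Lemma det2Zr c u v : det2 u (scale2 c v) = c * det2 u v.
Proof. by rewrite /det2 /=; ring. Qed.

Lemma det2Zl c u v : det2 (scale2 c u) v = c * det2 u v.
Proof. by rewrite /det2 /=; ring. Qed.

Lemma det2Dr u v w : det2 u (v + w) = det2 u v + det2 u w.
Proof. by rewrite /det2 /=; ring. Qed.

Lemma det2Dl u v w : det2 (u + v) w = det2 u w + det2 v w.
Proof. by rewrite /det2 /=; ring. Qed.

Lemma det2Br u v w : det2 u (v - w) = det2 u v - det2 u w.
Proof. by rewrite /det2 /=; ring. Qed.

Lemma parallelP u v : u != 0 -> reflect (exists c, v = scale2 c u) (det2 u v == 0).
Proof.
move=> u0; apply: (iffP eqP) => [|[c ->]]; last by rewrite det2Zr det2vv mulr0.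
case: u v u0 => a b [c d]; rewrite /det2 /scale2 /= => ab0 /eqP.
rewrite subr_eq0 => /eqP E; have [a0|a0] := eqVneq a 0.
  have b0 : b != 0 by move: ab0; rewrite plane_eq0 /= a0 eqxx.
  exists (d / b); rewrite divfK //; congr pair.
  by move/eqP: E; rewrite a0 mul0r mulr0 eq_sym mulf_eq0 (negbTE b0) /= => /eqP.
exists (c / a); rewrite divfK //; congr pair; apply: (mulfI a0).
by rewrite E; field.
Qed.

Lemma plane_basis u v x : det2 u v != 0 ->
  x = scale2 (det2 x v / det2 u v) u + scale2 (det2 u x / det2 u v) v.
Proof.
case: u v x => a b [c d] [e f]; rewrite /det2 /scale2 /= => D0.
by apply: injective_projections => /=; field.
Qed.

Lemma exists_det2 u : u != 0 -> exists v, det2 u v = 1.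
Proof.
case: u => a b; have [->|a0] := eqVneq a 0 => ab0.
  have b0 : b != 0 by move: ab0; rewrite plane_eq0 /=.
  by exists (- b^-1, 0); rewrite /det2 /= mul0r sub0r mulrN opprK divff.
by exists (0, a^-1); rewrite /det2 /= mulr0 subr0 divff.
Qed.

Lemma card_plane : #|{: V}| = (p * p)%N.
Proof. by rewrite card_prod card_Fp. Qed.

Lemma stable_scale2 G X c : c != 0 -> diff_stable G X ->
  diff_stable G [set scale2 c x | x in X].
Proof.
move=> c0 sX; have -> : [set scale2 c x | x in X] = [set x *+ (c : nat) | x in X].
  by apply: eq_imset => x; rewrite -scale2_natr natr_Zp.
apply: (stable_mulrn hp) => // [x|].
  by rewrite -scale2_natr (Fp_natr0 hp idfun) scale20.
by rewrite lt0n; have := ltn_ord c; rewrite [X in (_ < X)%N]Fp_cast // => ->; rewrite andbT.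
Qed.

Definition scale_closed X := forall c v, c != 0 -> v \in X -> scale2 c v \in X.

(** This only says that the image of each line of direction [v] is collinear; that the images of
    parallel lines are parallel is a consequence, [parallel_image]. *)
Definition line_preserving g v :=
  forall x (s t : F), det2 (g (x + scale2 s v) - g x) (g (x + scale2 t v) - g x) = 0.

(** Take a direction [e] outside [X] as the vertical one. No two points of the curve differ by a
    multiple of [e], so the curve is the graph of a function [f], and [k] is not a slope of [f] when
    [e' + k e] is outside [X]. As [X] contains [p - 1] multiples of each of its directions, at least
    [(p - 1) / 2] slopes are missed. *)
Lemma few_directions_line (X : {set V}) (c : F -> V) :
    scale_closed X -> 0 \notin X -> (#|X| * 2 <= p * p - 1)%N ->
    (forall s t, s != t -> c s - c t \in X) ->
  forall s t u : F, det2 (c s - c u) (c t - c u) = 0.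
Proof.
move=> sX X0 cardX cX; have p1 := prime_gt1 hp.
have [e e0 eX] : exists2 e, e != 0 & e \notin X.
  have : ~~ ([set~ 0] \subset X).
    apply/negP=> /subset_leq_card; rewrite cardsC1 card_plane => le.
    by have := leq_trans (leq_mul le (leqnn 2)) cardX; nia.
  by case/subsetPn=> e; rewrite !inE => e0 eX; exists e.
have [e' ee'] := exists_det2 e0.
pose a v := det2 v e'; pose b v := det2 e v.
have vE v : v = scale2 (a v) e + scale2 (b v) e'.
  by rewrite {1}(@plane_basis e e' v) ee' ?oner_eq0 // !divr1.
have binj : injective (fun s => b (c s)).
  move=> s t /eqP; rewrite -subr_eq0 /b -det2Br => /(parallelP _ e0)[k E].
  apply: contraNeq eX => st; have k0 : k != 0.
    by apply: contraNneq X0 => k0; rewrite -(scale20 e) -k0 -E cX.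
  by rewrite -(scale2K e k0) -E sX ?invr_eq0 // cX.
pose f y := a (c (invF binj y)).
have cE s : c s = scale2 (f (b (c s))) e + scale2 (b (c s)) e'.
  by rewrite /f (invF_f binj) -vE.
pose C := [set k : F | e' + scale2 k e \notin X].
have abE l k : (a (scale2 l (e' + scale2 k e)) = l * k)
    * (b (scale2 l (e' + scale2 k e)) = l).
  split; first by rewrite /a det2Zl det2Dl det2vv det2Zl add0r ee' mulr1.
  by rewrite /b det2Zr det2Dr det2Zr det2vv ee' mulr0 addr0 mulr1.
have cardC : ((p - 1) * #|~: C| <= #|X|)%N.
  have -> : ((p - 1) * #|~: C| = #|setX [set~ (0%R : F)] (~: C)|)%N.
    by rewrite cardsX cardsC1 card_Fp // subn1.
  rewrite -(@card_in_imset _ _ (fun u : F * F => scale2 u.1 (e' + scale2 u.2 e))).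
    apply/subset_leq_card/subsetP=> x /imsetP[[l k] /setXP[]].
    by rewrite !inE negbK => l0 kX ->; apply: sX.
  move=> [l k] [l' k'] /setXP[]; rewrite !inE /= => l0 _ _ E.
  have El := congr1 b E; rewrite !abE in El; subst l'.
  have := congr1 a E; rewrite !abE => /(mulfI l0) ->//.
have [||A [B fE]] := @few_slopes_affine p hp f C.
- move=> k; rewrite inE => kX y y' /eqP E; apply: contraNeq kX => yy'.
  have yy0 : y - y' != 0 by rewrite subr_eq0.
  rewrite -(scale2K (e' + scale2 k e) yy0) sX ?invr_eq0 //.
  have := cX (invF binj y) (invF binj y').
  rewrite (inj_eq (can_inj (f_invF binj))) => /(_ yy').
  have cI z : c (invF binj z) = scale2 (f z) e + scale2 z e'.
    by rewrite [LHS]cE (f_invF binj).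
  rewrite !cI (_ : f y = f y' + k * (y - y')); last first.
    by rewrite -[f y](subrK (k * y)) (eqP E); ring.
  by congr (_ \in X); apply: injective_projections => /=; ring.
- have aux i j k q : ((q - 1) * j <= k)%N -> (k * 2 <= q * q - 1)%N -> (1 < q)%N ->
      (i + j)%N = q -> (q.-1 <= i * 2)%N.
    move=> jk kq q1 ij; have : ((q - 1) * (j * 2) <= (q - 1) * (q + 1))%N.
      by rewrite mulnA (leq_trans (leq_mul jk (leqnn 2))) // (leq_trans kq) //; lia.
    by rewrite leq_pmul2l; lia.
  by apply: aux cardC cardX p1 _; rewrite cardsC card_Fp.
move=> s t u.
have dE s' t' : c s' - c t' = scale2 (b (c s') - b (c t')) (e' + scale2 A e).
  rewrite {1}(cE s') {1}(cE t') !fE scale2Dr scale2A.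
  by apply: injective_projections => /=; ring.
by rewrite !dE det2Zl det2Zr det2vv !mulr0.
Qed.

End Plane.

Lemma det_mx2 (R : comNzRingType) (A : 'M[R]_2) :
  \det A = A 0 0 * A 1 1 - A 0 1 * A 1 0.
Proof.
rewrite (expand_det_row _ 0) !big_ord_recl big_ord0 /cofactor !det_mx11 !mxE /=.
rewrite addr0 expr0 expr1 mul1r mulN1r mulrN.
by congr (A _ _ * A _ _ - A _ _ * A _ _); apply/val_inj.
Qed.

Section Lines.

Variables (p : nat) (hp : prime p).
Local Notation F := 'F_p.
Local Notation V := (plane p).
Implicit Types (u v w x : V) (c d : F) (G : {group {perm V}}) (X : {set V}) (g : {perm V}).

Lemma stable_line_preserving G X g v : diff_stable G X -> scale_closed X ->
    0 \notin X -> (#|X| * 2 <= p * p - 1)%N -> g \in G -> v \in X ->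
  line_preserving g v.
Proof.
move=> stX scX X0 cardX gG vX x s t.
have := @few_directions_line p hp X (fun s => g (x + scale2 s v)) scX X0 cardX _ s t 0.
rewrite /= scale20 addr0; apply=> {}s {}t st.
by rewrite stX // opprD addrACA subrr add0r -scale2B scX ?subr_eq0.
Qed.

Lemma line_preservingZ g v c : line_preserving g v -> line_preserving g (scale2 c v).
Proof. by move=> gv x s t; rewrite !scale2A gv. Qed.

(** The position on the image line is an injective function of the position on the line, hence takes
    every value of F_p. *)
Lemma line_image g v x a : v != 0 -> line_preserving g v ->
  exists s, g (x + scale2 s v) = g x + scale2 a (g (x + v) - g x).
Proof.
move=> v0 gv; set w := g (x + v) - g x.
have w0 : w != 0.
  by rewrite subr_eq0 (inj_eq perm_inj) -subr_eq0 addrAC subrr add0r.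
have kP s : exists k, g (x + scale2 s v) - g x == scale2 k w.
  have /parallelP : det2 w (g (x + scale2 s v) - g x) == 0.
    by rewrite -(gv x 1 s) scale21.
  by case=> // k ->; exists k.
pose k s := xchoose (kP s).
have kE s : g (x + scale2 s v) = g x + scale2 (k s) w.
  by rewrite -(eqP (xchooseP (kP s))) [RHS]addrC subrK.
have kinj : injective k.
  move=> s t kst; have := kE s; rewrite kst -kE => /perm_inj/addrI/eqP.
  by rewrite -subr_eq0 -scale2B scale2_eq0 (negbTE v0) orbF subr_eq0 => /eqP.
by exists (invF kinj a); rewrite kE f_invF.
Qed.

Lemma det2_image_neq0 g u v : line_preserving g u -> det2 u v != 0 ->
  det2 (g u - g 0) (g v - g 0) != 0.
Proof.
move=> gu uv0.
have u0 : u != 0 by apply: contraNneq uv0 => ->; rewrite /det2 !mul0r subrr.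
have gu0 : g u - g 0 != 0 by rewrite subr_eq0 (inj_eq perm_inj).
apply: contraNneq uv0 => /eqP/(parallelP _ gu0)[a E].
have [s] := line_image 0 a u0 gu; rewrite !add0r -E addrC subrK => /perm_inj <-.
by rewrite det2Zr det2vv mulr0.
Qed.

(** Image lines that are not parallel meet in a point, whose preimage lies on both of the original
    lines; these then coincide, and so do their images. *)
Lemma parallel_image g v x s : v != 0 -> line_preserving g v ->
  det2 (g v - g 0) (g (x + scale2 s v) - g x) = 0.
Proof.
move=> v0 gv; set w := g v - g 0; set wx := g (x + v) - g x.
have wx0 : wx != 0.
  by rewrite subr_eq0 (inj_eq perm_inj) -subr_eq0 addrAC subrr add0r.
suff /eqP : det2 w wx = 0.
  have w0 : w != 0 by rewrite subr_eq0 (inj_eq perm_inj).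
  case/(parallelP _ w0)=> c E; have c0 : c != 0.
    by apply: contraNneq wx0 => c0; rewrite E c0 scale20.
  have := gv x 1 s; rewrite scale21 -/wx E det2Zl => /eqP.
  by rewrite mulf_eq0 (negbTE c0) => /eqP.
apply: contraTeq isT => det0.
have E := plane_basis (g x - g 0) det0.
set a := _ / _ in E; set b := det2 w _ / _ in E.
have [s1 E1] := line_image 0 a v0 gv; have [s2 E2] := line_image x (- b) v0 gv.
rewrite !add0r -/w in E1; rewrite -/wx in E2.
have /perm_inj xE : g (scale2 s1 v) = g (x + scale2 s2 v).
  rewrite E1 E2 -[g x](subrK (g 0)) E.
  by apply: injective_projections => /=; ring.
have {}xE : x = scale2 (s1 - s2) v by rewrite scale2B xE addrK.
have line0 t : det2 w (g (scale2 t v) - g 0) = 0.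
  by have := gv 0 1 t; rewrite !add0r scale21.
case/negP: det0; rewrite /wx -(subrK (g 0) (g x)) opprD addrA addrAC det2Br.
have -> : x + v = scale2 (s1 - s2 + 1) v by rewrite scale2D scale21 -xE.
by rewrite {1}xE !line0 subrr.
Qed.

(** In the basis of the image directions of [u] and [v], one coordinate [A] of [g] is constant along
    [v] and the other, [B], along [u]. The third direction makes the increments of [B] along [v]
    proportional to those of [A] along [u], from any pair of base points, so the increments do not
    depend on the base point. *)
Lemma three_directions_additive g u v : det2 u v != 0 -> line_preserving g u ->
    line_preserving g v -> line_preserving g (u + v) ->
  forall x y, g (x + y) - g x = g y - g 0.
Proof.
move=> uv0 gu gv guv.
have u0 : u != 0 by apply: contraNneq uv0 => ->; rewrite /det2 !mul0r subrr.
have v0 : v != 0 by apply: contraNneq uv0 => ->; rewrite /det2 !mulr0 subrr.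
have uvn0 : u + v != 0.
  apply: contraNneq uv0 => E; rewrite -[v](addKr u) E addr0 -[- u]scale21.
  by rewrite -(scale21 u) /det2 /=; apply/eqP; ring.
set w1 := g u - g 0; set w2 := g v - g 0; set w3 := g (u + v) - g 0.
have w12 : det2 w1 w2 != 0 by apply: det2_image_neq0.
have w13 : det2 w1 w3 != 0 by apply: det2_image_neq0; rewrite // det2Dr det2vv add0r.
have w32 : det2 w3 w2 != 0.
  by apply: det2_image_neq0; rewrite // det2Dl det2vv addr0.
pose A x := det2 (g x - g 0) w2; pose B x := det2 w1 (g x - g 0).
have AB y x : A y - A x = - det2 w2 (g y - g x) by rewrite /A /det2 /=; ring.
have BB y x : B y - B x = det2 w1 (g y - g x) by rewrite /B /det2 /=; ring.
have Av x s : A (x + scale2 s v) = A x.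
  by apply/eqP; rewrite -subr_eq0 AB parallel_image // oppr0.
have Bu x s : B (x + scale2 s u) = B x.
  by apply/eqP; rewrite -subr_eq0 BB parallel_image.
have ABuv x s : det2 w3 w2 * (B (x + scale2 s (u + v)) - B x) =
                det2 w1 w3 * (A (x + scale2 s (u + v)) - A x).
  rewrite AB BB; set z := g _ - g x.
  apply/eqP; rewrite mulrN -addr_eq0; apply/eqP.
  transitivity (det2 w1 w2 * det2 w3 z); first by rewrite /det2; ring.
  by rewrite /w3 /z parallel_image // mulr0.
pose A1 a := A (scale2 a u); pose B1 b := B (scale2 b v).
have xE x : x = scale2 (det2 x v / det2 u v) u + scale2 (det2 u x / det2 u v) v.
  exact: plane_basis.
have AE a b : A (scale2 a u + scale2 b v) = A1 a by rewrite Av.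
have BE a b : B (scale2 a u + scale2 b v) = B1 b by rewrite addrC Bu.
have A10 : A1 0 = 0 by rewrite /A1 scale20 /A subrr /det2 !mul0r subrr.
have B10 : B1 0 = 0 by rewrite /B1 scale20 /B subrr /det2 !mulr0 subrr.
have AB1 a b s : det2 w3 w2 * (B1 (b + s) - B1 b) = det2 w1 w3 * (A1 (a + s) - A1 a).
  have := ABuv (scale2 a u + scale2 b v) s.
  by rewrite scale2Dr addrACA -!scale2D !AE !BE.
clearbody A1 B1.
have A1D a s : A1 (a + s) = A1 a + A1 s.
  apply/eqP; rewrite [A1 a + _]addrC -subr_eq; apply/eqP/(mulfI w13).
  by rewrite -(AB1 a 0 s) (AB1 0 0 s) add0r A10 subr0.
have B1D b s : B1 (b + s) = B1 b + B1 s.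
  apply/eqP; rewrite [B1 b + _]addrC -subr_eq; apply/eqP/(mulfI w32).
  by rewrite (AB1 0 b s) -(AB1 0 0 s) add0r B10 subr0.
have AD x y : A (x + y) = A x + A y.
  by rewrite (xE x) (xE y) addrACA -!scale2D !AE A1D.
have BD x y : B (x + y) = B x + B y.
  by rewrite (xE x) (xE y) addrACA -!scale2D !BE B1D.
move=> x y; apply/eqP; rewrite -subr_eq0; apply/eqP.
set z := _ - _; rewrite (plane_basis z w12).
have -> : det2 z w2 = A (x + y) - A x - A y by rewrite /z /A /det2 /=; ring.
have -> : det2 w1 z = B (x + y) - B x - B y by rewrite /z /B /det2 /=; ring.
rewrite AD BD (_ : A x + A y - A x - A y = 0); last by ring.
by rewrite (_ : B x + B y - B x - B y = 0); [rewrite !mul0r !scale20 addr0 | ring].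
Qed.

Lemma additive_scale2 (h : V -> V) : {morph h : x y / x + y} ->
  forall c x, h (scale2 c x) = scale2 c (h x).
Proof.
move=> hD c x; have h0 : h 0 = 0 by apply: (addIr (h 0)); rewrite -hD !add0r.
rewrite -(natr_Zp c) !scale2_natr; elim: (c : nat) => [|n IHn] //.
by rewrite !mulrS hD IHn.
Qed.

Lemma additive_AGL2 g : (forall x y, g (x + y) - g x = g y - g 0) -> g \in AGL2 p.
Proof.
move=> gD; pose h x := g x - g 0.
have hD : {morph h : x y / x + y}.
  by move=> x y; rewrite /h -(gD x y) [RHS]addrC addrA subrK.
have hZ := additive_scale2 hD.
pose A : 'M[F]_2 := \matrix_(i, j) let v := h (if j == 0 then (1, 0) else (0, 1)) in
  if i == 0 then v.1 else v.2.
have hE x : h x = mulMv A x.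
  have {1}-> : x = scale2 x.1 (1, 0) + scale2 x.2 (0, 1).
    by case: x => a b; apply: injective_projections; rewrite /= ?mulr0 ?mulr1 ?addr0 ?add0r.
  rewrite hD !hZ /mulMv !mxE /=.
  by apply: injective_projections => /=; rewrite mulrC [_ * x.2]mulrC.
rewrite inE; apply/existsP; exists A; apply/existsP; exists (g 0).
apply/andP; split; last by apply/forallP=> x; rewrite -hE /h subrK.
rewrite unitmxE unitfE; apply/negP=> /eqP detA.
have hinj : injective h by move=> x y /addIr/perm_inj.
have h1 : h (1, 0) != 0.
  by rewrite /h subr_eq0 (inj_eq perm_inj) plane_eq0.
have : det2 (h (1, 0)) (h (0, 1)) == 0.
  have A00 : A 0 0 = (h (1, 0)).1 by rewrite mxE.
  have A10 : A 1 0 = (h (1, 0)).2 by rewrite mxE.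
  have A01 : A 0 1 = (h (0, 1)).1 by rewrite mxE.
  have A11 : A 1 1 = (h (0, 1)).2 by rewrite mxE.
  by rewrite -[X in _ == X]detA det_mx2 A00 A01 A10 A11 /det2 [X in _ == _ - X]mulrC.
case/(parallelP _ h1)=> c; rewrite -hZ => /hinj/eqP.
by rewrite /scale2 xpair_eqE /= mulr0 oner_eq0 andbF.
Qed.

End Lines.

(** * Binary forms invariant under the group *)

Section Weights.

Variables (p : nat) (hp : prime p).
Local Notation F := 'F_p.
Local Notation V := (plane p).
Implicit Types (u v w x : V) (c d : F).

Definition weight (k : nat) (f : V -> F) := forall c v, f (scale2 c v) = c ^+ k * f v.

Lemma scale2_inj c : c != 0 -> injective (scale2 c : V -> V).
Proof. by move=> c0; exact: can_inj (fun v => scale2K v c0). Qed.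

Lemma exists_expr_neq1 n : ~~ (p.-1 %| n)%N -> exists2 c : F, c != 0 & c ^+ n != 1.
Proof.
move=> ndvd; have p1 : (0 < p.-1)%N by have := prime_gt1 hp; lia.
have [|c c0 cn] := @Fp_expr_neq1 p hp (n %% p.-1).
  by rewrite ltn_mod p1 andbT lt0n.
by exists c; rewrite // (divn_eq n p.-1) exprD mulnC exprM Fp_expr_pred // expr1n mul1r.
Qed.

Lemma weight_moment0 k f i j : weight k f -> ~~ (p.-1 %| k + i + j)%N ->
  \sum_v f v * (v.1 ^+ i * v.2 ^+ j) = 0.
Proof.
move=> wf /exists_expr_neq1[c c0 cn]; apply/eqP; set s := \sum_v _.
have : (c ^+ (k + i + j) - 1) * s == 0.
  rewrite mulrBl mul1r subr_eq0 /s [eqbRHS](reindex_inj (scale2_inj c0)) /= mulr_sumr.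
  apply/eqP/eq_bigr=> v _; rewrite wf !exprMn !exprD.
  rewrite -!mulrA; congr (_ * _); rewrite [RHS]mulrCA; congr (_ * _).
  by rewrite mulrCA; congr (_ * _); rewrite mulrCA.
by rewrite mulf_eq0 subr_eq0 (negbTE cn).
Qed.

(** Multiplied by [a - b], the sum becomes [a ^+ p - b ^+ p = a - b]. Hence 1 minus this sum is the
    indicator of [a = b] as a polynomial, which is used for interpolation. *)
Lemma sum_geometric (a b : F) : \sum_(i < p) a ^+ (p.-1 - i) * b ^+ i = (a != b)%:R.
Proof.
have [->|ab] := eqVneq a b => /=.
  rewrite (eq_bigr (fun=> b ^+ p.-1)) => [|i _]; last first.
    by rewrite -exprD subnK // -ltnS prednK ?prime_gt0.
  by rewrite sumr_const card_ord (mulrn_pchar (pchar_Fp hp)).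
have ab0 : a - b != 0 by rewrite subr_eq0.
apply: (mulfI ab0); rewrite mulr1.
transitivity (a ^+ p - b ^+ p).
  rewrite subrXX; congr (_ * _); apply: eq_bigr => i _; rewrite -subn1 -subnDA add1n.
by have := expf_card a; have := expf_card b; rewrite card_Fp // => -> ->.
Qed.

(* Interpolation expresses the coefficients of f by its moments, and the weight
   kills every moment but those of total degree p - 1 - k or 2 (p - 1) - k. *)
Lemma weight_form (k : nat) (f : V -> F) : (0 < k < p.-1)%N -> weight k f ->
    (forall i j, (i + j = p.-1 - k)%N -> \sum_v f v * (v.1 ^+ i * v.2 ^+ j) = 0) ->
  exists a : nat -> F, forall x, f x = \sum_(b < k.+1) a b * (x.1 ^+ (k - b) * x.2 ^+ b).
Proof.
move=> /andP[k0 kp] wf mom0; pose mu i j := \sum_v f v * (v.1 ^+ i * v.2 ^+ j).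
(* A moment survives only if [i + j + k] is a multiple of [p - 1]; this number is positive and below
   [3 * (p - 1)], and the value [p - 1] is excluded by [mom0]. *)
have mu0 i j : (i < p)%N -> (j < p)%N -> (i + j + k != 2 * p.-1)%N -> mu i j = 0.
  move=> ip jp ijk; have [ijk1|ijk1] := eqVneq (i + j + k)%N p.-1.
    by apply: mom0; lia.
  apply: (weight_moment0 wf); apply/negP=> /dvdnP[q E].
  by case: q E => [|[|[|q]]] E; nia.
have mu00 i : (i < p)%N -> mu i 0%N = 0 by move=> ip; apply: mu0; lia.
have mu01 i : (i < p)%N -> mu 0%N i = 0 by move=> ip; apply: mu0; lia.
exists (fun b => mu (p.-1 - (k - b)) (p.-1 - b))%N => x.
pose E (a : F) i := a ^+ (p.-1 - i).
transitivity (\sum_v f v * ((1 - \sum_(i < p) E x.1 i * v.1 ^+ i) *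
                      (1 - \sum_(i < p) E x.2 i * v.2 ^+ i))).
  rewrite (bigD1 x) //= /E !sum_geometric !eqxx !subr0 !mulr1 big1 ?addr0 // => v vx.
  rewrite !sum_geometric.
  have [E1|] := eqVneq x.1 v.1; last by rewrite subrr mul0r mulr0.
  have [E2|] := eqVneq x.2 v.2; last by rewrite subrr !mulr0.
  by case/eqP: vx; apply: injective_projections.
transitivity (mu 0%N 0%N - (\sum_(i < p) E x.1 i * mu i 0%N) - (\sum_(j < p) E x.2 j * mu 0%N j)
    + \sum_(i < p) \sum_(j < p) E x.1 i * E x.2 j * mu i j).
  have -> : \sum_(i < p) E x.1 i * mu i 0%N =
      \sum_v f v * \sum_(i < p) E x.1 i * v.1 ^+ i.
    under eq_bigr do rewrite mulr_sumr; rewrite exchange_big; apply: eq_bigr => v _.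
    by rewrite mulr_sumr; apply: eq_bigr => i _; rewrite expr0 mulr1 mulrCA.
  have -> : \sum_(i < p) E x.2 i * mu 0%N i =
      \sum_v f v * \sum_(i < p) E x.2 i * v.2 ^+ i.
    under eq_bigr do rewrite mulr_sumr; rewrite exchange_big; apply: eq_bigr => v _.
    by rewrite mulr_sumr; apply: eq_bigr => i _; rewrite expr0 mul1r mulrCA.
  have -> : \sum_(i < p) \sum_(j < p) E x.1 i * E x.2 j * mu i j =
      \sum_v f v * ((\sum_(i < p) E x.1 i * v.1 ^+ i) * (\sum_(i < p) E x.2 i * v.2 ^+ i)).
    under eq_bigr do under eq_bigr do rewrite mulr_sumr.
    under eq_bigr do rewrite exchange_big; rewrite exchange_big; apply: eq_bigr => v _.
    rewrite mulr_suml mulr_sumr; apply: eq_bigr => i _.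
    rewrite mulr_sumr mulr_sumr; apply: eq_bigr => j _.
    by rewrite mulrCA; congr (_ * _); rewrite -!mulrA; congr (_ * _); rewrite mulrCA.
  rewrite /mu -!sumrB -big_split /=; apply: eq_bigr => v _.
  rewrite !expr0 mulr1 mulrBl mul1r !mulrBr !mulr1 opprB; ring.
rewrite mu00 ?prime_gt0 // big1 ?subr0 => [|i _]; last by rewrite mu00 ?mulr0.
rewrite big1 ?subr0 ?add0r => [|i _]; last by rewrite mu01 ?mulr0.
rewrite exchange_big (reindex_inj rev_ord_inj) /=.
rewrite (big_ord_widen p (fun j => mu (p.-1 - (k - j))%N (p.-1 - j)%N *
                             (x.1 ^+ (k - j) * x.2 ^+ j))); last lia.
rewrite [RHS]big_mkcond /=; apply: eq_bigr => j _; have jp := ltn_ord j.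
case: ifPn => jk.
  have ip : (p.-1 - (k - j) < p)%N by lia.
  rewrite (bigD1 (Ordinal ip)) //= big1 ?addr0 => [|i].
    by rewrite mulrC /E subnS; congr (mu _ _ * (_ ^+ _ * _ ^+ _)); lia.
  rewrite -val_eqE /= => ine; rewrite mu0 ?mulr0 //; [lia | move: ine].
  by have := ltn_ord i; lia.
by apply: big1 => i _; rewrite mu0 ?mulr0 //; have := ltn_ord i; lia.
Qed.

(* The point v is encoded as v.1 + v.2 Z, so that the coefficients of linmoment f e
   are, up to binomials, the moments of f of degree e. *)
Definition linpoly v : {poly F} := v.1%:P + v.2 *: 'X.

Lemma linpolyD : {morph linpoly : v w / v + w}.
Proof. by move=> v w; rewrite /linpoly polyCD scalerDl addrACA. Qed.

Lemma coef_linpolyX v e j : (linpoly v ^+ e)`_j =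
  if (j <= e)%N then v.1 ^+ (e - j) * v.2 ^+ j *+ 'C(e, j) else 0.
Proof.
rewrite /linpoly exprDn coef_sum.
rewrite (eq_bigr (fun i : 'I_e.+1 =>
    (v.1 ^+ (e - i) * v.2 ^+ i *+ 'C(e, i)) * (j == i)%:R)); last first.
  by move=> i _; rewrite exprZn -polyC_exp coefMn coefCM coefZ coefXn mulrA mulrnAl.
case: ifPn => je.
  rewrite (bigD1 (Ordinal (je : j < e.+1)%N)) //= eqxx mulr1 big1 ?addr0 // => i.
  by rewrite -val_eqE /= eq_sym => /negbTE->; rewrite mulr0.
by apply: big1 => i _; rewrite (gtn_eqF _) ?mulr0 //; have := ltn_ord i; lia.
Qed.

Definition linmoment (f : V -> F) e : {poly F} := \sum_v f v *: linpoly v ^+ e.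

Lemma coef_linmoment f e j : (linmoment f e)`_j =
  if (j <= e)%N then (\sum_v f v * (v.1 ^+ (e - j) * v.2 ^+ j)) *+ 'C(e, j) else 0.
Proof.
rewrite coef_sum; under eq_bigr do rewrite coefZ coef_linpolyX.
case: ifP => je; last by rewrite big1 // => v _; rewrite mulr0.
by rewrite -sumrMnl; apply: eq_bigr => v _; rewrite mulrnAr.
Qed.

Lemma linmoment0 k f e : weight k f -> ~~ (p.-1 %| k + e)%N -> linmoment f e = 0.
Proof.
move=> wf ke; apply/polyP=> j; rewrite coef0 coef_linmoment; case: ifP => // je.
by rewrite (weight_moment0 wf) ?mul0rn // -addnA subnK.
Qed.

Lemma linmoment_eq0 f e : (e < p)%N -> linmoment f e = 0 ->
  forall i j, (i + j = e)%N -> \sum_v f v * (v.1 ^+ i * v.2 ^+ j) = 0.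
Proof.
move=> ep f0 i j ije; have := coef0 F j; rewrite -{1}f0 coef_linmoment ifT; last lia.
rewrite (_ : e - j = i)%N; last lia.
rewrite -mulr_natr => /eqP; rewrite mulf_eq0 => /orP[/eqP//|].
by rewrite (negbTE (bin_Fp_neq0 hp idfun _)) //; lia.
Qed.

Lemma linmoment_const c : linmoment (fun=> c) p.-1 = 0.
Proof.
have p1 := prime_gt1 hp.
apply/polyP=> j; rewrite coef0 coef_linmoment; case: ifP => // je.
rewrite -mulr_sumr -(pair_bigA _ (fun a b : F => a ^+ (p.-1 - j) * b ^+ j)) /=.
rewrite -big_distrlr /= !sum_Fp_expr //.
have [->|j0] := posnP j; first by rewrite /= mulr0 mulr0 mul0rn.
rewrite [X in (if X then -1 else 0) * _](_ : _ = false) ?mul0r ?mulr0 ?mul0rn //.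
by apply/negP=> /andP[j1 /dvdn_leq]; lia.
Qed.

(* The product is the coefficient of 'C(p.-1, k1) in the expansion of
   sum_(v, w) f1 v * f2 w * (v + w)^(p - 1) = sum_u (f1 * f2)(u) * u^(p - 1). *)
Lemma linmomentM_eq0 (k1 k2 : nat) (f1 f2 : V -> F) : weight k1 f1 -> weight k2 f2 ->
    (0 < k1)%N -> (0 < k2)%N -> (k1 + k2 = p.-1)%N ->
    (forall u w, u != 0 -> w != 0 ->
       \sum_v f1 v * f2 (u - v) = \sum_v f1 v * f2 (w - v)) ->
  linmoment f1 k2 * linmoment f2 k1 = 0.
Proof.
move=> wf1 wf2 k10 k20 k12 conv; have p1 := prime_gt1 hp.
pose C u := \sum_v f1 v * f2 (u - v).
have CE : linmoment C p.-1 = 0.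
  rewrite -(linmoment_const (C (1, 0))); apply: eq_bigr => u _.
  (* The value of the convolution at 0 is immaterial, since [linpoly 0 ^+ p.-1 = 0]. *)
  have [->|u0] := eqVneq u 0; last by rewrite /C (conv u (1, 0)) // plane_eq0 oner_eq0.
  by rewrite /linpoly /= scale0r addr0 expr0n (_ : (p.-1 == 0)%N = false) ?scaler0 //; lia.
have : linmoment C p.-1 = \sum_(j < p.-1.+1)
    (linmoment f1 (p.-1 - j) * linmoment f2 j) *+ 'C(p.-1, j).
  transitivity (\sum_v \sum_w (f1 v * f2 w) *: (linpoly v + linpoly w) ^+ p.-1).
    rewrite /linmoment /C; under eq_bigr do rewrite scaler_suml.
    rewrite exchange_big; apply: eq_bigr => v _.
    rewrite (reindex_inj (addrI v)) /=; apply: eq_bigr => w _.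
    by rewrite addrAC subrr add0r linpolyD.
  under eq_bigr do under eq_bigr do rewrite exprDn scaler_sumr.
  under eq_bigr do rewrite exchange_big.
  rewrite exchange_big; apply: eq_bigr => j _ /=.
  rewrite mulr_suml -sumrMnl; apply: eq_bigr => v _.
  rewrite mulr_sumr -sumrMnl; apply: eq_bigr => w _.
  by rewrite -scalerMnr -scalerAl -scalerAr scalerA.
have k1p : (k1 < p.-1.+1)%N by lia.
rewrite CE (bigD1 (Ordinal k1p)) //= big1 ?addr0 => [|j]; last first.
  rewrite -val_eqE /= => jk; rewrite (linmoment0 wf2) ?mulr0 ?mul0rn //.
  apply/negP=> /dvdnP[q]; have := ltn_ord j.
  by case: q => [|[|q]]; nia.
rewrite (_ : p.-1 - k1 = k2)%N; last lia.
move/esym/eqP; rewrite -scaler_nat scaler_eq0 => /orP[|/eqP//].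
by rewrite (negbTE (bin_Fp_neq0 hp idfun _)) //; lia.
Qed.

End Weights.

Section Character.

Variables (p : nat) (hp : prime p).
Local Notation F := 'F_p.
Local Notation V := (plane p).
Implicit Types (u v w x : V) (c d : F).
Variable G : {group {perm V}}.
Hypothesis shiftG : forall v : V, shift v \in G.

Lemma suborbit_neq0 v w : v != 0 -> w \in suborbit G v -> w != 0.
Proof.
by move=> v0 /imsetP[g _ ->]; rewrite subr_eq0 (inj_eq perm_inj).
Qed.

Lemma suborbit_eq v w : w \in suborbit G v -> suborbit G w = suborbit G v.
Proof.
move=> wv; apply/eqP; rewrite eqEsubset (sub_suborbit (suborbit_stable shiftG v) wv).
exact: sub_suborbit (suborbit_stable shiftG w) (suborbit_sym shiftG wv).
Qed.

Lemma suborbit_scale2 c v : c != 0 ->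
  suborbit G (scale2 c v) = [set scale2 c x | x in suborbit G v].
Proof.
have sub d w : d != 0 -> suborbit G (scale2 d w) \subset [set scale2 d x | x in suborbit G w].
  move=> d0; apply: sub_suborbit; first exact/stable_scale2/suborbit_stable.
  by apply/imsetP; exists w => //; apply: suborbit_refl.
move=> c0; apply/eqP; rewrite eqEsubset sub //=; apply/subsetP=> _ /imsetP[x xv ->].
have : x \in suborbit G (scale2 c^-1 (scale2 c v)) by rewrite scale2K.
move/(subsetP (sub _ _ (invr_neq0 c0)))=> /imsetP[y yv ->].
by rewrite scale2A divff // scale21.
Qed.

(** The scalars that map the suborbit [S] of [v0] to itself form a group [M] of order [m], whose
    elements are roots of unity of order [m]. So [c ^+ m] depends only on the multiple [c * S], and
    [psi] takes this value on it. The index [t] of [M] exceeds 1 because [w0] lies outside [S]. *)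
Lemma invariant_character v0 w0 : v0 != 0 -> w0 != 0 -> w0 \notin suborbit G v0 ->
    (forall v, v != 0 -> exists2 c, c != 0 & scale2 c v \in suborbit G v0) ->
  exists m t psi, [/\ (m * t = p.-1)%N, (1 < t)%N, weight m psi,
    forall v, v != 0 -> psi v != 0 &
    forall g, g \in G -> forall x y, psi (g y - g x) = psi (y - x)].
Proof.
move=> v00 w00 w0v0 cov; pose S := suborbit G v0.
pose M := [set c : F | (c != 0) && (scale2 c v0 \in S)]; pose m := #|M|.
have ME c v : c != 0 -> v \in S -> (scale2 c v \in S) = (c \in M).
  move=> c0 vS; rewrite inE c0 /=.
  have cSE u : u \in S -> scale2 c u \in S -> suborbit G (scale2 c v0) = S.
    move=> uS cuS; rewrite suborbit_scale2 // -(suborbit_eq uS) -suborbit_scale2 //.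
    by rewrite (suborbit_eq cuS).
  apply/idP/idP => [cvS|cv0S]; last first.
    rewrite -(cSE _ _ cv0S) ?suborbit_refl // suborbit_scale2 //.
    by apply/imsetP; exists v.
  by rewrite -(cSE _ vS cvS) suborbit_refl.
have p1 := prime_gt1 hp.
have M1 : 1 \in M by rewrite inE oner_eq0 scale21 suborbit_refl.
have MM c d : c \in M -> (c * d \in M) = (d \in M).
  move=> cM; have /andP[c0 cS] : (c != 0) && (scale2 c v0 \in S) by rewrite inE in cM.
  rewrite inE mulf_eq0 (negbTE c0) /= inE mulrC -scale2A.
  have [//|d0] /= := eqVneq d 0.
  by rewrite ME // inE d0.
have M_root c : c \in M -> c ^+ m = 1.
  move=> cM; have c0 : c != 0 by move: cM; rewrite inE => /andP[].
  have prod0 : \prod_(d in M) d != 0.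
    by apply/prodf_neq0 => d; rewrite inE => /andP[].
  apply: (mulIf prod0); rewrite mul1r [RHS](reindex_inj (mulfI c0)) /=.
  rewrite [RHS](eq_bigl (fun d => d \in M)) => [|d]; last exact: MM.
  by rewrite big_split /= prodr_const.
have [t tE] : exists t, (m * t = p.-1)%N.
  have m0 : (0 < m)%N by apply/card_gt0P; exists 1.
  (* All [m] elements of [M] are roots of unity of order [gcdn m p.-1], and there are at most that
     many. *)
  have : (m <= gcdn m p.-1)%N.
    rewrite {1}/m cardE; apply: max_unity_roots; [by rewrite gcdn_gt0 m0 | | exact: enum_uniq].
    apply/allP=> c; rewrite mem_enum unity_rootE => cM.
    have [a b E _] := egcdnP p.-1 m0.
    have : c ^+ (a * m) = 1 by rewrite mulnC exprM M_root // expr1n.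
    have c0 : c != 0 by move: cM; rewrite inE => /andP[].
    by rewrite E exprD [(b * _)%N]mulnC exprM (Fp_expr_pred hp c0) expr1n mul1r => ->.
  move=> mg; have : (m %| p.-1)%N.
    by rewrite -(eqP (_ : gcdn m p.-1 == m)) ?dvdn_gcdr // eqn_leq mg dvdn_leq ?dvdn_gcdl.
  by case/dvdnP=> t ->; exists t; rewrite mulnC.
have cofP v : exists c, (v == 0) || ((c != 0) && (scale2 c v \in S)).
  have [|v0'] := eqVneq v 0; first by exists 0.
  by have [c c0 cS] := cov v v0'; exists c; rewrite c0.
pose cof v := xchoose (cofP v).
have cofE v : v != 0 -> cof v != 0 /\ scale2 (cof v) v \in S.
  move=> v0'; have : (v == 0) || _ := xchooseP (cofP v); rewrite -/(cof v).
  by case/orP=> [/idPn//|/andP[]].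
pose psi v := if v == 0 then 0 else (cof v) ^- m.
have psiP v c : v != 0 -> c != 0 -> scale2 c v \in S -> psi v = c ^- m.
  move=> v0' c0 cS; rewrite /psi (negbTE v0'); congr (_^-1).
  have [d0 dS] := cofE v v0'; set d := cof v in d0 dS *.
  have : c / d \in M by rewrite -(ME _ _ _ dS) ?mulf_neq0 ?invr_eq0 // scale2A divfK.
  move/M_root; rewrite exprMn exprVn => E.
  by rewrite -[c ^+ m](divfK (_ : d ^+ m != 0)) ?expf_neq0 // E mul1r.
have t1 : (1 < t)%N.
  case: t tE => [|[|t]] // E; first by move: E; rewrite muln0; lia.
  have [c c0 cS] := cov w0 w00; case/negP: w0v0; rewrite -(scale2K w0 c0) ME ?invr_eq0 //.
  have : M \subset [set~ 0] by apply/subsetP=> d; rewrite !inE => /andP[].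
  move/subset_cardP; rewrite cardsC1 card_Fp // -E muln1 => /(_ erefl) ->.
  by rewrite !inE invr_eq0.
exists m, t, psi; split=> //.
- have m0 : (0 < m)%N by case: (m) tE => //; lia.
  move=> c v; have [->|c0] := eqVneq c 0.
    by rewrite scale20 /psi eqxx expr0n (gtn_eqF m0) mul0r.
  have [->|v0'] := eqVneq v 0; first by rewrite scale2r0 /psi eqxx mulr0.
  have [d0 dS] := cofE v v0'.
  rewrite (psiP v (cof v)) // (psiP _ (cof v / c)) ?scale2_eq0 ?negb_or ?c0 ?mulf_neq0 ?invr_eq0 //.
    by rewrite exprMn exprVn invfM invrK mulrC.
  by rewrite scale2A divfK.
- by move=> v v0'; have [d0 _] := cofE v v0'; rewrite /psi (negbTE v0') invr_eq0 expf_neq0.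
- move=> g gG x y; have [->|xy] := eqVneq x y; first by rewrite !subrr.
  have yx0 : y - x != 0 by rewrite subr_eq0 eq_sym.
  have [d0 dS] := cofE _ yx0; rewrite (psiP _ _ yx0 d0 dS); apply: psiP => //.
    by rewrite subr_eq0 (inj_eq perm_inj) eq_sym.
  have := suborbit_in shiftG gG (erefl (g x)) (erefl (g y)).
  set z := g y - g x; move=> zyx.
  rewrite -[S]/(suborbit G v0) -(suborbit_eq dS) suborbit_scale2 //.
  by apply/imsetP; exists z.
Qed.

End Character.

Section InvariantForm.

Variables (p : nat) (hp : prime p).
Local Notation F := 'F_p.
Local Notation V := (plane p).
Implicit Types (u v w x : V) (c d : F).
Variable G : {group {perm V}}.
Hypothesis shiftG : forall v : V, shift v \in G.

Lemma weightX m i psi : weight m psi -> weight (m * i) (fun v : V => psi v ^+ i).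
Proof. by move=> wpsi c v; rewrite wpsi exprMn exprM. Qed.

(** The weights of [psi ^+ i1] and [psi ^+ i2] add up to [m * t = p - 1]. Their convolution is
    invariant under the group and, by [c ^+ p.-1 = 1], under scalars, hence constant off 0. By
    [linmomentM_eq0] one of the two powers has vanishing moments in the degree complementary to its
    weight, as [weight_form] requires. *)
Lemma invariant_form v0 w0 : v0 != 0 -> w0 != 0 -> w0 \notin suborbit G v0 ->
    (forall v w, v != 0 -> w != 0 ->
       exists2 c, c != 0 & scale2 c w \in suborbit G v) ->
  exists k m (f : V -> F) (a : nat -> F), [/\ (0 < k < p.-1)%N, small_degree p k m,
    forall g, g \in G -> forall x y, f (g y - g x) = f (y - x),
    forall v, v != 0 -> f v != 0 &
    forall x, f x = \sum_(b < k.+1) a b * (x.1 ^+ (k - b) * x.2 ^+ b)].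
Proof.
move=> v00 w00 w0v0 cov.
have [m [t [psi [mt t1 wpsi psi0 psiG]]]] :=
  invariant_character hp shiftG v00 w00 w0v0 (fun v => cov v0 v v00).
pose i1 := t./2; pose i2 := (t - i1)%N.
have p1 := prime_gt1 hp.
have m0 : (0 < m)%N by case: (m) mt => //; lia.
have k1E : (m * i1 + m * i2 = p.-1)%N by rewrite -mulnDr /i2 subnKC ?mt // /i1; lia.
have k10 : (0 < m * i1)%N by rewrite muln_gt0 m0 /i1; lia.
have k20 : (0 < m * i2)%N by rewrite muln_gt0 m0 /i2 /i1; lia.
have conv u w : u != 0 -> w != 0 ->
    \sum_v psi v ^+ i1 * psi (u - v) ^+ i2 = \sum_v psi v ^+ i1 * psi (w - v) ^+ i2.
  move=> u0 w0'; have [c c0 /imsetP[g gG cw]] := cov u w u0 w0'.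
  transitivity (\sum_v psi v ^+ i1 * psi (scale2 c w - v) ^+ i2).
    rewrite [RHS](reindex_inj (_ : injective (fun v => g v - g 0))) /=; last first.
      by move=> x y /addIr/perm_inj.
    apply: eq_bigr => v _; rewrite psiG // subr0 cw.
    by rewrite opprB addrA subrK psiG.
  rewrite [LHS](reindex_inj (scale2_inj c0)) /=; apply: eq_bigr => v _.
  have -> : scale2 c w - scale2 c v = scale2 c (w - v).
    by apply: injective_projections => /=; rewrite mulrBr.
  rewrite !wpsi !exprMn mulrACA -!exprM -exprD -mulnDr /i2 subnKC ?mt; last by rewrite /i1; lia.
  by rewrite Fp_expr_pred // mul1r.
have form i : (0 < m * i < p.-1)%N -> small_degree p (m * i) m ->
    linmoment (fun v => psi v ^+ i) (p.-1 - m * i) = 0 ->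
    exists k m (f : V -> F) (a : nat -> F), [/\ (0 < k < p.-1)%N, small_degree p k m,
      forall g, g \in G -> forall x y, f (g y - g x) = f (y - x),
      forall v, v != 0 -> f v != 0 &
      forall x, f x = \sum_(b < k.+1) a b * (x.1 ^+ (k - b) * x.2 ^+ b)].
  move=> ik sik lin0; have [|a aE] := weight_form hp ik (weightX i wpsi).
    by move=> j l jl; apply: (linmoment_eq0 hp _ lin0); lia.
  exists (m * i)%N, m, (fun v => psi v ^+ i), a; split=> // [g gG x y|v v0'].
    by rewrite psiG.
  by rewrite expf_neq0 // psi0.
have := linmomentM_eq0 hp (weightX i1 wpsi) (weightX i2 wpsi) k10 k20 k1E conv.
move/eqP; rewrite mulf_eq0 => /orP[] /eqP.
  move=> lin0; apply: (form i1); first lia.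
    by rewrite /small_degree; apply/orP; left; rewrite /i1; nia.
  by rewrite (_ : p.-1 - m * i1 = m * i2)%N //; lia.
move=> lin0; apply: (form i2); first lia; last first.
  by rewrite (_ : p.-1 - m * i2 = m * i1)%N //; lia.
rewrite /small_degree; case: (boolP (odd t)) => todd; last first.
  by apply/orP; left; rewrite /i2 /i1; nia.
have t3 : (3 <= t)%N by lia.
apply/orP; right; apply/and3P; split.
- apply/negP=> modd; have : odd p.-1 by rewrite -mt oddM modd.
  have [p2|podd] := even_prime hp; last by lia.
  by rewrite p2 in mt; nia.
- by apply/eqP; rewrite /i2 /i1; nia.
- by rewrite -mt leq_mul2l t3 orbT.
Qed.

End InvariantForm.

(** * Apolarity and powers of linear forms *)

Section Sylvester.

Variables (K : closedFieldType) (k : nat) (a : nat -> K).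

Definition umbral (P : {poly K}) := \sum_(i < k.+1) P`_i * a i.

Lemma umbralD P Q : umbral (P + Q) = umbral P + umbral Q.
Proof. by rewrite /umbral -big_split; apply: eq_bigr => i _; rewrite coefD mulrDl. Qed.

Lemma umbralZ c P : umbral (c *: P) = c * umbral P.
Proof. by rewrite /umbral mulr_sumr; apply: eq_bigr => i _; rewrite coefZ mulrA. Qed.

Lemma umbral_sum (I : finType) (P : I -> {poly K}) :
  umbral (\sum_i P i) = \sum_i umbral (P i).
Proof.
rewrite /umbral exchange_big; apply: eq_bigr => i _.
by rewrite coef_sum mulr_suml.
Qed.

Lemma umbralXn b : (b <= k)%N -> umbral 'X^b = a b.
Proof.
move=> bk; rewrite /umbral (bigD1 (Ordinal (bk : b < k.+1)%N)) //= coefXn eqxx mul1r.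
rewrite big1 ?addr0 // => i; rewrite -val_eqE /= coefXn => /negbTE->.
by rewrite mul0r.
Qed.

(* A binary form of degree k is, by means of its values a i on monomials, a
   functional on binary forms.  The contraction by a linear factor of an
   apolar form of minimal degree is a power of a linear form. *)
Lemma sylvester : (0 < k)%N -> (exists2 i, (i <= k)%N & a i != 0) ->
  exists j (q : {poly K}) (s t : K), [/\ (k <= j.*2)%N, (j <= k)%N, (size q <= (k - j).+1)%N,
    (s != 0) || (t != 0) &
    forall b, (b <= j)%N -> umbral ('X^b * q) = s ^+ (j - b) * t ^+ b].
Proof.
move=> k0 [i0 i0k ai0].
pose apolar r (q : {poly K}) := (size q <= r.+1)%N /\
  forall b, (b <= k - r)%N -> umbral ('X^b * q) = 0.
pose A r : 'M[K]_(r.+1, (k - r).+1) := \matrix_(i, b) umbral ('X^b * 'X^i).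
have AP r (q : {poly K}) (b : 'I_(k - r).+1) : (size q <= r.+1)%N ->
    ((\row_(i < r.+1) q`_i) *m A r) 0 b = umbral ('X^b * q).
  move=> sq; rewrite mxE {2}(_ : q = \sum_(i < r.+1) q`_i *: 'X^i); last first.
    rewrite -poly_def; apply/polyP=> i; rewrite coef_poly; case: ltnP => // ri.
    by rewrite nth_default // (leq_trans sq).
  rewrite mulr_sumr umbral_sum; apply: eq_bigr => i _.
  by rewrite !mxE -scalerAr umbralZ.
(* For [r = k / 2 + 1] the [r + 1] coefficients of a form outnumber the [k - r + 1] conditions of
   apolarity. *)
have exA : exists r, ~~ row_free (A r).
  exists (k./2.+1); rewrite /row_free neq_ltn (leq_ltn_trans (rank_leq_col _)) //; lia.
case: (ex_minnP exA) => r Ar rmin.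
have nonapolar r' q : (r' < r)%N -> apolar r' q -> q = 0.
  move=> r'r [sq q0]; have free : row_free (A r') by apply: contraLR r'r => /rmin; rewrite -leqNgt.
  have : (\row_(i < r'.+1) q`_i) *m A r' = 0.
    by apply/rowP=> b; rewrite AP // q0 ?mxE // -ltnS.
  move/(congr1 (mulmxr (pinvmx (A r')))); rewrite /= mulmxKp // mul0mx => /rowP E.
  apply/polyP=> i; rewrite coef0; have [ri|ri] := leqP r'.+1 i.
    by rewrite nth_default // (leq_trans sq).
  by have := E (Ordinal ri); rewrite !mxE.
have [q q0 [sq qA]] : exists2 q, q != 0 & apolar r q.
  move: Ar; rewrite -kermx_eq0 => /rowV0Pn[c /sub_kermxP cA c0].
  exists (rVpoly c).
    by apply: contraNneq c0 => c0; rewrite -[c]rVpolyK c0 linear0.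
  split=> [|b bk]; first exact: size_poly.
  rewrite -[b]/(val (Ordinal (bk : b < (k - r).+1)%N)) -AP; last exact: size_poly.
  by rewrite -/(poly_rV _) rVpolyK cA mxE.
have r0 : (0 < r)%N.
  rewrite lt0n; apply: contraNneq ai0 => r0; move: sq qA; rewrite r0 subn0 => /size1_polyC qC qA.
  have := qA i0 i0k; rewrite qC mulrC mul_polyC umbralZ umbralXn // => /eqP.
  by rewrite mulf_eq0 => /orP[/eqP E|//]; move: q0; rewrite qC E eqxx.
have rk : (r <= k./2.+1)%N.
  by apply: rmin; rewrite /row_free neq_ltn (leq_ltn_trans (rank_leq_col _)) //; lia.
have rk' : (r <= k)%N by lia.
pose j := (k - r).+1.
have jk : (k - j = r.-1)%N by rewrite /j; lia.
have scaled (s t c : K) (q' : {poly K}) : (size q' <= r)%N -> c != 0 -> (s != 0) || (t != 0) ->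
    (forall b, (b <= j)%N -> umbral ('X^b * q') = c * (s ^+ (j - b) * t ^+ b)) ->
    exists j (q : {poly K}) (s t : K), [/\ (k <= j.*2)%N, (j <= k)%N, (size q <= (k - j).+1)%N,
      (s != 0) || (t != 0) &
      forall b, (b <= j)%N -> umbral ('X^b * q) = s ^+ (j - b) * t ^+ b].
  move=> sq' c0 st q'E; exists j, (c^-1 *: q'), s, t; split=> //; rewrite ?jk; [lia|lia| |].
    by rewrite (leq_trans (size_scale_leq _ _)) // prednK.
  by move=> b bj; rewrite -scalerAr umbralZ q'E // mulKf.
(* A constant [q], seen as a form of degree [r], is a power of the linear factor at infinity. This
   gives [s = 0] and [t = 1], and [s ^+ (j - b) * t ^+ b] is then the indicator of [b = j]. *)
have [sq1|sq1] := leqP (size q) 1.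
  have qC := size1_polyC sq1; have c0 : q`_0 != 0 by apply: contraNneq q0 => c0; rewrite qC c0.
  have qE b : (b <= k)%N -> umbral ('X^b * q) = q`_0 * a b.
    by move=> bk; rewrite {1}qC mulrC mul_polyC umbralZ umbralXn.
  have aj b : (b <= k - r)%N -> a b = 0.
    move=> bk; have := qA b bk; rewrite qE; last by rewrite (leq_trans bk) // leq_subr.
    by move/eqP; rewrite mulf_eq0 (negbTE c0) => /eqP.
  apply: (scaled 0 1 (q`_0 * a j) q); rewrite ?oner_neq0 ?orbT //.
  - by rewrite (leq_trans sq1).
  - rewrite mulf_neq0 //; apply/negP=> /eqP aj0.
    suff /eqP : (1 : {poly K}) = 0 by rewrite oner_eq0.
    apply: (nonapolar r.-1); first by rewrite prednK.
    split=> [|b bk]; first by rewrite size_poly1.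
    rewrite mulr1 umbralXn; last by lia.
    have [bk'|bk'] := leqP b (k - r); first exact: aj.
    by rewrite (_ : b = j) //; rewrite /j; lia.
  - move=> b bj; rewrite qE; last by rewrite /j in bj; lia.
    have [->|bj'] := eqVneq b j; first by rewrite subnn expr0 expr1n !mulr1.
    rewrite aj ?mulr0; last by rewrite /j in bj bj'; lia.
    by rewrite expr0n subn_eq0 leqNgt ltn_neqAle bj' bj mul0r mulr0.
(* After division by ['X - t], apolarity becomes a geometric recurrence of ratio [t] for the
   cofactor; minimality of [r] prevents its first term from vanishing. *)
have /closed_rootP[t] : size q != 1 by rewrite gtn_eqF.
move=> /factor_theorem[q' qE].
have q'0 : q' != 0 by apply: contraNneq q0 => q'0; rewrite qE q'0 mul0r.
have sq' : (size q' <= r)%N.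
  by move: sq; rewrite qE size_Mmonic ?monicXsubC // size_XsubC addn2.
have geom b : (b <= k - r)%N -> umbral ('X^(b.+1) * q') = t * umbral ('X^b * q').
  move=> bk; have := qA b bk.
  have -> : 'X^b * q = 'X^(b.+1) * q' + (- t) *: ('X^b * q').
    by rewrite qE exprSr -mul_polyC polyCN; ring.
  by rewrite umbralD umbralZ mulNr => /eqP; rewrite subr_eq0 => /eqP.
have geom' b : (b <= j)%N -> umbral ('X^b * q') = umbral q' * t ^+ b.
  elim: b => [|b IHb] bj; first by rewrite expr0 mul1r mulr1.
  by rewrite geom // IHb 1?ltnW // exprS mulrCA.
apply: (scaled 1 t (umbral q') q'); rewrite ?oner_neq0 //.
  apply/negP=> /eqP u0; case/eqP: q'0; apply: (nonapolar r.-1); first by rewrite prednK.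
  split=> [|b bk]; first by rewrite prednK.
  by rewrite geom' ?u0 ?mul0r // /j; lia.
by move=> b bj; rewrite geom' // expr1n mul1r.
Qed.

(** Further contraction by a coordinate with a non-zero coefficient [s] or [t] lowers the exponent
    from [j] to [e]. In the dehomogenised notation the first coordinate is 1 and the second is
    ['X]. *)
Lemma contract_power j (q : {poly K}) (s t : K) :
    (j <= k)%N -> (size q <= (k - j).+1)%N -> (s != 0) || (t != 0) ->
    (forall b, (b <= j)%N -> umbral ('X^b * q) = s ^+ (j - b) * t ^+ b) ->
  forall e, (e <= j)%N -> exists2 r : {poly K}, (size r <= (k - e).+1)%N &
    forall b, (b <= e)%N -> umbral ('X^b * r) = s ^+ (e - b) * t ^+ b.
Proof.
move=> jk sq st qE e ej; have [s0|s0] := boolP (s != 0).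
  exists ((s ^+ (j - e))^-1 *: q) => [|b be].
    by rewrite (leq_trans (size_scale_leq _ _)) // (leq_trans sq) // ltnS leq_sub2l.
  rewrite -scalerAr umbralZ qE; last exact: leq_trans ej.
  rewrite (_ : j - b = j - e + (e - b))%N; last lia.
  by rewrite exprD -mulrA mulKf // expf_neq0.
have t0 : t != 0 by move: st; rewrite (negbTE s0).
exists ((t ^+ (j - e))^-1 *: ('X^(j - e) * q)) => [|b be].
  rewrite (leq_trans (size_scale_leq _ _)) // (leq_trans (size_polyMleq _ _)) //.
  by rewrite size_polyXn; lia.
rewrite -scalerAr umbralZ mulrA -exprD qE; last by lia.
rewrite (_ : j - (b + (j - e)) = e - b)%N; last lia.
by rewrite exprD (mulrC (t ^+ b)) mulrCA mulKf // expf_neq0.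
Qed.

End Sylvester.

Section PowersOfLinearForm.

Variables (p : nat) (hp : prime p).
Local Notation F := 'F_p.
Local Notation V := (plane p).
Implicit Types (u v w x : V).

Lemma sum_Fp_expr_delta (i l : nat) : (i < p.-1)%N -> (l < p.-1)%N ->
  \sum_(x : F) x ^+ (p.-1 - l + i) = if i == l then -1 else 0.
Proof.
move=> ip lp; rewrite sum_Fp_expr // (_ : (0 < p.-1 - l + i)%N); last lia.
have [->|il] := eqVneq i l; first by rewrite subnK ?dvdnn // ltnW.
rewrite ifN //; apply/negP=> /dvdnP[q E].
by case: q E => [|[|q]] E; nia.
Qed.

Variables (K : closedFieldType) (iota : {rmorphism F -> K}) (k : nat).
Hypothesis kp : (0 < k < p.-1)%N.

(** By [sum_Fp_expr_delta], [x ^+ (p.-1 - l)] is dual to [x ^+ l] up to the sign -1; the signs of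
    the two coordinates cancel. All exponents stay below [p - 1] because [k] does. *)
Lemma exists_moments n (w : nat -> K) : (n <= k)%N ->
  exists c : V -> K, forall i j, (i + j <= k)%N ->
    \sum_v c v * iota (v.1 ^+ i * v.2 ^+ j) = if (i + j == n)%N then w j else 0.
Proof.
move=> nk; exists (fun v => \sum_(l < n.+1)
  w l * iota (v.1 ^+ (p.-1 - (n - l)) * v.2 ^+ (p.-1 - l))).
move=> i j ijk; under eq_bigr do rewrite mulr_suml.
rewrite exchange_big /=.
transitivity (\sum_(l < n.+1) w l * ((i == n - l)%N && (j == l))%:R).
  apply: eq_bigr => l _; have ln := ltn_ord l.
  transitivity (w l * iota (\sum_(x : F) \sum_(y : F)
      x ^+ (p.-1 - (n - l) + i) * y ^+ (p.-1 - l + j))).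
    rewrite (pair_bigA _ (fun x y : F => x ^+ (p.-1 - (n - l) + i) * y ^+ (p.-1 - l + j))) /=.
    rewrite rmorph_sum mulr_sumr; apply: eq_bigr => v _.
    by rewrite -mulrA -rmorphM mulrACA -!exprD.
  rewrite -big_distrlr /= !sum_Fp_expr_delta //; try lia.
  by case: eqP; case: eqP; rewrite ?(mulr0, mul0r, rmorph0) // mulrNN mulr1 rmorph1.
case: ifPn => ijn; last first.
  by apply: big1 => l _; have := ltn_ord l; case: eqP; case: eqP; rewrite ?mulr0 //; lia.
have jn : (j < n.+1)%N by lia.
rewrite (bigD1 (Ordinal jn)) //= big1 ?addr0 => [|l].
  by rewrite eqxx (_ : i == _) ?mulr1 //; lia.
by rewrite -val_eqE /= => lj; rewrite [j == l]eq_sym (negbTE lj) andbF mulr0.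
Qed.

Definition linpolyK v : {poly K} := map_poly iota (linpoly v).

Lemma linpolyKB v w : linpolyK (v - w) = linpolyK v - linpolyK w.
Proof.
rewrite /linpolyK -rmorphB; congr (map_poly _ _); apply: (addIr (linpoly w)).
by rewrite -linpolyD !subrK.
Qed.

Lemma coef_linpolyKX v e j : (linpolyK v ^+ e)`_j =
  if (j <= e)%N then iota (v.1 ^+ (e - j) * v.2 ^+ j) *+ 'C(e, j) else 0.
Proof.
have -> : linpolyK v ^+ e = map_poly iota (linpoly v ^+ e) by rewrite rmorphXn.
rewrite coef_map (coef_linpolyX hp); case: ifP => _; last exact: rmorph0.
by rewrite /= raddfMn.
Qed.

Lemma linpolyKX v e : linpolyK v ^+ e =
  \sum_(j < e.+1) (iota (v.1 ^+ (e - j) * v.2 ^+ j) *+ 'C(e, j)) *: 'X^j.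
Proof.
rewrite -(poly_def _ (fun j => iota (v.1 ^+ (e - j) * v.2 ^+ j) *+ 'C(e, j))).
by apply/polyP=> j; rewrite coef_linpolyKX coef_poly ltnS.
Qed.

Variables (f : V -> F) (a : nat -> F).
Hypothesis fE : forall x, f x = \sum_(b < k.+1) a b * (x.1 ^+ (k - b) * x.2 ^+ b).
Hypothesis f_neq0 : forall v, v != 0 -> f v != 0.

(** The division by binomials makes [f x] the value of the functional [umbral] on the [k]-th power
    of the linear form attached to [x]. *)
Definition umbral_coef b : K := iota (a b) / ('C(k, b))%:R.

Lemma umbral_form x : iota (f x) = umbral k umbral_coef (linpolyK x ^+ k).
Proof.
rewrite fE rmorph_sum; apply: eq_bigr => b _; have bk := ltn_ord b.
rewrite coef_linpolyKX ifT // rmorphM [LHS]mulrC -mulr_natr -mulrA; congr (_ * _).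
by rewrite /umbral_coef mulrCA divff ?mulr1 // (bin_Fp_neq0 hp iota) //; lia.
Qed.

(** A binary linear form has a non-trivial zero in the plane. *)
Lemma form_degree_gt1 : (1 < k)%N.
Proof.
rewrite ltnNge; apply/negP=> k1; have k1E : k = 1%N by lia.
have f1 : f (a 1%N, - a 0%N) = 0.
  by rewrite fE k1E !big_ord_recl big_ord0 /= !expr0 !expr1 /=; ring.
have : (a 1%N, - a 0%N) = 0 :> V.
  by apply/eqP; apply: contraT => /f_neq0; rewrite f1 eqxx.
move=> v0; have a1 : a 1%N = 0 := congr1 fst v0.
have /eqP : - a 0%N = 0 := congr1 snd v0; rewrite oppr_eq0 => /eqP a0.
have := @f_neq0 (1, 0); rewrite plane_eq0 oner_eq0 => /(_ isT).
by rewrite fE k1E !big_ord_recl big_ord0 /= a0 a1 !mul0r !addr0 eqxx.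
Qed.

(** Choose [c] so that, among its moments of degree at most [k], only those of degree [n = k - e]
    survive, with values given by the contraction [r]. In the sum of the [c v] times [(x - v)^k],
    the binomial expansion then keeps one term, a multiple of [x^e r], and the functional sends it
    to the [e]-th power of [s x.1 + t x.2]. *)
Lemma linear_form_powers : exists s t : K, (s != 0) || (t != 0) /\
  exists2 E, (k <= E.*2)%N & forall e, (e <= E)%N -> exists2 c : V -> K, \sum_v c v = 0 &
    forall x, \sum_v c v * iota (f (x - v)) = (s * iota x.1 + t * iota x.2) ^+ e.
Proof.
have k1 := form_degree_gt1.
have [||j [q [s [t [kj jk sq st qE]]]]] := @sylvester K k umbral_coef.
- lia.
- have : [exists b : 'I_k.+1, a b != 0].
    rewrite -negb_forall; apply/negP=> /forallP a0.
    have := @f_neq0 (1, 0); rewrite plane_eq0 oner_eq0 => /(_ isT).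
    by rewrite fE big1 ?eqxx // => b _; rewrite (eqP (a0 b)) mul0r.
  case/existsP=> b ab; exists (b : nat); first by rewrite -ltnS.
  rewrite mulf_neq0 ?fmorph_eq0 ?invr_eq0 // (bin_Fp_neq0 hp iota) //.
  by have := ltn_ord b; lia.
(* The bound [e <= k.-1] makes [n] positive, so that the moment of degree 0, the sum of [c],
   vanishes; since [k > 1], it still allows [k <= E.*2]. *)
exists s, t; split=> //; exists (minn j k.-1); first lia.
move=> e eE; have ej : (e <= j)%N by lia.
have [r sr rE] := contract_power jk sq st qE ej.
set n := (k - e)%N in sr.
have Ckn : ('C(k, n))%:R != 0 :> K by apply: (bin_Fp_neq0 hp iota); lia.
(* This factor cancels the sign and the binomial coefficient of the surviving term. *)
pose z : K := (-1) ^+ n / ('C(k, n))%:R.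
have nk : (n <= k)%N by rewrite /n; lia.
have [c cE] := @exists_moments n (fun j => z * (r`_j / ('C(n, j))%:R)) nk.
exists c.
  have := cE 0%N 0%N isT; rewrite ifN; last by rewrite /n; lia.
  by move=> c0; rewrite -[RHS]c0; apply: eq_bigr => v _; rewrite !expr0 mulr1 rmorph1 mulr1.
have cL i : (i <= k)%N -> \sum_v c v *: linpolyK v ^+ i = if i == n then z *: r else 0.
  move=> ik; apply/polyP=> l; rewrite coef_sum; under eq_bigr do rewrite coefZ coef_linpolyKX.
  have [li|li] := leqP l i; last first.
    rewrite big1 => [|v _]; last by rewrite mulr0.
    case: eqP => [ni|]; last by rewrite coef0.
    by rewrite coefZ nth_default ?mulr0 // (leq_trans sr) // -/n -ni.
  under eq_bigr do rewrite mulrnAr.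
  rewrite sumrMnl cE ?subnK //; case: eqP => [ni|]; last by rewrite coef0 mul0rn.
  rewrite coefZ -[LHS]mulr_natr -!mulrA ni mulVf ?mulr1 // (bin_Fp_neq0 hp iota) //.
  by rewrite -ni; lia.
move=> x.
transitivity (umbral k umbral_coef (\sum_v c v *: (linpolyK x - linpolyK v) ^+ k)).
  rewrite umbral_sum; apply: eq_bigr => v _.
  by rewrite umbralZ -linpolyKB umbral_form.
transitivity (umbral k umbral_coef (linpolyK x ^+ e * r)).
  congr umbral; under eq_bigr do rewrite exprBn scaler_sumr.
  rewrite exchange_big /=.
  have termE (i : 'I_k.+1) :
      \sum_v c v *: ((-1) ^+ i * linpolyK x ^+ (k - i) * linpolyK v ^+ i *+ 'C(k, i)) =
      (-1) ^+ i * linpolyK x ^+ (k - i) * (\sum_v c v *: linpolyK v ^+ i) *+ 'C(k, i).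
    rewrite mulr_sumr -sumrMnl; apply: eq_bigr => v _.
    by rewrite -scalerMnr scalerAr.
  rewrite (eq_bigr _ (fun i _ => termE i)).
  rewrite (bigD1 (Ordinal (nk : n < k.+1)%N)) //= [X in _ + X]big1 ?addr0 => [|i]; last first.
    rewrite -val_eqE /= => ni;
    by rewrite cL ?(negbTE ni) ?mulr0 ?mul0rn // -ltnS.
  rewrite cL ?eqxx; last by rewrite /n; lia.
  rewrite (_ : k - n = e)%N; last by rewrite /n; lia.
  have -> : (-1) ^+ n = ((-1) ^+ n : K)%:P by rewrite polyC_exp polyCN.
  rewrite -mulrA mul_polyC -[_ *+ _]scaler_nat scalerA -scalerAr scalerA.
  rewrite -[RHS]scale1r; congr (_ *: _).
  have ss : (-1) ^+ n * (-1) ^+ n = 1 :> K by rewrite -expr2 sqrr_sign.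
  by rewrite /z -[RHS]ss; move: Ckn; move: (_ ^+ _) (_%:R) => w C C0; field.
rewrite linpolyKX mulr_suml umbral_sum exprDn; apply: eq_bigr => b _.
rewrite -scalerAl umbralZ rE; last by rewrite -ltnS.
rewrite !exprMn rmorphM !rmorphXn mulrnAl; congr (_ *+ _).
by rewrite [LHS]mulrACA [iota x.1 ^+ _ * _]mulrC [iota x.2 ^+ _ * _]mulrC.
Qed.

End PowersOfLinearForm.

Section PseudoCyclotomic.

Variables (p : nat) (hp : prime p).
Local Notation F := 'F_p.
Local Notation V := (plane p).
Implicit Types (u v w x y : V).
Variable G : {group {perm V}}.
Hypothesis shiftG : forall v : V, shift v \in G.

Section Form.

Variables (K : closedFieldType) (iota : {rmorphism F -> K}) (k m : nat).
Variables (f : V -> F) (a : nat -> F).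
Hypothesis kp : (0 < k < p.-1)%N.
Hypothesis km : small_degree p k m.
Hypothesis fG : forall g, g \in G -> forall x y, f (g y - g x) = f (y - x).
Hypothesis f_neq0 : forall v, v != 0 -> f v != 0.
Hypothesis fE : forall x, f x = \sum_(b < k.+1) a b * (x.1 ^+ (k - b) * x.2 ^+ b).

Lemma linpolyKDZ v w r :
  linpolyK iota (v + scale2 r w) = linpolyK iota v + iota r *: linpolyK iota w.
Proof.
rewrite /linpolyK linpolyD rmorphD; congr (_ + _).
by rewrite -map_polyZ /linpoly /= scalerDr scalerA -mul_polyC polyCM.
Qed.

(* The coefficient of degree k in r is a multiple of \sum_w c w. *)
Lemma form_on_line (g : {perm V}) (c : V -> K) x v : g \in G -> \sum_w c w = 0 ->
  exists2 Q : {poly K}, (size Q <= k)%N & forall r,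
    Q.[iota r] = \sum_w c w * iota (f (g (x + scale2 r v) - w)).
Proof.
move=> gG c0; pose U := umbral k (umbral_coef iota k a).
pose D i := \sum_w c (g w) *
  U ((linpolyK iota (x - w) ^+ (k - i) * linpolyK iota v ^+ i) *+ 'C(k, i)).
exists (\poly_(i < k) D i) => [|r]; first exact: size_poly.
rewrite (reindex_inj (@perm_inj _ g)) /= horner_poly.
transitivity (\sum_(i < k.+1) D i * iota r ^+ i).
  rewrite big_ord_recr /= (_ : D k = 0) ?mul0r ?addr0 //.
  rewrite /D subnn; under eq_bigr do rewrite expr0 mul1r binn mulr1n.
  rewrite -mulr_suml (_ : \sum_w c (g w) = 0) ?mul0r //.
  by rewrite -[RHS]c0 [RHS](reindex_inj (@perm_inj _ g)).
transitivity (\sum_(i < k.+1) \sum_w c (g w) *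
    U ((linpolyK iota (x - w) ^+ (k - i) * linpolyK iota v ^+ i) *+ 'C(k, i)) * iota r ^+ i).
  by apply: eq_bigr => i _; rewrite -mulr_suml.
rewrite exchange_big /=.
apply: eq_bigr => w _; rewrite fG // addrAC (umbral_form hp iota kp fE) linpolyKDZ exprDn.
rewrite umbral_sum mulr_sumr; apply: eq_bigr => i _.
rewrite -mulrA; congr (_ * _); rewrite mulrC -umbralZ; congr (umbral _ _ _).
by rewrite exprZn -scalerAr scalerMnr.
Qed.

(** Every [l o g] is affine on each line, hence additive up to a constant. The vectors that no
    [l o g] distinguishes from 0 form a block [B], which is trivial by primitivity since [l] is
    non-zero. The defect of additivity of an element [h] lies in [B], because [l o g o h] is affine
    for every [g]. *)
Lemma form_affine : stable_primitive G -> G \subset AGL2 p.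
Proof.
move=> prim.
have [s [t [st [E kE powE]]]] := linear_form_powers hp iota kp fE f_neq0.
pose l x := s * iota x.1 + t * iota x.2.
have l_line g x v : g \in G -> exists A B, forall r, l (g (x + scale2 r v)) = A * iota r + B.
  move=> gG; apply: (@bounded_powers_affine p hp K iota _ k E _ _ m km kE); last lia.
  move=> e eE; have [c c0 cE] := powE e eE.
  have [Q sQ QE] := form_on_line x v gG c0; exists Q => // r.
  by rewrite QE cE.
have p2 : (2 < p)%N by lia.
have two0 : (2%:R : F) != 0.
  by rewrite Fp_natr_eq0 //; apply/negP=> /dvdn_leq; lia.
pose half : F := (2%:R)^-1.
(* The pairs [x, y] and [0, x + y] have the same midpoint, which turns affinity on lines into
   additivity. *)
have l_mid g x y : g \in G -> l (g (x + scale2 half (y - x))) = iota half * (l (g x) + l (g y)).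
  move=> gG; have [A [B AB]] := l_line g x (y - x) gG.
  have := AB 0; rewrite scale20 addr0 rmorph0 mulr0 add0r => ->.
  have := AB 1; rewrite scale21 rmorph1 mulr1 addrC subrK => ->.
  rewrite AB; have half2 : iota half * 2%:R = 1.
    by rewrite -(rmorph_nat iota) -rmorphM mulVf // rmorph1.
  by rewrite -[B in LHS]mul1r -half2; ring.
have l_add g x y : g \in G -> l (g (x + y)) - l (g x) = l (g y) - l (g 0).
  move=> gG; have half0 : iota half != 0 by rewrite fmorph_eq0 invr_eq0.
  have := l_mid g x y gG; have := l_mid g 0 (x + y) gG.
  have -> : x + scale2 half (y - x) = 0 + scale2 half (x + y - 0).
    have key (b c : F) : b + half * (c - b) = 0 + half * (b + c - 0).
      by rewrite -[X in X + _]mul1r -(mulVf two0 : half * _ = 1); ring.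
    by apply: injective_projections => /=; apply: key.
  move=> -> /(mulfI half0) E1.
  have -> : l (g (x + y)) = l (g x) + l (g y) - l (g 0) by rewrite -E1 [RHS]addrC addKr.
  by ring.
pose B := [set v | [forall g in G, l (g v) == l (g 0)]].
have BP x y : reflect (forall g, g \in G -> l (g y) = l (g x)) (y - x \in B).
  rewrite inE; apply: (iffP forall_inP) => lB g gG; last first.
    by have := l_add g (y - x) x gG; rewrite subrK lB // => /addrI/oppr_inj->.
  apply/eqP; rewrite -[y](subrK x); apply/eqP.
  have := l_add g (y - x) x gG; rewrite (eqP (lB g gG)) => E1.
  by rewrite -[LHS](subrK (l (g 0))) E1 subrK.
have Bstable : diff_stable G B.
  move=> h hG x y; apply/BP/BP => lB g gG.
    by have := lB (h^-1 * g)%g; rewrite !permM !permK; apply; rewrite !groupM ?groupV.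
  by rewrite -!permM lB // groupM.
have [||BT|B0] := prim B Bstable.
- by rewrite -(subrr 0); apply/BP.
- move=> x y xB yB; have /BP y0 : y - 0 \in B by rewrite subr0.
  have /BP xy : x + y - y \in B by rewrite addrK.
  by rewrite -[x + y]subr0; apply/BP => g gG; rewrite xy ?y0.
- have lT v : l v = 0.
    have /BP/(_ 1%g (group1 G)) : v - 0 \in B by rewrite BT inE.
    by rewrite !perm1 /l /= !rmorph0 !mulr0 addr0.
  have := lT (1, 0); have := lT (0, 1).
  rewrite /l /= rmorph0 rmorph1 !mulr0 !mulr1 add0r addr0 => t0 s0.
  by move: st; rewrite t0 s0 eqxx.
apply/subsetP=> h hG; apply: additive_AGL2 => x y; apply/eqP; rewrite -subr_eq0.
suff : h (x + y) - h x - (h y - h 0) \in B by rewrite B0 inE.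
apply/BP => g gG.
have lB u w : l (g (u - w)) = l (g u) - l (g w) + l (g 0).
  by rewrite -[u in RHS](subrK w) [u - w + w]addrC l_add // subrK.
rewrite !lB; congr (_ + _); rewrite -!permM.
by rewrite l_add // groupM.
Qed.

End Form.

Lemma pseudo_cyclotomic_affine v0 w0 : v0 != 0 -> w0 != 0 -> w0 \notin suborbit G v0 ->
    (forall v w, v != 0 -> w != 0 -> exists2 c, c != 0 & scale2 c w \in suborbit G v) ->
  stable_primitive G -> G \subset AGL2 p.
Proof.
move=> v00 w00 w0v0 cov.
have [k [m [f [a [kp km fG f0 fE]]]]] := invariant_form hp shiftG v00 w00 w0v0 cov.
have [K [iota _]] := countable_algebraic_closure F.
exact: (form_affine iota kp km fG f0 fE).
Qed.

End PseudoCyclotomic.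

(** * Transitivity, primitivity and affine groups of degree p *)

Section Transitivity.

Variable V : finZmodType.
Implicit Types (G : {group {perm V}}).

Lemma doubly_transitiveP (x0 x1 : V) G : x0 != x1 ->
  reflect (two_transitive G) (doubly_transitive G).
Proof.
move=> x01; apply: (iffP idP) => [dG x y x' y' xy xy'|tG].
  have dt (u v : V) : u != v -> [tuple u; v] \in dtuple_on 2 [set: V].
    by move=> uv; rewrite inE /= !inE uv /=; apply/subsetP=> z; rewrite inE.
  have [g gG] := atransP2 dG (dt _ _ xy) (dt _ _ xy').
  by case/(congr1 val) => -> ->; exists g.
apply/imsetP; exists [tuple x0; x1].
  by rewrite inE /= !inE x01 /=; apply/subsetP=> z; rewrite inE.
apply/setP=> t; case/tupleP: t => y t; case/tupleP: t => z t; rewrite (tuple0 t) {t}.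
apply/idP/imsetP => [|[g gG ->]].
  rewrite inE /= !inE andbT => /andP[yz _]; have [g [gG gx gy]] := tG _ _ _ _ x01 yz.
  by exists g => //; apply: val_inj; rewrite /= !apermE gx gy.
apply: n_act_dtuple; first by apply/astabsP=> u; rewrite !inE.
by rewrite inE /= !inE x01 /=; apply/subsetP=> u; rewrite inE.
Qed.

Lemma doubly_transitive_full (x0 x1 : V) G : x0 != x1 ->
    (forall v, shift v \in G) -> two_closed G -> doubly_transitive G ->
  G = [set: {perm V}] :> {set _}.
Proof.
move=> x01 sG /andP[_ /eqP clG] /(doubly_transitiveP _ x01) tG.
apply/eqP; rewrite eqEsubset subsetT /=; apply/subsetP=> g _.
by rewrite -clG; apply/two_closureP => // x y xy; apply: tG; rewrite ?(inj_eq perm_inj).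
Qed.

Lemma primitive_stableP G : (forall v, shift v \in G) ->
  [primitive G, on [set: V] | 'P] -> stable_primitive G.
Proof.
move=> sG; rewrite (trans_prim_astab (in_setT 0)) ?shift_trans // => maxG B sB B0 BD.
pose M := [set g in G | g 0 \in B].
have MG : group_set M.
  apply/group_setP; split=> [|g h]; first by rewrite inE group1 perm1.
  rewrite !inE => /andP[gG g0] /andP[hG h0]; rewrite groupM //= permM.
  by rewrite -(subrK (h 0) (h _)) BD // sB // subr0.
have /maximal_eqP[_ /(_ (Group MG))] := maxG; case=> /=.
- apply/subsetP=> g /setIP[gG /astab1P g0]; rewrite inE gG /=.
  by move: g0; rewrite /= apermE => ->.
- by apply/subsetP=> g; rewrite inE => /andP[].
- move=> ME; right; apply/setP=> v; rewrite inE.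
  apply/idP/eqP=> [vB|->//]; have : shift v \in M by rewrite inE sG shiftE addr0.
  by rewrite ME => /setIP[_ /astab1P]; rewrite /= apermE shiftE addr0.
move=> ME; left; apply/setP=> v; rewrite inE.
have : shift v \in M by rewrite ME sG.
by rewrite inE shiftE addr0 => /andP[].
Qed.

Lemma stable_primitiveP G : (forall v, shift v \in G) ->
  stable_primitive G -> [primitive G, on [set: V] | 'P].
Proof.
move=> sG sp; rewrite (trans_prim_astab (in_setT 0)) ?shift_trans //.
apply/maximal_eqP; split=> [|M sM MG]; first exact: subsetIl.
pose B := [set v | shift v \in M].
have stabM g : g \in G -> g 0 = 0 -> g \in M.
  move=> gG g0; apply: (subsetP sM); rewrite inE gG; apply/astab1P.
  by rewrite /= apermE.
have BM g : g \in G -> (g \in M) = (g 0 \in B).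
  move=> gG; rewrite inE -[in LHS](mulgKV (shift (g 0)) g) groupMl // stabM //.
    by rewrite groupM ?groupV.
  by rewrite permM; apply: (canLR (permK _)); rewrite shiftE addr0.
have Bsub g x y : g \in G -> y - x \in B -> g y - g x \in B.
  move=> gG xyB; pose k := (shift x * g * shift (- g x))%g.
  have kM : k \in M.
    by apply: stabM; rewrite ?groupM // !permM !shiftE addr0 addNr.
  have xyM : shift (y - x) \in M by rewrite inE in xyB.
  have : (shift (y - x) * k)%g \in M by rewrite groupM.
  rewrite BM ?groupM // !permM !shiftE addr0 [x + _]addrC subrK.
  by rewrite addrC.
have Bst : diff_stable G B.
  move=> g gG x y; apply/idP/idP; last exact: Bsub.
  by move/(Bsub g^-1%g _ _ (groupVr gG)); rewrite !permK.
have [||BT|B0] := sp B Bst.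
- by rewrite -[0](perm1 0) -BM ?group1.
- move=> x y; rewrite !inE => xM yM.
  rewrite (_ : shift (x + y) = shift y * shift x)%g ?groupM //.
  by apply/permP=> z; rewrite permM !shiftE addrA.
- right; apply/eqP; rewrite eqEsubset MG; apply/subsetP=> g gG.
  by rewrite BM // BT inE.
left; apply/eqP; rewrite eqEsubset sM andbT; apply/subsetP=> g gM.
have gG := subsetP MG _ gM; rewrite inE gG; apply/astab1P; rewrite /= apermE.
by move: gM; rewrite BM // B0 inE => /eqP.
Qed.

End Transitivity.

Section AffineLine.

Variables (p : nat) (hp : prime p).
Local Notation F := 'F_p.

Lemma AGL1P (g : {perm F}) :
  reflect (exists a b, a != 0 /\ forall x, g x = a * x + b) (g \in AGL1 p).
Proof.
rewrite inE; apply: (iffP existsP) => [[a /existsP[b /andP[a0 /forallP gE]]]|[a [b [a0 gE]]]].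
  by exists a, b; split=> // x; apply/eqP.
by exists a; apply/existsP; exists b; rewrite a0; apply/forallP=> x; rewrite gE.
Qed.

Lemma shift_AGL1 (v : F) : shift v \in AGL1 p.
Proof. by apply/AGL1P; exists 1, v; rewrite oner_eq0; split=> // x; rewrite shiftE mul1r addrC. Qed.

Lemma two_transitive_AGL1 : two_transitive (AGL1 p).
Proof.
move=> x y x' y' xy xy'; pose a := (y' - x') / (y - x).
have yx0 : y - x != 0 by rewrite subr_eq0 eq_sym.
have a0 : a != 0 by rewrite mulf_neq0 ?invr_eq0 // subr_eq0 eq_sym.
have ginj : injective (fun z => a * z + (x' - a * x)) by move=> u v /addIr/(mulfI a0).
exists (perm ginj); rewrite !permE; split; last 2 first.
- by rewrite addrC subrK.
- by rewrite addrCA -mulrBr divfK // addrC subrK.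
by apply/AGL1P; exists a, (x' - a * x); split=> // z; rewrite permE.
Qed.

(** The conjugate is an affine map without fixed points, hence a translation by some [b], and
    [g (1 + x) = g x + b] makes [g] affine of slope [b]. *)
Lemma conj_shift_AGL1 (g : {perm F}) : (shift 1%R ^ g)%g \in AGL1 p -> g \in AGL1 p.
Proof.
case/AGL1P=> a [b [a0 E]].
have step x : g (1 + x) = a * g x + b by rewrite -E permJ shiftE.
have a1 : a = 1.
  apply/eqP; apply: contraT => a1; have a1' : 1 - a != 0 by rewrite subr_eq0 eq_sym.
  have := step ((g^-1)%g (b / (1 - a))); rewrite permKV.
  rewrite (_ : a * (b / (1 - a)) + b = b / (1 - a)); last by field.
  move/(canRL (permK g))/eqP; rewrite -subr_eq0 addrK oner_eq0 //.
have b0 : b != 0.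
  apply: contraTneq isT => b0; have := step 0; rewrite a1 mul1r b0 !addr0 => /perm_inj/eqP.
  by rewrite oner_eq0.
apply/AGL1P; exists b, (g 0); split=> // x; rewrite -[x]natr_Zp.
elim: (x : nat) => [|n IHn]; first by rewrite mulr0 add0r.
by rewrite mulrS step IHn a1 mul1r mulrDr mulr1; ring.
Qed.

(* Galois: a minimal normal subgroup is a normal Sylow p-subgroup, hence contains
   the conjugates of shift 1 and commutes with it. *)
Lemma solvable_AGL1 (N : {group {perm F}}) : (forall v, shift v \in N) -> solvable N ->
  N \subset AGL1 p.
Proof.
move=> sN solN; case: (burnside_prime_degree hp sN) => // tN.
have s1 : shift (1 : F) != 1%g.
  apply/eqP=> /permP/(_ 0); rewrite shiftE perm1 addr0 => /eqP.
  by rewrite oner_eq0.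
have N1 : N != 1%g :> {set _}.
  by apply/eqP=> N1; have := sN 1; rewrite N1 inE (negbTE s1).
have [M minM MN] := minnormal_exists N1 (normG N).
have [nM M1 /is_abelemP[q [q_pr abM]]] := minnormal_solvable minM MN solN.
have p1 := prime_gt1 hp.
have pM : (p %| #|M|)%N.
  (* If [m] moves [x], an element of [N] fixing [x] can send [m x] to any other point, and
     conjugation by it keeps [m] in [M]. *)
  suff trM : [transitive M, on [set: F] | 'P].
    by have := atrans_dvd trM; rewrite cardsT card_Fp.
  have [m mM m1] := trivgPn _ M1.
  have [x mx] : exists x, m x != x.
    apply/existsP; rewrite -negb_forall; apply: contra m1 => /forallP m_id.
    by apply/eqP/permP=> x; rewrite perm1; apply/eqP; have := m_id x.
  apply/imsetP; exists x; rewrite ?inE //; apply/esym/setP=> y; rewrite inE.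
  have [->|yx] := eqVneq y x; first exact: orbit_refl.
  have xmx : x != m x by rewrite eq_sym.
  have xy : x != y by rewrite eq_sym.
  have [h [hN hx hy]] := tN x (m x) x y xmx xy.
  apply/imsetP; exists (m ^ h)%g; first by rewrite memJ_norm // (subsetP nM).
  by rewrite /= apermE -{1}hx permJ hy.
have qp : q = p.
  have /pgroupP/(_ p hp pM) := abelem_pgroup abM.
  by rewrite inE => /eqP.
subst q.
have pN : (#|N|`_p %| p)%N.
  have : (#|N| %| p`!)%N.
    by have : (#|N| %| #|('Sym_F)%g|)%N := cardSg (subsetT N); rewrite card_Sym card_Fp.
  have -> : p`! = (p * (p.-1)`!)%N by rewrite -{1 2}(prednK (ltnW p1)) factS.
  move/(partn_dvd p _)=> -/(_ _); rewrite muln_gt0 fact_gt0 prime_gt0 // => /(_ isT).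
  rewrite partnM ?fact_gt0 ?prime_gt0 // [X in (_ * X)%N]part_p'nat ?muln1.
    by rewrite (part_pnat_id (pnat_id hp)).
  by rewrite p'natE // prime_ndvd_fact // ltn_predL prime_gt0.
have sylM : (p.-Sylow(N) M)%g.
  rewrite pHallE MN /= eqn_leq; apply/andP; split.
    rewrite dvdn_leq ?part_gt0 // -[X in (X %| _)%N](part_pnat_id (abelem_pgroup abM)).
    by rewrite partn_dvd // cardSg.
  exact: leq_trans (dvdn_leq (prime_gt0 hp) pN) (dvdn_leq (cardG_gt0 M) pM).
have nsM : (M <| N)%g by rewrite /normal MN.
have s1M : shift 1 \in M.
  rewrite -cycle_subG (sub_normal_Hall sylM nsM) ?cycle_subG ?sN //.
  rewrite /pgroup (@pnat_dvd _ p) ?pnat_id // -/(#[_]%g) order_dvdn.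
  apply/eqP/permP=> x; rewrite permX perm1.
  have iterE n : iter n (shift (1 : F)) x = n%:R + x.
    by elim: n => [|n IHn]; rewrite ?add0r //= IHn shiftE mulrS addrA.
  by rewrite iterE (Fp_natr0 hp idfun) add0r.
(* The outer use reduces the claim to [shift 1 ^ g]; the inner one conjugates [shift 1] by this
   element, with which it commutes in the abelian group [M]. *)
apply/subsetP=> g gN; apply: conj_shift_AGL1; apply: conj_shift_AGL1.
have sgM : (shift 1%R ^ g)%g \in M by rewrite memJ_norm // (subsetP nM).
rewrite /conjg -(centsP (abelem_abelian abM) _ sgM _ s1M) mulgA mulVg mul1g.
exact: shift_AGL1.
Qed.

End AffineLine.

Lemma prod_permE (S T : finType) (a : {perm S}) (b : {perm T}) x :
  prod_perm a b x = (a x.1, b x.2).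
Proof. by rewrite permE. Qed.

Lemma prod_permM (S T : finType) (a c : {perm S}) (b d : {perm T}) :
  (prod_perm a b * prod_perm c d)%g = prod_perm (a * c)%g (b * d)%g.
Proof. by apply/permP=> x; rewrite permM !prod_permE !permM. Qed.

Lemma prod_perm1 (S T : finType) : prod_perm 1 1 = 1%g :> {perm S * T}.
Proof. by apply/permP=> -[x y]; rewrite prod_permE !perm1. Qed.

Lemma prod_permV (S T : finType) (a : {perm S}) (b : {perm T}) :
  ((prod_perm a b)^-1)%g = prod_perm a^-1%g b^-1%g.
Proof.
by apply: (mulgI (prod_perm a b)); rewrite mulgV prod_permM !mulgV prod_perm1.
Qed.

Lemma prod_perm_split (S T : finType) (g : {perm S * T}) (x0 : S) (y0 : T) :
    (forall x y y', (g (x, y)).1 = (g (x, y')).1) ->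
    (forall x x' y, (g (x, y)).2 = (g (x', y)).2) ->
  exists a b, g = prod_perm a b.
Proof.
move=> g1 g2.
have ginj1 : injective (fun x => (g (x, y0)).1).
  move=> x x' E; suff /perm_inj[] : g (x, y0) = g (x', y0) by [].
  by rewrite [LHS]surjective_pairing E (g2 x x') -surjective_pairing.
have ginj2 : injective (fun y => (g (x0, y)).2).
  move=> y y' E; suff /perm_inj[] : g (x0, y) = g (x0, y') by [].
  by rewrite [LHS]surjective_pairing E (g1 x0 y y') -surjective_pairing.
exists (perm ginj1), (perm ginj2); apply/permP=> -[x y].
by rewrite prod_permE !permE /= (g1 x y0 y) (g2 x0 x y) -surjective_pairing.
Qed.

(** 2-closedness of a group containing the translations, freed from orbital digraphs: a map that
    agrees on each pair of points with some element of [A] belongs to [A]. *)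
Definition pair_closed (T : finType) (A : {set {perm T}}) := forall g : {perm T},
  (forall x y, x != y -> exists h, [/\ h \in A, h x = g x & h y = g y]) -> g \in A.

Section Coordinates.

Variables (p : nat) (hp : prime p).
Local Notation F := 'F_p.
Local Notation V := (plane p).
Implicit Types (a b : {perm F}).

Lemma shift_pair (c d : F) : shift ((c, d) : V) = prod_perm (shift c) (shift d).
Proof. by apply/permP=> x; rewrite prod_permE !shiftE. Qed.

Lemma shift_conj1 a b :
  (shift ((1%R, 0%R) : V) ^ prod_perm a b)%g = prod_perm (shift 1%R ^ a)%g 1%g.
Proof.
rewrite shift_pair conjgE prod_permV !prod_permM -!conjgE; congr prod_perm.
apply/permP=> x; rewrite perm1 /conjg !permM shiftE add0r permKV //.
Qed.

Lemma shift_conj2 a b :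
  (shift ((0%R, 1%R) : V) ^ prod_perm a b)%g = prod_perm 1%g (shift 1%R ^ b)%g.
Proof.
rewrite shift_pair conjgE prod_permV !prod_permM -!conjgE; congr prod_perm.
apply/permP=> x; rewrite perm1 /conjg !permM shiftE add0r permKV //.
Qed.

Variable G : {group {perm V}}.
Hypothesis shiftG : forall v : V, shift v \in G.

Definition slice1 := [set a | prod_perm a 1%g \in G].
Definition slice2 := [set b | prod_perm 1%g b \in G].

Lemma slice1_group : group_set slice1.
Proof.
apply/group_setP; split=> [|a b]; first by rewrite inE prod_perm1 group1.
by rewrite !inE => aG bG; rewrite -[1%g]mulg1 -prod_permM groupM.
Qed.

Lemma slice2_group : group_set slice2.
Proof.
apply/group_setP; split=> [|a b]; first by rewrite inE prod_perm1 group1.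
by rewrite !inE => aG bG; rewrite -[1%g]mulg1 -prod_permM groupM.
Qed.

Canonical slice1_Group := Group slice1_group.
Canonical slice2_Group := Group slice2_group.

Lemma shift_perm0 : shift (0 : F) = 1%g.
Proof. by apply/permP=> x; rewrite shiftE add0r perm1. Qed.

Lemma shift_slice1 c : shift c \in slice1_Group.
Proof. by rewrite inE -shift_perm0 -shift_pair. Qed.

Lemma shift_slice2 c : shift c \in slice2_Group.
Proof. by rewrite inE -shift_perm0 -shift_pair. Qed.

(** The first coordinate [a] of an element need not lie in the slice, but the conjugate
    [shift 1 ^ a] does. *)
Lemma slice1_AGL1 : slice1 \subset AGL1 p ->
  forall a b, prod_perm a b \in G -> a \in AGL1 p.
Proof.
move=> sub a b abG; apply: conj_shift_AGL1; apply: (subsetP sub).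
by rewrite inE -(shift_conj1 a b) groupJ ?shiftG.
Qed.

Lemma slice2_AGL1 : slice2 \subset AGL1 p ->
  forall a b, prod_perm a b \in G -> b \in AGL1 p.
Proof.
move=> sub a b abG; apply: conj_shift_AGL1; apply: (subsetP sub).
by rewrite inE -(shift_conj2 a b) groupJ ?shiftG.
Qed.

Lemma slice1_transitive : two_transitive slice1 ->
  forall x y a, exists2 h, h \in slice1 & h x = a x /\ h y = a y.
Proof.
move=> t1 x y a; have [->|xy] := eqVneq x y.
  exists (shift (a y - y)); first exact: shift_slice1.
  by rewrite shiftE subrK.
have [|h [h1 hx hy]] := t1 x y (a x) (a y) xy; first by rewrite (inj_eq perm_inj).
by exists h.
Qed.

Lemma slice2_transitive : two_transitive slice2 ->
  forall x y a, exists2 h, h \in slice2 & h x = a x /\ h y = a y.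
Proof.
move=> t1 x y a; have [->|xy] := eqVneq x y.
  exists (shift (a y - y)); first exact: shift_slice2.
  by rewrite shiftE subrK.
have [|h [h1 hx hy]] := t1 x y (a x) (a y) xy; first by rewrite (inj_eq perm_inj).
by exists h.
Qed.

Lemma slice1_full : pair_closed G -> two_transitive slice1 -> forall a, prod_perm a 1%g \in G.
Proof.
move=> clG t1 a; apply: clG => -[x y] [x' y'] _.
have [h h1 [hx hx']] := slice1_transitive t1 x x' a.
by exists (prod_perm h 1%g); rewrite inE in h1; rewrite h1 !prod_permE !perm1 /= hx hx'.
Qed.

Lemma slice2_full : pair_closed G -> two_transitive slice2 -> forall b, prod_perm 1%g b \in G.
Proof.
move=> clG t1 a; apply: clG => -[x y] [x' y'] _.
have [h h1 [hy hy']] := slice2_transitive t1 y y' a.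
by exists (prod_perm 1%g h); rewrite inE in h1; rewrite h1 !prod_permE !perm1 /= hy hy'.
Qed.

Lemma coord_prodP (A B : {set {perm F}}) g :
  reflect (exists a b, [/\ a \in A, b \in B & g = prod_perm a b]) (g \in coord_prod A B).
Proof.
apply: (iffP imset2P) => [[a b aA bB ->]|[a [b [aA bB ->]]]]; first by exists a, b.
by exists a b.
Qed.

Lemma solvable_shift_normalized (H : {group {perm V}}) :
  (forall g h, g \in H -> h \in H -> exists v, [~ g, h]%g = shift v) -> solvable H.
Proof.
move=> comH.
have abT : abelian (shift_Group V).
  apply/centsP=> _ /imsetP[u _ ->] _ /imsetP[v _ ->].
  by apply/permP=> x; rewrite !permM !shiftE addrCA.
have sub : (H^`(1) \subset shift_Group V)%g.
  rewrite gen_subG; apply/subsetP=> _ /imset2P[g h gH hH ->].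
  by have [v ->] := comH g h gH hH; apply/imsetP; exists v.
rewrite (series_sol (der_normal 1 H)) (abelian_sol (abelianS sub abT)).
by rewrite abelian_sol // der_abelian.
Qed.

Lemma AGL1_commute_shift a b : a \in AGL1 p -> b \in AGL1 p -> exists v, [~ a, b]%g = shift v.
Proof.
move=> /AGL1P[c [d [c0 aE]]] /AGL1P[c' [d' [c'0 bE]]].
have E x : (b * a)%g x = (a * b)%g x + (c * d' + d - c' * d - d').
  by rewrite !permM !aE !bE; ring.
exists (- (c * d' + d - c' * d - d')); apply/permP=> x.
rewrite shiftE commgEl.
have -> : (a^-1 * a ^ b)%g = ((b * a)^-1 * (a * b))%g by rewrite conjgE invMg !mulgA.
rewrite permM; set y := fun_of_perm _ x.
have : (b * a)%g y = x by rewrite permKV.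
by rewrite E => <-; rewrite addrC addrK.
Qed.

Lemma coord_AGL1_solvable (H : {group {perm V}}) :
  H \subset coord_prod (AGL1 p) (AGL1 p) -> solvable H.
Proof.
move=> sub; apply: solvable_shift_normalized => g h /(subsetP sub)/coord_prodP[a [b [aA bA ->]]].
move=> /(subsetP sub)/coord_prodP[c [d [cA dA ->]]].
have [v vE] := AGL1_commute_shift aA cA; have [w wE] := AGL1_commute_shift bA dA.
exists (v, w); rewrite shift_pair -vE -wE !commgEl !conjgE !prod_permV !prod_permM.
by rewrite !mulgA.
Qed.

Lemma solvable_slice1_full (H : {group {perm V}}) : (forall a, prod_perm a 1%g \in H) ->
  solvable H -> AGL1 p = [set: {perm F}].
Proof.
move=> full solH; apply/eqP; rewrite eqEsubset subsetT.
have fM : {in [set: {perm F}] &, {morph (fun a => prod_perm a 1%g : {perm V}) : a b / (a * b)%g}}.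
  by move=> a b _ _; rewrite prod_permM mulg1.
pose f := Morphism fM.
have injf : ('injm f)%g.
  apply/injmP => a b _ _ /permP E; apply/permP=> x.
  by have := E (x, 0); rewrite /= !prod_permE => -[].
apply: (@solvable_AGL1 p hp [set: {perm F}]%G) => [v|]; first by rewrite inE.
rewrite -(injm_sol injf) //; apply: solvableS solH.
by apply/subsetP=> _ /morphimP[a _ _ ->] /=.
Qed.

End Coordinates.

(** * Change of coordinates *)

Section ChangeOfCoordinates.

Variable V : finZmodType.
Implicit Types (G : {group {perm V}}).

Lemma pair_closedJ (T : finType) (A : {set {perm T}}) (s : {perm T}) :
  pair_closed A -> pair_closed (A :^ s)%g.
Proof.
move=> clA g gA; rewrite mem_conjg; apply: clA => x y xy.
have [|h [hA hx hy]] := gA (s x) (s y); first by rewrite (inj_eq perm_inj).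
exists (h ^ s^-1)%g; split; first by rewrite -mem_conjg.
  by rewrite -[in LHS](permK s x) permJ hx -[in RHS](permK s x) permJ.
by rewrite -[in LHS](permK s y) permJ hy -[in RHS](permK s y) permJ.
Qed.

Lemma two_transitiveJ (T : finType) (A : {set {perm T}}) (s : {perm T}) :
  two_transitive A -> two_transitive (A :^ s)%g.
Proof.
move=> tA x y x' y' xy xy'.
have [||h [hA hx hy]] := tA (s^-1 x)%g (s^-1 y)%g (s^-1 x')%g (s^-1 y')%g;
  rewrite ?(inj_eq perm_inj) //.
exists (h ^ s)%g; split; first by rewrite memJ_conjg.
  by rewrite -[x](permKV s) permJ hx permKV.
by rewrite -[y](permKV s) permJ hy permKV.
Qed.

Variable s : {perm V}.
Hypothesis sD : {morph s : x y / x + y}.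

Lemma additive0 : s 0 = 0.
Proof. by apply: (addIr (s 0)); rewrite -sD !add0r. Qed.

Lemma additiveB : {morph s : x y / x - y}.
Proof. by move=> x y; apply: (addIr (s y)); rewrite -sD !subrK. Qed.

Lemma additiveV : {morph (s^-1)%g : x y / x + y}.
Proof. by move=> x y; apply: (canLR (permK s)); rewrite sD !permKV. Qed.

Lemma shiftJ G : (forall v, shift v \in G) -> forall v, shift v \in (G :^ s)%G.
Proof.
move=> sG v; rewrite (_ : shift v = shift ((s^-1)%g v) ^ s)%g ?memJ_conjg //.
by apply/permP=> x; rewrite -[x](permKV s) permJ !shiftE sD !permKV.
Qed.

Lemma stable_primitiveJ G : stable_primitive G -> stable_primitive (G :^ s)%G.
Proof.
move=> pG B sB B0 BD; have [||||] := pG (s @^-1: B).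
- move=> g gG x y; by rewrite !inE !additiveB // -(permJ g s x) -(permJ g s y) sB ?memJ_conjg.
- by rewrite inE additive0.
- by move=> x y; rewrite !inE sD; apply: BD.
- move=> BT; left; apply/setP=> x; rewrite inE -[x](permKV s).
  by have := in_setT ((s^-1)%g x); rewrite -BT inE.
move=> Bx; right; apply/setP=> x; rewrite -[x](permKV s).
have : ((s^-1)%g x \in s @^-1: B) = ((s^-1)%g x == 0) by rewrite Bx inE.
by rewrite !inE => ->; rewrite -[X in _ = (_ == X)]additive0 (inj_eq perm_inj).
Qed.

End ChangeOfCoordinates.

Section PlaneCoordinates.

Variables (p : nat) (hp : prime p).
Local Notation F := 'F_p.
Local Notation V := (plane p).
Implicit Types (g h s : {perm V}) (G : {group {perm V}}).

Lemma exists_coordinates (u v : V) : det2 u v != 0 ->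
  exists s : {perm V}, [/\ {morph s : x y / x + y}, s u = (1, 0) & s v = (0, 1)].
Proof.
move=> uv0; pose t (x : V) : V := (det2 x v / det2 u v, det2 u x / det2 u v).
have t_inj : injective t.
  have tE x : x = scale2 (t x).1 u + scale2 (t x).2 v := plane_basis x uv0.
  by move=> x y E; rewrite (tE x) E -tE.
exists (perm t_inj); split=> [x y||]; rewrite !permE /t.
- by rewrite det2Dl det2Dr !mulrDl.
- by rewrite divff // det2vv mul0r.
by rewrite divff // det2vv mul0r.
Qed.

Lemma coord_axis1 h : (forall x t, det2 (1, 0) (h (x + scale2 t (1, 0)) - h x) = 0) ->
  forall a a' b, (h (a, b)).2 = (h (a', b)).2.
Proof.
move=> E a a' b; have := E (a', b) (a - a').
rewrite (_ : (a', b) + _ = (a, b)); last first.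
  by congr (_, _) => /=; rewrite ?mulr1 ?mulr0 ?addr0 // addrC subrK.
by rewrite /det2 /= mul1r mul0r subr0 => /eqP; rewrite subr_eq0 => /eqP.
Qed.

Lemma coord_axis2 h : (forall x t, det2 (0, 1) (h (x + scale2 t (0, 1)) - h x) = 0) ->
  forall a b b', (h (a, b)).1 = (h (a, b')).1.
Proof.
move=> E a b b'; have := E (a, b') (b - b').
rewrite (_ : (a, b') + _ = (a, b)); last first.
  by congr (_, _) => /=; rewrite ?mulr1 ?mulr0 ?addr0 // addrC subrK.
by rewrite /det2 /= mul1r mul0r sub0r => /eqP; rewrite oppr_eq0 subr_eq0 => /eqP.
Qed.

Lemma coord_parallel (s g : {perm V}) (u v u' v' : V) : {morph s : x y / x + y} -> u != 0 ->
    s u = u' -> s v = v' ->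
    (forall x t, det2 u (g (x + scale2 t v) - g x) = 0) ->
  forall x t, det2 u' ((g ^ s)%g (x + scale2 t v') - (g ^ s)%g x) = 0.
Proof.
move=> sD u0 <- <- E x t; rewrite -(additive_scale2 sD) -[x](permKV s) -sD !permJ -additiveB //.
have /eqP/(parallelP _ u0)[c ->] := E ((s^-1)%g x) t.
by rewrite additive_scale2 // det2Zr det2vv mulr0.
Qed.

Lemma coord_split s g (u v : V) : {morph s : x y / x + y} -> det2 u v != 0 ->
    s u = (1, 0) -> s v = (0, 1) ->
    (forall x t, det2 u (g (x + scale2 t u) - g x) = 0) ->
    (forall x t, det2 v (g (x + scale2 t v) - g x) = 0) ->
  exists a b, (g ^ s)%g = prod_perm a b.
Proof.
move=> sD uv su sv gu gv.
have u0 : u != 0 by apply: contraNneq uv => ->; rewrite /det2 !mul0r subrr.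
have v0 : v != 0 by apply: contraNneq uv => ->; rewrite /det2 !mulr0 subrr.
apply: (@prod_perm_split _ _ _ 0 0).
  exact: coord_axis2 (coord_parallel sD v0 sv sv gv).
exact: coord_axis1 (coord_parallel sD u0 su su gu).
Qed.

Lemma swapE (x : V) : swap_perm F x = (x.2, x.1).
Proof. by rewrite permE. Qed.

Lemma swapK : (swap_perm F * swap_perm F = 1)%g.
Proof. by apply/permP=> -[a b]; rewrite permM !swapE perm1. Qed.

Lemma coord_swap_split s g (u v : V) : {morph s : x y / x + y} -> det2 u v != 0 ->
    s u = (1, 0) -> s v = (0, 1) ->
    (forall x t, det2 v (g (x + scale2 t u) - g x) = 0) ->
    (forall x t, det2 u (g (x + scale2 t v) - g x) = 0) ->
  exists a b, (g ^ s)%g = (prod_perm a b * swap_perm F)%g.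
Proof.
move=> sD uv su sv gu gv.
have u0 : u != 0 by apply: contraNneq uv => ->; rewrite /det2 !mul0r subrr.
have v0 : v != 0 by apply: contraNneq uv => ->; rewrite /det2 !mulr0 subrr.
have [a [b E]] : exists a b, (g ^ s * swap_perm F)%g = prod_perm a b.
  have swE (k : {perm V}) x : (k * swap_perm F)%g x = ((k x).2, (k x).1).
    by rewrite permM swapE.
  apply: (@prod_perm_split _ _ _ 0 0) => [x y y'|x x' y]; rewrite !swE /=.
    have /(_ (x, y') (y - y')) := coord_parallel sD u0 su sv gv.
    rewrite (_ : (x, y') + _ = (x, y)); last first.
      by congr (_, _) => /=; rewrite ?mulr1 ?mulr0 ?addr0 // addrC subrK.
    by rewrite /det2 /= mul1r mul0r subr0 => /eqP; rewrite subr_eq0 => /eqP.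
  have /(_ (x', y) (x - x')) := coord_parallel sD v0 sv su gu.
  rewrite (_ : (x', y) + _ = (x, y)); last first.
    by congr (_, _) => /=; rewrite ?mulr1 ?mulr0 ?addr0 // addrC subrK.
  by rewrite /det2 /= mul1r mul0r sub0r => /eqP; rewrite oppr_eq0 subr_eq0 => /eqP.
by exists a, b; rewrite -E -mulgA swapK mulg1.
Qed.

End PlaneCoordinates.

(** * Primitive groups *)

Section Primitive.

Variables (p : nat) (hp : prime p).
Local Notation F := 'F_p.
Local Notation V := (plane p).
Implicit Types (g h s : {perm V}) (X Y : {set V}).

Section Directions.

Variable G : {group {perm V}}.
Hypothesis shiftG : forall v : V, shift v \in G.

Lemma multiples_stable v : exists X, [/\ diff_stable G X, scale_closed X, v \in X &
  forall u, u \in X <-> exists2 c : F, c != 0 & scale2 c u \in suborbit G v].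
Proof.
pose X := [set u : V | [exists c : F, (c != 0) && (scale2 c u \in suborbit G v)]].
have XP u : reflect (exists2 c : F, c != 0 & scale2 c u \in suborbit G v) (u \in X).
  by rewrite inE; apply: (iffP existsP) => [[c /andP[]]|[c c0 uS]]; exists c; rewrite ?c0.
exists X; split=> [g gG x y|c u c0 /XP[d d0 uS]||u]; last by split=> /XP.
- have st (c : F) : c != 0 ->
    (scale2 c (g y - g x) \in suborbit G v) = (scale2 c (y - x) \in suborbit G v).
    move=> c0; have ci0 : c^-1 != 0 by rewrite invr_eq0.
    have sc z : (scale2 c z \in suborbit G v) = (z \in [set scale2 c^-1 x | x in suborbit G v]).
      apply/idP/imsetP=> [zS|[w wS ->]]; first by exists (scale2 c z); rewrite ?scale2K.
      by rewrite -{1}[c]invrK scale2K.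
    by rewrite !sc (stable_scale2 hp ci0 (suborbit_stable shiftG v)).
  by apply/XP/XP => -[c c0 cS]; exists c => //; rewrite ?st // -st.
- by apply/XP; exists (d / c); rewrite ?mulf_neq0 ?invr_eq0 // scale2A divfK.
by apply/XP; exists 1; rewrite ?oner_eq0 // scale21 suborbit_refl.
Qed.

Lemma small_scale_closed X : diff_stable G X -> scale_closed X -> 0 \notin X ->
  exists Y, [/\ Y = X \/ Y = ~: X :\ 0, diff_stable G Y, scale_closed Y, 0 \notin Y &
    (#|Y| * 2 <= p * p - 1)%N].
Proof.
move=> sX cX X0.
have cardX : (#|X| + #|~: X :\ 0%R| = p * p - 1)%N.
  have := cardsC X; rewrite [#|~: X|](cardsD1 (0 : V)) inE X0 /= card_plane // => <-.
  by rewrite addnCA add1n subn1.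
have [small|big] := leqP (#|X| * 2) (p * p - 1); first by exists X; split=> //; left.
exists (~: X :\ 0); split; first by right.
- exact/stableD/stable0/stableC.
- move=> c v c0; rewrite !inE scale2_eq0 negb_or c0 => /andP[-> /=]; apply: contra => cvX.
  by rewrite -(scale2K v c0) cX // invr_eq0.
- by rewrite !inE eqxx.
move: cardX big; move: #|X| #|_ :\ _| => a b; lia.
Qed.

(** A vector of [Y] in a third direction is the sum of non-zero multiples of [u] and [v], which
    again belong to [Y]; the three provide the directions that force additivity. *)
Lemma two_directions Y u v : scale_closed Y ->
    (forall g w, g \in G -> w \in Y -> line_preserving g w) ->
    u \in Y -> v \in Y -> det2 u v != 0 ->
  (forall g, g \in G -> forall x y, g (x + y) - g x = g y - g 0) \/
  (forall w, w \in Y -> det2 u w = 0 \/ det2 v w = 0).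
Proof.
move=> cY lp uY vY uv0.
have [/forallP dir|] := boolP [forall w, (w \in Y) ==> (det2 u w == 0) || (det2 v w == 0)].
  by right=> w wY; have /implyP/(_ wY)/orP[/eqP|/eqP] := dir w; [left|right].
rewrite negb_forall => /existsP[w]; rewrite negb_imply negb_or => /and3P[wY uw vw].
left=> g gG; rewrite (plane_basis w uv0) in wY.
set a := det2 w v / _ in wY; set b := det2 u w / _ in wY.
have a0 : a != 0 by rewrite mulf_neq0 ?invr_eq0 // det2C oppr_eq0.
have b0 : b != 0 by rewrite mulf_neq0 ?invr_eq0.
apply: (three_directions_additive (u := scale2 a u) (v := scale2 b v)).
- by rewrite det2Zl det2Zr mulf_neq0 // mulf_neq0.
- by apply: lp => //; apply: cY.
- by apply: lp => //; apply: cY.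
exact: lp.
Qed.

End Directions.

Lemma prod_perm_AGL2 a b : a \in AGL1 p -> b \in AGL1 p -> prod_perm a b \in AGL2 p.
Proof.
move=> /AGL1P[c [d [c0 aE]]] /AGL1P[c' [d' [c'0 bE]]].
apply: additive_AGL2 => x y; rewrite !prod_permE !aE !bE /=.
by congr (_, _) => /=; ring.
Qed.

Lemma swap_AGL2 a b : a \in AGL1 p -> b \in AGL1 p ->
  (prod_perm a b * swap_perm F)%g \in AGL2 p.
Proof.
move=> /AGL1P[c [d [c0 aE]]] /AGL1P[c' [d' [c'0 bE]]].
apply: additive_AGL2 => x y; rewrite !permM !swapE !prod_permE !aE !bE /=.
by congr (_, _) => /=; ring.
Qed.

Lemma product_wreathP g :
  reflect ((exists a b, g = prod_perm a b) \/ (exists a b, g = prod_perm a b * swap_perm F)%g)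
    (g \in product_wreath_S2 F).
Proof.
have swG : group_set [set 1%g; swap_perm F].
  by apply/group_setP; split=> [|x y]; rewrite ?set21 // !inE;
    do 2![case/pred2P=> ->]; rewrite ?mulg1 ?mul1g ?swapK eqxx ?orbT.
have cyc : <[swap_perm F]>%g = [set 1%g; swap_perm F].
  apply/eqP; rewrite eqEsubset (@gen_subG _ _ (Group swG)) sub1set set22 /=.
  by apply/subsetP=> x; rewrite !inE => /pred2P[]->; rewrite ?group1 ?cycle_id.
apply: (iffP mulsgP) => [[x y /coord_prodP[a [b [_ _ ->]]]]|].
  rewrite cyc !inE => /pred2P[]->->; [left|right]; exists a, b => //.
  by rewrite mulg1.
have ab_in a b : prod_perm a b \in coord_prod [set: {perm F}] [set: {perm F}].
  by apply/coord_prodP; exists a, b; rewrite !inE.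
case=> -[a [b ->]].
  by exists (prod_perm a b) 1%g; rewrite ?group1 ?mulg1 ?ab_in.
by exists (prod_perm a b) (swap_perm F); rewrite ?cycle_id ?ab_in.
Qed.

Lemma conj_prod_perm (a b c d : {perm F}) :
  (prod_perm c d ^ prod_perm a b = prod_perm (c ^ a) (d ^ b))%g.
Proof. by rewrite conjgE prod_permV !prod_permM !conjgE. Qed.

Lemma conj_prod_swap (c d : {perm F}) : (prod_perm c d ^ swap_perm F = prod_perm d c)%g.
Proof.
have swV : ((swap_perm F)^-1 = swap_perm F)%g.
  by apply: (mulgI (swap_perm F)); rewrite mulgV swapK.
by apply/permP=> x; rewrite conjgE swV !permM !swapE !prod_permE.
Qed.

Lemma swap_conj1 (a b c : {perm F}) :
  (prod_perm c 1 ^ (prod_perm a b * swap_perm F) = prod_perm 1 (c ^ a))%g.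
Proof. by rewrite conjgM conj_prod_perm conj_prod_swap conj1g. Qed.

Lemma swap_conj2 (a b c : {perm F}) :
  (prod_perm 1 c ^ (prod_perm a b * swap_perm F) = prod_perm (c ^ b) 1)%g.
Proof. by rewrite conjgM conj_prod_perm conj_prod_swap conj1g. Qed.

(** By primitivity some element [k] interchanges the coordinates, since otherwise the lines of
    constant first coordinate would be blocks. Conjugation by [k] exchanges the two slices, so one
    full slice yields the whole wreath product; if both slices are affine, all of [H] is. *)
Lemma wreath_dichotomy (H : {group {perm V}}) : (forall v : V, shift v \in H) ->
    pair_closed H -> stable_primitive H -> H \subset product_wreath_S2 F ->
  H \subset AGL2 p \/ H = product_wreath_S2 F :> {set _}.
Proof.
move=> sH clH pH HW.
have [k kH [a [b kE]]] : exists2 k, k \in H & exists a b, k = (prod_perm a b * swap_perm F)%g.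
  have [/existsP[k /andP[kH sk]]|] := boolP [exists k, (k \in H) &&
      [exists a, exists b, k == (prod_perm a b * swap_perm F)%g]].
    by exists k => //; have /existsP[a /existsP[b /eqP kE]] := sk; exists a, b.
  rewrite negb_exists => /forallP nos.
  have straight g : g \in H -> exists a b, g = prod_perm a b.
    move=> gH; have := subsetP HW _ gH; case/product_wreathP=> // -[a [b gE]].
    have := nos g; rewrite gH /= => /existsP[]; exists a; apply/existsP.
    by exists b; apply/eqP.
  have [||||B1] := pH [set x : V | x.1 == 0].
  - move=> g /straight[a [b ->]] x y; rewrite !inE !prod_permE /= !subr_eq0.
    by rewrite (inj_eq perm_inj).
  - by rewrite inE.
  - by move=> x y; rewrite !inE /= => /eqP-> /eqP->; rewrite addr0.
  - by move/setP/(_ (1, 0)); rewrite !inE /= oner_eq0.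
  by have /setP/(_ (0, 1)) := B1; rewrite !inE plane_eq0 /= eqxx oner_eq0.
have fullW : (forall c, prod_perm c 1%g \in H) -> (forall c, prod_perm 1%g c \in H) ->
    H = product_wreath_S2 F :> {set _}.
  move=> H1 H2; apply/eqP; rewrite eqEsubset HW; apply/subsetP=> g.
  have H12 c d : prod_perm c d \in H.
    by rewrite -[c]mulg1 -[d]mul1g -prod_permM groupM.
  have swH : swap_perm F \in H by rewrite -(groupMl _ (H12 a b)) -kE.
  by case/product_wreathP=> -[c [d ->]]; rewrite ?groupM.
have [t1|A1] := burnside_prime_degree hp (shift_slice1 sH).
  have H1 := slice1_full sH clH t1; right; apply: fullW => // c.
  by rewrite -[c](conjgKV a) -(swap_conj1 a b) -kE groupJ ?H1.
have [t2|A2] := burnside_prime_degree hp (shift_slice2 sH).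
  have H2 := slice2_full sH clH t2; right; apply: fullW => // c.
  by rewrite -[c](conjgKV b) -(swap_conj2 a b) -kE groupJ ?H2.
left; apply/subsetP=> g gH; case/product_wreathP: (subsetP HW _ gH) => -[c [d gE]].
  by rewrite gE in gH *; apply: prod_perm_AGL2;
    [apply: (slice1_AGL1 sH A1 gH)|apply: (slice2_AGL1 sH A2 gH)].
rewrite gE; apply: swap_AGL2; apply: conj_shift_AGL1 => //.
  apply: (subsetP A2); rewrite inE -(swap_conj1 c d) -gE groupJ //.
  by have := shift_slice1 sH 1; rewrite inE.
apply: (subsetP A1); rewrite inE -(swap_conj2 c d) -gE groupJ //.
by have := shift_slice2 sH 1; rewrite inE.
Qed.

Lemma simply_primitive_structure (G : {group {perm V}}) : (forall v : V, shift v \in G) ->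
    pair_closed G -> stable_primitive G -> ~ two_transitive G ->
  exists2 s : {perm V}, {morph s : x y / x + y} &
    (G :^ s)%G \subset AGL2 p \/ (G :^ s)%G = product_wreath_S2 F :> {set _}.
Proof.
move=> sG clG pG ntG.
have id_case : G \subset AGL2 p -> exists2 s : {perm V}, {morph s : x y / x + y} &
    (G :^ s)%G \subset AGL2 p \/ (G :^ s)%G = product_wreath_S2 F :> {set _}.
  by move=> GA; exists 1%g => [x y|]; [rewrite !perm1|left; rewrite /= conjsg1].
have [v0 [w0 [v00 w00 w0v0]]] : exists v w, [/\ v != 0, w != 0 & w \notin suborbit G v].
  have [/existsP[v /existsP[w /and3P[]]]|] := boolP
    [exists v, exists w, [&& v != 0, w != 0 & w \notin suborbit G v]]; first by exists v, w.
  move=> no; case: ntG; apply: suborbit_two_transitive => // v w vn wn.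
  apply: contraR no => vw; apply/existsP; exists v; apply/existsP; exists w.
  by rewrite vn wn.
have [cov|] := boolP [forall v, forall w, (v != 0) ==> (w != 0) ==>
    [exists c, (c != 0) && (scale2 c w \in suborbit G v)]].
  apply: id_case; apply: (pseudo_cyclotomic_affine hp sG v00 w00 w0v0) => // v w vn wn.
  have /forallP/(_ w) := forallP cov v; rewrite vn wn /= => /existsP[c /andP[]].
  by exists c.
rewrite negb_forall => /existsP[v1]; rewrite negb_forall => /existsP[w1].
rewrite 2!negb_imply => /and3P[v10 w10 nocov].
have [X [sX cX v1X XP]] := multiples_stable sG v1.
have X0 : 0 \notin X.
  apply/negP=> /XP[c c0]; rewrite scale2r0 => S0.
  by have := suborbit_neq0 v10 S0; rewrite eqxx.
have w1X : w1 \notin X.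
  by apply: contra nocov => /XP[c c0 cS]; apply/existsP; exists c; rewrite c0.
have [Y [YX sY cY Y0 smallY]] := small_scale_closed sX cX X0.
have [u uY] : exists u, u \in Y.
  by case: YX => ->; [exists v1|exists w1; rewrite !inE w10 w1X].
have u0 : u != 0 by apply: contraNneq Y0 => <-.
have [v vY uv] : exists2 v, v \in Y & det2 u v != 0.
  have [/existsP[v /andP[]]|] := boolP [exists v, (v \in Y) && (det2 u v != 0)]; first by exists v.
  rewrite negb_exists => /forallP no.
  (* With a single direction in [Y], adding 0 gives a stable line, which contradicts primitivity. *)
  have YE : Y :|: [set 0] = [set x | det2 u x == 0].
    apply/setP=> x; rewrite !inE; have := no x; rewrite negb_and negbK.
    have [xY /= ->|xY _ /=] := boolP (x \in Y); first by [].
    apply/eqP/(parallelP _ u0) => [->|[c xE]]; first by exists 0; rewrite scale20.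
    apply/eqP; apply: contraNT xY; rewrite xE scale2_eq0 negb_or => /andP[c0 _].
    exact: cY.
  have [||||B0] := pG [set x | det2 u x == 0].
  - by rewrite -YE; apply/stableU/stable0.
  - by rewrite inE /det2 !mulr0 subrr.
  - by move=> x y; rewrite !inE det2Dr => /eqP-> /eqP->; rewrite addr0.
  - have [z uz] := exists_det2 u0; move/setP/(_ z); rewrite !inE uz.
    by rewrite oner_eq0.
  by have /setP/(_ u) := B0; rewrite !inE det2vv eqxx (negbTE u0).
have lp g w : g \in G -> w \in Y -> line_preserving g w.
  exact: (stable_line_preserving hp sY cY Y0 smallY).
have [aff|dir] := two_directions cY lp uY vY uv.
  by apply: id_case; apply/subsetP=> g gG; apply: additive_AGL2 => //; apply: aff.
have v_0 : v != 0 by apply: contraNneq Y0 => <-.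
have [s [sD su sv]] := exists_coordinates uv.
exists s => //; apply: wreath_dichotomy.
- exact: shiftJ.
- exact: pair_closedJ.
- exact: stable_primitiveJ.
apply/subsetP=> _ /imsetP[g gG ->].
have {}lp w := lp g w gG.
have gY w : w \in Y -> g w - g 0 \in Y by move=> wY; rewrite sY // subr0.
have par w z x t : w \in Y -> det2 z (g w - g 0) = 0 -> z != 0 ->
    det2 z (g (x + scale2 t w) - g x) = 0.
  move=> wY E z0; have wn : w != 0 by apply: contraNneq Y0 => <-.
  have gw0 : g w - g 0 != 0 by rewrite subr_eq0 (inj_eq perm_inj).
  have /eqP/(parallelP _ gw0)[c ->] := parallel_image x t wn (lp w wY).
  by rewrite det2Zr E mulr0.
have indep := det2_image_neq0 (lp u uY) uv.
apply/product_wreathP.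
have [Eu|Eu] := dir _ (gY u uY); have [Ev|Ev] := dir _ (gY v vY).
- have /(parallelP _ u0)[c Ec] : det2 u (g u - g 0) == 0 by apply/eqP.
  by move: indep; rewrite Ec det2Zl Ev mulr0 eqxx.
- by left; apply: (coord_split sD uv su sv) => x t; apply: par.
- by right; apply: (coord_swap_split sD uv su sv) => x t; apply: par.
have /(parallelP _ v_0)[c Ec] : det2 v (g u - g 0) == 0 by apply/eqP.
by move: indep; rewrite Ec det2Zl Ev mulr0 eqxx.
Qed.

End Primitive.

(** * Imprimitive groups *)

Section Imprimitive.

Variables (p : nat) (hp : prime p).
Local Notation F := 'F_p.
Local Notation V := (plane p).
Implicit Types (g h s : {perm V}) (X Y : {set V}).

Definition line (e : V) : {set V} := [set x | det2 e x == 0].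

Section StableLine.

Variable G : {group {perm V}}.
Hypothesis shiftG : forall v : V, shift v \in G.

(** A stable set closed under addition is a subspace over the prime field, and a proper non-zero
    subspace of the plane is a line. *)
Lemma imprimitive_stable_line : ~~ [primitive G, on [set: V] | 'P] ->
  exists2 e, e != 0 & diff_stable G (line e).
Proof.
pose st e := [forall g in G, forall x, forall y, (g y - g x \in line e) == (y - x \in line e)].
have stP e : st e -> diff_stable G (line e).
  by move=> se g gG x y; have /forallP/(_ x)/forallP/(_ y)/eqP := forall_inP se g gG.
have [/existsP[e /andP[e0 se]] _|no] := boolP [exists e : V, (e != 0) && st e].
  by exists e => //; apply: stP.
case/negP; apply: (stable_primitiveP shiftG) => B sB B0 BD.
have [/existsP[e /andP[eB e0]]|noe] := boolP [exists e, (e \in B) && (e != 0)]; last first.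
  right; apply/setP=> x; rewrite inE; apply/idP/eqP=> [xB|->//]; apply/eqP.
  by apply: contraR noe => x0; apply/existsP; exists x; rewrite xB.
left; have multB u (c : F) : u \in B -> scale2 c u \in B.
  move=> uB; rewrite -(natr_Zp c) scale2_natr; elim: (c : nat) => [|n IHn] //.
  by rewrite mulrS BD.
have [/existsP[v /andP[vB ev]]|nov] := boolP [exists v, (v \in B) && (det2 e v != 0)].
  by apply/setP=> x; rewrite inE (plane_basis x ev) BD ?multB.
case/negP: no; apply/existsP; exists e; rewrite e0 /st.
have <- : B = line e.
  apply/setP=> x; rewrite inE; apply/idP/(parallelP _ e0)=> [xB|[c ->]]; last exact: multB.
  apply/(parallelP _ e0); apply: contraR nov => ex; apply/existsP; exists x.
  by rewrite xB.
apply/forall_inP=> g gG; apply/forallP=> x; apply/forallP=> y; apply/eqP.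
exact: sB.
Qed.

Lemma card_stabilizer : #|G| = (p * p * #|'C_G[(0 : V)%R | 'P]%g|)%N.
Proof.
have := card_orbit 'P G (0 : V).
rewrite (atransP (shift_trans shiftG)) ?inE // cardsT (card_plane hp) => ->.
by rewrite mulnC Lagrange ?subsetIl.
Qed.

Hypothesis cardG : ~~ (p ^ 3 %| #|G|)%N.

Lemma stabilizer_p' : ~~ (p %| #|'C_G[(0 : V)%R | 'P]%g|)%N.
Proof.
apply: contra cardG => pC; rewrite card_stabilizer expnS mulnC.
by rewrite -mulnn dvdn_mul.
Qed.

Lemma suborbit_p' v : ~~ (p %| #|suborbit G v|)%N.
Proof.
apply: contra stabilizer_p' => /dvdn_trans; apply.
rewrite (_ : suborbit G v = orbit 'P 'C_G[(0 : V)%R | 'P]%g v) ?card_orbit ?dvdn_indexg //.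
apply/setP=> x; apply/imsetP/imsetP=> [[g gG ->]|[g /setIP[gG /astab1P g0] ->]].
  exists (g * shift (- g 0))%g; last by rewrite /= apermE permM shiftE addrC.
  rewrite inE groupM //=; apply/astab1P; rewrite /= apermE permM shiftE.
  by rewrite addNr.
by exists g => //; move: g0; rewrite /= !apermE => ->; rewrite subr0.
Qed.

Variable e : V.
Hypotheses (e0 : e != 0) (stableL : diff_stable G (line e)).

Lemma line_line_preserving g : g \in G -> line_preserving g e.
Proof.
move=> gG x s t.
have par c : exists d, g (x + scale2 c e) - g x = scale2 d e.
  apply/(parallelP _ e0); have := stableL gG x (x + scale2 c e).
  by rewrite !inE addrAC subrr add0r det2Zr det2vv mulr0 eqxx.
have [a ->] := par s; have [b ->] := par t.
by rewrite det2Zl det2Zr det2vv !mulr0.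
Qed.

Lemma mem_suborbit u v : (u \in suborbit G v) = (suborbit G u == suborbit G v).
Proof.
apply/idP/eqP=> [/(suborbit_eq shiftG)//|<-]; exact: suborbit_refl.
Qed.

(* Otherwise every point of the affine line det2 e u = 1 has the same number of
   multiples in the suborbit, whose size is then divisible by p. *)
Lemma multiples_proper v : det2 e v = 1 ->
  exists2 u, det2 e u != 0 & forall c, c != 0 -> scale2 c u \notin suborbit G v.
Proof.
move=> ev; set S := suborbit G v.
have SL x : x \in S -> det2 e x != 0.
  have sub : S \subset ~: line e.
    by apply: sub_suborbit; [exact: stableC|rewrite !inE ev oner_eq0].
  by move/(subsetP sub); rewrite !inE.
have [/existsP[u /andP[eu nS]]|cov] := boolP [exists u, (det2 e u != 0) &&
    [forall c, (c != 0) ==> (scale2 c u \notin S)]].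
  by exists u => // c c0; have /implyP/(_ c0) := forallP nS c.
have {}cov u : det2 e u != 0 -> exists2 c, c != 0 & scale2 c u \in S.
  move=> eu; move: cov; rewrite negb_exists => /forallP/(_ u); rewrite eu /=.
  rewrite negb_forall => /existsP[c]; rewrite negb_imply negbK => /andP[c0 cS].
  by exists c.
case/negP: (suborbit_p' v); rewrite -/S.
pose N (u : V) := [set c : F | scale2 c u \in S].
have N0 u c : c \in N u -> c != 0.
  rewrite inE => /SL; apply: contraNneq => ->.
  by rewrite scale20 /det2 !mulr0 subrr.
have cardN u : det2 e u != 0 -> #|N u| = #|N v|.
  move=> /cov[d d0 duS].
  suff -> : N u = [set c * d | c in N v] by rewrite card_imset //; apply: mulIf.
  have main c : c != 0 -> (c * d \in N u) = (c \in N v).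
    move=> c0; rewrite !inE -scale2A [LHS]mem_suborbit [RHS]mem_suborbit.
    rewrite (suborbit_scale2 hp shiftG (scale2 d u) c0) (suborbit_eq shiftG duS).
    by rewrite (suborbit_scale2 hp shiftG v c0).
  apply/setP=> c; apply/idP/imsetP=> [cN|[c' c'N ->]]; last by rewrite main // (N0 _ _ c'N).
  have c0 := N0 _ _ cN; exists (c / d); last by rewrite divfK.
  by rewrite -main ?divfK // mulf_neq0 ?invr_eq0.
pose U := [set u : V | det2 e u == 1].
have cardU : #|U| = p.
  have -> : U = [set v + scale2 c e | c : F].
    apply/setP=> u; rewrite inE; apply/eqP/imsetP=> [eu|[c _ ->]]; last first.
      by rewrite det2Dr det2Zr det2vv mulr0 addr0.
    have /(parallelP _ e0)[c cE] : det2 e (u - v) == 0 by rewrite det2Br eu ev subrr.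
    by exists c => //; rewrite -cE addrC subrK.
  rewrite card_imset ?card_Fp // => c d /addrI/eqP.
  by rewrite -subr_eq0 -scale2B scale2_eq0 (negbTE e0) orbF subr_eq0 => /eqP.
rewrite -sum1_card (partition_big (fun x => scale2 (det2 e x)^-1 x) (mem U)) /=; last first.
  by move=> x /SL ex; rewrite inE det2Zr mulVf.
suff fib u : u \in U -> (\sum_(x in S | scale2 (det2 e x)^-1 x == u) 1 = #|N v|)%N.
  by rewrite (eq_bigr _ fib) sum_nat_const cardU dvdn_mulr.
rewrite inE => /eqP eu; have eu0 : det2 e u != 0 by rewrite eu oner_eq0.
have inj : injective (fun c : F => scale2 c u).
  move=> c d /(congr1 (det2 e)); by rewrite !det2Zr eu !mulr1.
rewrite -(cardN u eu0) -(card_imset _ inj) sum1_card; apply: eq_card => x.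
rewrite unfold_in; apply/andP/imsetP=> [[xS /eqP xu]|[c cN ->]].
  by exists (det2 e x); rewrite ?inE -xu scale2A mulfV ?scale21 ?SL.
have c0 := N0 _ _ cN; rewrite inE in cN; split=> //.
by rewrite det2Zr eu mulr1 scale2K.
Qed.

(* Maschke: u is the average of the images of a vector under the stabiliser of 0,
   each normalised by its action on the quotient by the line. *)
Lemma stable_affine_complement :
    (forall g, g \in G -> forall x y, g (x + y) - g x = g y - g 0) ->
  exists2 u, det2 u e != 0 &
    forall g, g \in G -> forall x t, det2 u (g (x + scale2 t u) - g x) = 0.
Proof.
move=> aff; have [v ev] := exists_det2 e0.
set C := 'C_G[(0 : V)%R | 'P]%g.
have CP g : g \in C -> g \in G /\ g 0 = 0.
  by case/setIP=> gG /astab1P; rewrite /= apermE.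
have CD g : g \in C -> {morph g : x y / x + y}.
  move=> /CP[gG g0] x y; have := aff g gG x y; rewrite g0 subr0 => <-.
  by rewrite [RHS]addrC subrK.
pose a g := det2 e (g v).
have aE g x : g \in C -> det2 e (g x) = a g * det2 e x.
  move=> gC; have [gG g0] := CP g gC.
  have := stableL gG 0 (x - scale2 (det2 e x) v); rewrite g0 !subr0 !inE.
  rewrite det2Br det2Zr ev mulr1 subrr eqxx => /eqP.
  have -> : g (x - scale2 (det2 e x) v) = g x - scale2 (det2 e x) (g v).
    apply: (addIr (scale2 (det2 e x) (g v))); rewrite subrK.
    by rewrite -(additive_scale2 (CD g gC)) -CD // subrK.
  by rewrite det2Br det2Zr => /eqP; rewrite subr_eq0 mulrC => /eqP.
have a0 g : g \in C -> a g != 0.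
  move=> gC; have [gG g0] := CP g gC.
  have := stableL gG 0 v; rewrite g0 !subr0 !inE ev oner_eq0.
  by rewrite /a => /negbT.
(* The sum is not divided by [#|C|]: [det2 e u] equals [#|C|], which is non-zero in F_p because [p]
   does not divide the order of the stabiliser. *)
pose u := \sum_(g in C) scale2 (a g)^-1 (g v).
have det2_sum (I : finType) (P : pred I) (f : I -> V) :
    det2 e (\sum_(i | P i) f i) = \sum_(i | P i) det2 e (f i).
  by apply: (big_morph (det2 e)) => [x y|]; rewrite ?det2Dr // /det2 !mulr0 subrr.
exists u.
  rewrite det2C oppr_eq0 det2_sum (eq_bigr (fun=> 1)) => [|g gC]; last first.
    by rewrite det2Zr mulVf ?a0.
  by rewrite sumr_const Fp_natr_eq0 // stabilizer_p'.
have uE h : h \in C -> h u = scale2 (a h) u.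
  move=> hC; have h0 : h 0 = 0 by case: (CP h hC).
  rewrite /u (big_morph h (CD h hC) h0) [RHS](big_morph _ (scale2Dr (a h)) (scale2r0 _)).
  rewrite [RHS](reindex_inj (mulIg h)) /=; apply: eq_big => [g|g gC].
    by rewrite groupMr.
  rewrite (additive_scale2 (CD h hC)) scale2A permM; congr scale2.
  have -> : a (g * h)%g = a h * a g by rewrite {1}/a permM aE.
  by rewrite invfM mulrA mulfV ?mul1r ?a0.
move=> g gG x t; rewrite aff //.
have hC : (g * shift (- g 0))%g \in C.
  by rewrite inE groupM //=; apply/astab1P; rewrite /= apermE permM shiftE addNr.
have -> : g (scale2 t u) - g 0 = (g * shift (- g 0))%g (scale2 t u).
  by rewrite permM shiftE addrC.
by rewrite (additive_scale2 (CD _ hC)) uE // !det2Zr det2vv !mulr0.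
Qed.

(** By [multiples_proper], the multiples of a suborbit off the line do not fill its complement, so a
    small stable set [Y] with a direction [u] off the line exists. Together with the line it either
    has a third direction, and [G] is affine, or [u] is the only direction of [Y] off the line, and
    every element of [G] must preserve it. *)
Lemma stable_complement : exists2 u, det2 u e != 0 &
  forall g, g \in G -> forall x t, det2 u (g (x + scale2 t u) - g x) = 0.
Proof.
have [v ev] := exists_det2 e0; have v0 : v != 0.
  by apply: contra_eq_neq ev => ->; rewrite /det2 !mulr0 subrr eq_sym oner_neq0.
have [w ew wS] := multiples_proper ev.
have [X [sX cX vX XP]] := multiples_stable hp shiftG v.
have X0 : 0 \notin X.
  apply/negP=> /XP[c c0]; rewrite scale2r0 => S0.
  by have := suborbit_neq0 v0 S0; rewrite eqxx.
have [Y [YX sY cY Y0 smallY]] := small_scale_closed hp sX cX X0.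
have [u uY eu] : exists2 u, u \in Y & det2 e u != 0.
  case: YX => ->; [exists v => //; first by rewrite ev oner_eq0|exists w => //].
  rewrite !inE; apply/andP; split; last by apply/negP=> /XP[c c0]; apply/negP/wS.
  by apply: contraNneq ew => ->; rewrite /det2 !mulr0 subrr.
pose Z := Y :|: (line e :\ 0).
have cZ : scale_closed Z.
  move=> c x c0; rewrite !inE scale2_eq0 negb_or c0 /= det2Zr mulf_eq0 (negbTE c0) /=.
  by case/orP=> [xY|->]; [rewrite cY|rewrite orbT].
have lpZ g x : g \in G -> x \in Z -> line_preserving g x.
  move=> gG; rewrite inE => /orP[|]; first exact: (stable_line_preserving hp sY cY Y0 smallY).
  rewrite !inE => /andP[_ /(parallelP _ e0)[c ->]].
  exact/line_preservingZ/line_line_preserving.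
have ue : det2 u e != 0 by rewrite det2C oppr_eq0.
have [||aff|dir] := two_directions cZ lpZ _ _ ue.
- by rewrite inE uY.
- by rewrite !inE e0 det2vv eqxx orbT.
- exact: stable_affine_complement.
exists u => // g gG x t.
have u0 : u != 0 by apply: contraNneq Y0 => <-.
have gu0 : g u - g 0 != 0 by rewrite subr_eq0 (inj_eq perm_inj).
have guY : g u - g 0 \in Y by rewrite sY // subr0.
have lpu : line_preserving g u by apply: lpZ; rewrite // inE uY.
have /eqP/(parallelP _ gu0)[c ->] := parallel_image x t u0 lpu.
have [|E|E] := dir (g u - g 0); first by rewrite inE guY.
  by rewrite det2Zr E mulr0.
by have := stableL gG 0 u; rewrite !inE subr0 E eqxx (negbTE eu).
Qed.

End StableLine.

End Imprimitive.

(** * Groups acting coordinatewise *)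

Section Decomposable.

Variables (p : nat) (hp : prime p).
Local Notation F := 'F_p.
Local Notation V := (plane p).
Local Notation S := [set: {perm F}].

Lemma swap_additive : {morph swap_perm F : x y / x + y}.
Proof. by move=> x y; rewrite !swapE. Qed.

Lemma AGL1_group : group_set (AGL1 p).
Proof.
apply/group_setP; split=> [|g h /AGL1P[a [b [a0 gE]]] /AGL1P[c [d [c0 hE]]]].
  by apply/AGL1P; exists 1, 0; rewrite oner_eq0; split=> // x; rewrite perm1 mul1r addr0.
apply/AGL1P; exists (c * a), (c * b + d); split=> [|x]; first by rewrite mulf_neq0.
by rewrite permM gE hE mulrDr mulrA addrA.
Qed.

(** For [p > 3] the transposition of 2 and 3 fixes 0 and 1, whereas an affine map with two fixed
    points is the identity. *)
Lemma AGL1_full_prime : AGL1 p = S -> p = 2 \/ p = 3.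
Proof.
move=> AS; have p1 := prime_gt1 hp.
have [p3|p3] := leqP p 3; first by case: (p) p1 p3 => [|[|[|[|n]]]] //; [left|right].
have n0 n : (0 < n < p)%N -> n%:R != 0 :> F.
  case/andP=> n0 np; rewrite Fp_natr_eq0 //.
  by apply: contraL np => /(dvdn_leq n0); rewrite -leqNgt.
have n2 : 2%:R != 0 :> F by apply: n0; rewrite /= ltnW.
have n3 : 3%:R != 0 :> F by apply: n0.
have /AGL1P[a [b [_ gE]]] : tperm 2%:R 3%:R \in AGL1 p by rewrite AS inE.
have b0 : b = 0 by have := gE 0; rewrite tpermD // mulr0 add0r.
have a1 : a = 1.
  have := gE 1; rewrite b0 addr0 mulr1 tpermD // -subr_eq0.
    by rewrite -{2}[1]/(1%:R) -natrB.
  by rewrite -{2}[1]/(1%:R) -natrB // oner_eq0.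
have := gE 2%:R; rewrite tpermL a1 b0 mul1r addr0 => /eqP.
by rewrite -subr_eq0 -natrB // oner_eq0.
Qed.

Lemma coord_prod_properl (A : {set {perm F}}) : A \proper AGL1 p -> AGL1 p = S ->
  coord_prod S A \proper coord_prod (AGL1 p) (AGL1 p).
Proof.
move=> /properP[sA [b bA nbA]] AS; apply/properP; split.
  apply/subsetP=> g /coord_prodP[c [d [cS dA ->]]]; apply/coord_prodP.
  by exists c, d; rewrite AS -{2}AS (subsetP sA).
exists (prod_perm 1%g b); first by apply/coord_prodP; exists 1%g, b; rewrite AS inE -AS.
apply: contra nbA => /coord_prodP[c [d [_ dA /permP E]]].
suff -> : b = d by [].
by apply/permP=> x; have := E (0, x); rewrite !prod_permE => -[].
Qed.

Lemma slice2_full_prod (H : {group {perm V}}) (A : {group {perm F}}) :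
    (forall a, prod_perm a 1%g \in H) -> slice2 H = A ->
    (forall h, h \in H -> exists a b, h = prod_perm a b) ->
  H = coord_prod S A :> {set _}.
Proof.
move=> full1 <- splitH; apply/setP=> h; apply/idP/coord_prodP=> [hH|[a [b [_ bA ->]]]].
  have [a [b hE]] := splitH h hH; exists a, b; rewrite inE; split=> //.
  by rewrite inE -[X in prod_perm X _](mulVg a) -[b]mul1g -prod_permM groupM // -hE.
by rewrite -[a]mulg1 -[b]mul1g -prod_permM groupM //; rewrite inE in bA.
Qed.

Lemma coord_prod_trichotomy (H : {group {perm V}}) : (forall v : V, shift v \in H) ->
    pair_closed H -> (forall h, h \in H -> exists a b, h = prod_perm a b) ->
  exists2 s : {perm V}, {morph s : x y / x + y} &
    [\/ (H :^ s)%g = coord_prod S S,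
        exists2 A : {group {perm F}}, A \proper AGL1 p & (H :^ s)%g = coord_prod S A
      | (H :^ s)%g \proper coord_prod (AGL1 p) (AGL1 p)].
Proof.
move=> sH clH splitH.
have full1_case (K : {group {perm V}}) : (forall v : V, shift v \in K) ->
    pair_closed K -> (forall h, h \in K -> exists a b, h = prod_perm a b) ->
    two_transitive (slice1 K) ->
    K = coord_prod S S :> {set _} \/
    exists2 A : {group {perm F}}, A \proper AGL1 p & K = coord_prod S A :> {set _}.
  move=> sK clK splitK t1; have full1 := slice1_full sK clK t1.
  have t2_case : two_transitive (slice2 K) -> K = coord_prod S S :> {set _}.
    move=> t2; apply: (@slice2_full_prod K [set: {perm F}]%G) => //.
    by apply/setP=> b; rewrite !inE (slice2_full sK clK t2).
  have [/t2_case|A2] := burnside_prime_degree hp (shift_slice2 sK); first by left.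
  have [AE|nAE] := eqVneq (AGL1 p) (slice2 K).
    by left; apply: t2_case; rewrite -AE; apply: two_transitive_AGL1.
  right; exists (slice2_Group K); first by rewrite properEneq A2 eq_sym andbT.
  exact: slice2_full_prod.
have one_case (P : {set {perm V}} -> Prop) : P H ->
  exists2 s : {perm V}, {morph s : x y / x + y} & P (H :^ s)%g.
  by move=> PH; exists 1%g => [x y|]; rewrite ?perm1 ?conjsg1.
have [t1|A1] := burnside_prime_degree hp (shift_slice1 sH).
  apply: (one_case (fun K => or3 (K = _) (exists2 A : {group _}, _ & K = _) (K \proper _))).
  by case: (full1_case H sH clH splitH t1) => E; [apply: Or31|apply: Or32].
have [t2|A2] := burnside_prime_degree hp (shift_slice2 sH).
  exists (swap_perm F); first exact: swap_additive.
  have [||||E|E] := full1_case (H :^ swap_perm F)%G; last first.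
  - by apply: Or32.
  - by apply: Or31.
  - move=> x y x' y' xy xy'; have [h [h2 hx hy]] := t2 x y x' y' xy xy'.
    exists h; split=> //; rewrite inE in h2.
    by rewrite inE /= -conj_prod_swap memJ_conjg.
  - move=> _ /imsetP[h /splitH[a [b ->]] ->]; rewrite conj_prod_swap; by exists b, a.
  - exact: pair_closedJ.
  exact: (shiftJ swap_additive).
have HA : H \subset coord_prod (AGL1 p) (AGL1 p).
  apply/subsetP=> h hH; have [a [b hE]] := splitH h hH; rewrite hE in hH *.
  by apply/coord_prodP; exists a, b; rewrite (slice1_AGL1 sH A1 hH) (slice2_AGL1 sH A2 hH).
apply: (one_case (fun K => or3 (K = _) (exists2 A : {group _}, _ & K = _) (K \proper _))).
(* The full product has the 2-transitive group [AGL1 p] as its first slice, so equality leads back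
   to [full1_case]. *)
have [HE|nHE] := eqVneq (H : {set _}) (coord_prod (AGL1 p) (AGL1 p)); last first.
  by apply: Or33; rewrite properEneq nHE HA.
have [|E|E] := full1_case H sH clH splitH; last first.
- by apply: Or32.
- by apply: Or31.
suff -> : slice1 H = AGL1 p by apply: two_transitive_AGL1.
apply/eqP; rewrite eqEsubset A1; apply/subsetP=> a aA; rewrite inE HE.
by apply/coord_prodP; exists a, 1%g; split=> //; apply: (group1 (Group AGL1_group)).
Qed.

End Decomposable.

(** * Wreath products from a transvection *)

Section Wreath.

Variables (p : nat) (hp : prime p).
Local Notation F := 'F_p.
Local Notation V := (plane p).

Lemma wreath_permE (S T : finType) (g : {perm S}) (h : {ffun S -> {perm T}}) x :
  wreath_perm g h x = (g x.1, h x.1 x.2).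
Proof. by rewrite permE. Qed.

Lemma two_closed_shift (W : finZmodType) (A : {group {perm W}}) :
  (forall v, shift v \in A) -> pair_closed A -> two_closed A.
Proof.
move=> sA clA; rewrite /two_closed shift_trans //= eqEsubset; apply/andP; split.
  by apply/subsetP=> g /(two_closureP sA)/clA.
apply/subsetP=> g gA; apply/(two_closureP sA) => x y _; by exists g.
Qed.

Section Blocks.

Implicit Types (g h : {perm F}).

Variable K : {group {perm V}}.
Hypotheses (sK : forall v : V, shift v \in K) (clK : pair_closed K).
Hypothesis block : forall k, k \in K -> forall a b b', (k (a, b)).1 = (k (a, b')).1.

Definition block_action := [set g : {perm F} | [exists k in K, forall x, (k x).1 == g x.1]].
(** The block over 0 represents all blocks, since the translations in [K] carry it to the others. *)
Definition fibre_action := [set h : {perm F} | [exists k in K, forall b, k (0, b) == (0, h b)]].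

Lemma block_actionP g :
  reflect (exists2 k, k \in K & forall x, (k x).1 = g x.1) (g \in block_action).
Proof.
rewrite inE; apply: (iffP exists_inP) => [[k kK /forallP kE]|[k kK kE]]; exists k => //.
  by move=> x; apply/eqP.
by apply/forallP=> x; apply/eqP.
Qed.

Lemma fibre_actionP h :
  reflect (exists2 k, k \in K & forall b, k (0, b) = (0, h b)) (h \in fibre_action).
Proof.
rewrite inE; apply: (iffP exists_inP) => [[k kK /forallP kE]|[k kK kE]]; exists k => //.
  by move=> x; apply/eqP.
by apply/forallP=> x; apply/eqP.
Qed.

Lemma block_action_group : group_set block_action.
Proof.
apply/group_setP; split=> [|g h /block_actionP[k kK kE] /block_actionP[m mK mE]].
  by apply/block_actionP; exists 1%g => // x; rewrite !perm1.
by apply/block_actionP; exists (k * m)%g => [|x]; rewrite ?groupM // !permM mE kE.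
Qed.

Lemma fibre_action_group : group_set fibre_action.
Proof.
apply/group_setP; split=> [|g h /fibre_actionP[k kK kE] /fibre_actionP[m mK mE]].
  by apply/fibre_actionP; exists 1%g => // x; rewrite !perm1.
by apply/fibre_actionP; exists (k * m)%g => [|x]; rewrite ?groupM // !permM kE mE.
Qed.

Canonical block_action_Group := Group block_action_group.
Canonical fibre_action_Group := Group fibre_action_group.

Lemma shift_block c : shift c \in block_action.
Proof. by apply/block_actionP; exists (shift ((c, 0) : V)) => // x; rewrite !shiftE. Qed.

Lemma shift_fibre c : shift c \in fibre_action.
Proof.
apply/fibre_actionP; exists (shift ((0, c) : V)) => // x; rewrite !shiftE.
by congr (_, _); rewrite /= ?addr0.
Qed.

Lemma block_perm k : k \in K -> exists g : {perm F}, forall x, (k x).1 = g x.1.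
Proof.
move=> kK; have inj : injective (fun a => (k (a, 0)).1).
  move=> a a' E; have := block (groupVr kK) (k (a, 0)).1 (k (a, 0)).2 (k (a', 0)).2.
  by rewrite {2}E -!surjective_pairing !permK.
by exists (perm inj) => -[a b]; rewrite permE; apply: block.
Qed.

Lemma fibre_perm k i : k \in K -> exists2 h : {perm F}, h \in fibre_action &
  forall b, (k (i, b)).2 = h b.
Proof.
move=> kK; have [g gE] := block_perm kK.
have inj : injective (fun b => (k (i, b)).2).
  move=> b b' E; suff /perm_inj[] : k (i, b) = k (i, b') by [].
  by rewrite [LHS]surjective_pairing [RHS]surjective_pairing !gE E.
exists (perm inj) => [|b]; last by rewrite permE.
apply/fibre_actionP; exists (shift ((i, 0) : V) * k * shift ((- g i, 0) : V))%g.
  by rewrite !groupM.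
move=> b; rewrite !permM !shiftE permE.
have -> : (i, 0) + (0, b) = (i, b) :> V by congr (_, _); rewrite /= ?addr0 ?add0r.
by rewrite [k _]surjective_pairing gE; congr (_, _); rewrite /= ?add0r ?addNr.
Qed.

Variables (alpha : F) (u : {perm V}).
Hypotheses (alpha0 : alpha != 0) (uK : u \in K).
Hypothesis uE : forall x, u x = (x.1, x.2 + alpha * x.1).

(** Powers of [u] followed by translations translate two different blocks by independent amounts. *)
Lemma transvection (beta a0 d : F) : exists2 k, k \in K &
  forall x, k x = (x.1, x.2 + beta * (x.1 - a0) + d).
Proof.
pose n : nat := (beta / alpha)%R.
have unE x : (u ^+ n)%g x = (x.1, x.2 + beta * x.1).
  have -> : beta = n%:R * alpha by rewrite natr_Zp divfK.
  elim: n => [|n IHn]; first by rewrite perm1 !mul0r addr0 -surjective_pairing.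
  by rewrite expgSr permM IHn uE /= mulrS mulrDl mul1r; congr (_, _); ring.
exists (u ^+ n * shift ((0%R, (d - beta * a0)%R) : V))%g; first by rewrite groupM ?groupX.
move=> x; rewrite permM unE shiftE; congr (_, _) => /=; first by rewrite add0r.
by ring.
Qed.

(** Pair closure reduces the claim to two points. In one block a single element of the fibre action
    suffices; in two blocks, realise the action on blocks by any [k] in [K] and correct the second
    coordinates by a transvection. *)
Lemma wreath_sub : imprimitive_wreath block_action fibre_action \subset K.
Proof.
apply/subsetP=> _ /imset2P[g h /block_actionP[k kK kE] /ffun_onP hF ->].
apply: clK => -[i j] [i' j'] _; rewrite !wreath_permE /=.
have [<-{i'}|ii'] := eqVneq i i'.
  have /fibre_actionP[m mK mE] := hF i.
  exists (shift ((- i, 0) : V) * m * shift ((g i, 0) : V))%g.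
  split; first by rewrite !groupM.
    rewrite !permM !shiftE.
    have -> : (- i, 0) + (i, j) = (0, j) :> V by congr (_, _); rewrite /= ?add0r ?addNr.
    by rewrite mE; apply: injective_projections; rewrite /= ?addr0 ?add0r.
  rewrite !permM !shiftE.
  have -> : (- i, 0) + (i, j') = (0, j') :> V by congr (_, _); rewrite /= ?add0r ?addNr.
  by rewrite mE; apply: injective_projections; rewrite /= ?addr0 ?add0r.
pose d := h i j - (k (i, j)).2; pose d' := h i' j' - (k (i', j')).2.
have gii' : g i' - g i != 0 by rewrite subr_eq0 (inj_eq perm_inj) eq_sym.
have [m mK mE] := transvection ((d' - d) / (g i' - g i)) (g i) d.
exists (k * m)%g; split; first by rewrite groupM.
  rewrite permM mE kE /= subrr mulr0 addr0; congr (_, _).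
  by rewrite /d addrC subrK.
rewrite permM mE kE /= divfK //; congr (_, _).
by rewrite /d'; ring.
Qed.

Lemma wreath_eq : K = imprimitive_wreath block_action fibre_action :> {set _}.
Proof.
apply/eqP; rewrite eqEsubset wreath_sub andbT; apply/subsetP=> k kK.
have [g gE] := block_perm kK.
have /fin_all_exists2[h hF hE] i : exists2 h : {perm F}, h \in fibre_action &
  forall b, (k (i, b)).2 = h b by apply: fibre_perm.
apply/imset2P; exists g (finfun h).
- by apply/block_actionP; exists k.
- by apply/ffun_onP=> i; rewrite ffunE.
apply/permP=> -[i j]; rewrite wreath_permE ffunE /= -hE -(gE (i, j)).
exact: surjective_pairing.
Qed.

Lemma wreath_mem g (h : {ffun F -> {perm F}}) : g \in block_action ->
  (forall i, h i \in fibre_action) -> wreath_perm g h \in K.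
Proof.
move=> gB hF; apply: (subsetP wreath_sub); apply/imset2P.
by exists g h => //; apply/ffun_onP.
Qed.

Lemma two_closed_block : two_closed block_action.
Proof.
apply: (@two_closed_shift _ block_action_Group); first exact: shift_block.
move=> g gP; apply/block_actionP; exists (wreath_perm g [ffun=> 1%g]); last first.
  by move=> x; rewrite wreath_permE.
apply: clK => -[i j] [i' j'] _; have [<-{i'}|ii'] := eqVneq i i'.
  exists (wreath_perm (shift (g i - i)) [ffun=> 1%g]); split.
  - by apply: wreath_mem; [exact: shift_block|move=> a; rewrite ffunE (group1 fibre_action_Group)].
  - by rewrite !wreath_permE /= shiftE subrK.
  by rewrite !wreath_permE /= shiftE subrK.
have [m [mB mi mi']] := gP _ _ ii'.
exists (wreath_perm m [ffun=> 1%g]); rewrite !wreath_permE /= mi mi'; split=> //.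
by apply: wreath_mem => // a; rewrite ffunE (group1 fibre_action_Group).
Qed.

(** Let [h] act on all blocks at once. Two points of a block are matched by the assumption on [h],
    two points in different blocks by translating each block separately; pair closure of [K] does
    the rest. *)
Lemma two_closed_fibre : two_closed fibre_action.
Proof.
apply: (@two_closed_shift _ fibre_action_Group); first exact: shift_fibre.
have B1 : 1%g \in block_action by apply: (group1 block_action_Group).
move=> h hP; apply/fibre_actionP; exists (wreath_perm 1%g [ffun=> h]); last first.
  by move=> x; rewrite wreath_permE /= perm1 ffunE.
apply: clK => -[i j] [i' j'] xx'; have [ii'|ii'] := eqVneq i i'.
  have [m [mF mj mj']] : exists m, [/\ m \in fibre_action, m j = h j & m j' = h j'].
    by apply: hP; apply: contraNneq xx' => ->; rewrite ii'.
  exists (wreath_perm 1%g [ffun=> m]); rewrite !wreath_permE /= !ffunE mj mj'.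
  by split=> //; apply: wreath_mem => // a; rewrite ffunE.
exists (wreath_perm 1%g [ffun a => if a == i then shift (h j - j) else shift (h j' - j')]).
rewrite !wreath_permE /= !ffunE eqxx eq_sym (negbTE ii') !shiftE !subrK; split=> //.
by apply: wreath_mem => // a; rewrite ffunE; case: ifP => _; apply: shift_fibre.
Qed.

End Blocks.

End Wreath.

Section Transvections.

Variables (p : nat) (hp : prime p).
Local Notation F := 'F_p.
Local Notation V := (plane p).

Lemma card_shift_group : #|shift_Group V| = (p ^ 2)%N.
Proof.
rewrite card_imset ?card_plane // => u v /permP/(_ 0).
by rewrite !shiftE !addr0.
Qed.

Lemma Fp_expr_pX (a : F) k : a ^+ (p ^ k) = a.
Proof.
elim: k => [|k IHk]; first by rewrite expn0 expr1.
rewrite expnSr exprM IHk; have [->|a0] := eqVneq a 0.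
  by rewrite expr0n -leqn0 leqNgt prime_gt0.
have ap : a * a ^+ p.-1 = a by rewrite Fp_expr_pred // mulr1.
by rewrite -exprS prednK ?prime_gt0 in ap.
Qed.

Variable G : {group {perm V}}.
Hypothesis shiftG : forall v : V, shift v \in G.
Hypothesis cardG : (p ^ 3 %| #|G|)%N.

(** The translations have order [p ^ 2], so they are a proper subgroup of a Sylow subgroup, where
    normalisers grow. A normalising element, corrected by a translation to fix 0, is additive. *)
Lemma p_element_normalizing_shifts : exists h, [/\ h \in G, h 0 = 0, h != 1%g,
  {morph h : x y / x + y} & exists k, (h ^+ (p ^ k) = 1)%g].
Proof.
have pT : (p.-group (shift_Group V))%g by rewrite /pgroup card_shift_group pnatX pnat_id.
have TG : (shift_Group V) \subset G by apply/subsetP=> _ /imsetP[v _ ->].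
have [P sylP TP] := Sylow_superset TG pT.
have pP := pHall_pgroup sylP.
have properTP : (shift_Group V) \proper P.
  rewrite properEcard TP card_shift_group (card_Hall sylP).
  rewrite (@leq_trans (p ^ 3)) //; first by rewrite ltn_exp2l // prime_gt1.
  by rewrite p_part leq_exp2l ?prime_gt1 // -pfactor_dvdn.
have /properP[_ [g gN gT]] := nilpotent_proper_norm (pgroup_nil pP) properTP.
have [gP gnT] := setIP gN.
pose h := (g * shift (- g 0))%g.
have sT v : shift v \in (shift_Group V) by apply/imsetP; exists v.
have hN : h \in 'N(shift_Group V)%g by rewrite groupM // (subsetP (normG _)).
have hP : h \in P by rewrite groupM // (subsetP TP).
have h0 : h 0 = 0 by rewrite permM shiftE addNr.
exists h; split=> //.
- exact: (subsetP (pHall_sub sylP)).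
- by apply: contraNneq gT => h1; rewrite -(groupMr _ (sT (- g 0))) -/h h1.
- have key v : exists w, forall x, h (v + x) = w + h x.
    have : (shift v ^ h)%g \in (shift_Group V) by rewrite memJ_norm.
    case/imsetP=> w _ E; exists w => x.
    by rewrite -!shiftE -E permJ.
  move=> x y; have [w wE] := key x; rewrite wE; congr (_ + _).
  by have := wE 0; rewrite h0 !addr0.
have /p_natP[k hk] : (p.-nat #[h])%g by apply: mem_p_elt hP.
by exists k; rewrite -hk expg_order.
Qed.

(** On the stable line and on the quotient by it, [h] acts by scalars of [p]-power order, and these
    are 1 because a scalar of F_p is its own power of exponent [p ^ k]. *)
Lemma exists_transvection e v : e != 0 -> diff_stable G (line e) -> det2 e v = 1 ->
  exists h alpha, [/\ h \in G, alpha != 0 & forall x, h x = x + scale2 (alpha * det2 e x) e].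
Proof.
move=> e0 stL ev.
have [h [hG h0 h1 hD [k hk]]] := p_element_normalizing_shifts.
have hL x : (det2 e (h x) == 0) = (det2 e x == 0).
  by have := stL h hG 0 x; rewrite h0 !subr0 !inE.
have [c hec] : exists c, h e = scale2 c e.
  by apply/(parallelP _ e0); rewrite hL det2vv.
have dec x : x = scale2 (det2 x v) e + scale2 (det2 e x) v.
  have ev0 : det2 e v != 0 by rewrite ev oner_eq0.
  by rewrite {1}(plane_basis x ev0) ev !divr1.
pose a := det2 e (h v).
have hx x : h x = scale2 (det2 x v) (h e) + scale2 (det2 e x) (h v).
  by rewrite {1}(dec x) hD !(additive_scale2 hD).
have aE x : det2 e (h x) = a * det2 e x.
  by rewrite hx hec det2Dr !det2Zr det2vv !mulr0 add0r mulrC.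
have a1 : a = 1.
  have hka n : det2 e ((h ^+ n)%g v) = a ^+ n.
    by elim: n => [|n IHn]; rewrite ?perm1 // expgSr permM aE IHn exprS.
  by rewrite -[a](Fp_expr_pX _ k) -hka hk perm1.
have c1 : c = 1.
  have hkc n : (h ^+ n)%g e = scale2 (c ^+ n) e.
    elim: n => [|n IHn]; first by rewrite perm1 expr0 scale21.
    by rewrite expgSr permM IHn (additive_scale2 hD) hec scale2A exprSr.
  have := hkc (p ^ k)%N; rewrite hk perm1 Fp_expr_pX => /eqP.
  rewrite -{1}[e]scale21 -subr_eq0 -scale2B scale2_eq0 (negbTE e0) orbF subr_eq0.
  by move/eqP.
have /(parallelP _ e0)[al alE] : det2 e (h v - v) == 0 by rewrite det2Br -/a a1 ev subrr.
have hvE : h v = v + scale2 al e by rewrite -alE addrC subrK.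
have hE x : h x = x + scale2 (al * det2 e x) e.
  rewrite hx hec c1 scale21 hvE scale2Dr scale2A addrA -dec mulrC //.
exists h, al; split=> //; apply: contraNneq h1 => al0.
by apply/eqP/permP=> x; rewrite hE al0 mul0r scale20 addr0 perm1.
Qed.

End Transvections.

Lemma two_transitive_primitive (W : finZmodType) (G : {group {perm W}}) :
  (forall v, shift v \in G) -> two_transitive G -> [primitive G, on [set: W] | 'P].
Proof.
move=> sG tG; apply: (stable_primitiveP sG) => B sB B0 _.
have [/existsP[u /andP[uB u0]]|nou] := boolP [exists u, (u \in B) && (u != 0)].
  left; apply/setP=> w; rewrite inE; have [->//|w0] := eqVneq w 0.
  have [g [gG g0 gu]] : exists g, [/\ g \in G, g 0 = 0 & g u = w].
    by apply: tG; rewrite eq_sym.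
  by rewrite -[w]subr0 -gu -g0 sB // subr0.
right; apply/setP=> x; rewrite inE; apply/idP/eqP=> [xB|->//]; apply/eqP.
by apply: contraR nou => x0; apply/existsP; exists x; rewrite xB.
Qed.

Section Conjugation.

Variable W : finZmodType.
Variables (G : {group {perm W}}) (s : {perm W}).
Hypotheses (sG : forall v, shift v \in G) (sD : {morph s : x y / x + y}).

Lemma conj_groupK : ((G :^ s) :^ s^-1)%G = G.
Proof. by apply: val_inj; rewrite /= conjsgK. Qed.

Lemma primitive_conj : [primitive G :^ s, on [set: W] | 'P] = [primitive G, on [set: W] | 'P].
Proof.
have sH := shiftJ sD sG.
apply/idP/idP=> [/(primitive_stableP sH) pH|/(primitive_stableP sG) pG].
  apply: stable_primitiveP => //; rewrite -conj_groupK.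
  exact: stable_primitiveJ (additiveV sD) _ pH.
exact: (stable_primitiveP sH (stable_primitiveJ sD pG)).
Qed.

Lemma two_transitive_conj : two_transitive (G :^ s)%g -> two_transitive G.
Proof. by move/(two_transitiveJ (s^-1)%g); rewrite conjsgK. Qed.

End Conjugation.

(** * Sylow subgroups and the final case analysis *)

Section Sylow.

Variables (p : nat) (hp : prime p).
Local Notation V := (plane p).

(** An abelian group containing the translations consists of translations: [g] commutes with
    [shift x], so [g x = x + g 0]. Its order is therefore [p ^ 2]. *)
Lemma abelem_Sylow_card (G P : {group {perm V}}) : (forall v : V, shift v \in G) ->
  (p.-Sylow(G) P)%g -> abelian P -> ~~ (p ^ 3 %| #|G|)%N.
Proof.
move=> sG sylP abP; apply/negP=> p3.
have pT : (p.-group (shift_Group V))%g.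
  by rewrite /pgroup (card_shift_group hp) pnatX pnat_id.
have TG : shift_Group V \subset G by apply/subsetP=> _ /imsetP[v _ ->].
have [Q sylQ TQ] := Sylow_superset TG pT.
have abQ : abelian Q.
  have [x _ ->] := Sylow_trans sylP sylQ.
  by rewrite /= /abelian centJ conjSg.
have : (p ^ 3 <= #|Q|)%N.
  by rewrite (card_Hall sylQ) p_part leq_exp2l ?prime_gt1 // -pfactor_dvdn.
apply/negP; rewrite -ltnNge (@leq_ltn_trans (p ^ 2)) //; last first.
  by rewrite ltn_exp2l // prime_gt1.
rewrite -(card_shift_group hp) subset_leq_card //; apply/subsetP=> g gQ.
apply/imsetP; exists (g 0) => //; apply/permP=> x.
have sxQ : shift x \in Q by apply: (subsetP TQ); apply/imsetP; exists x.
have /permP/(_ 0) := centsP abQ _ gQ _ sxQ.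
by rewrite !permM !shiftE addr0 => <-; rewrite addrC.
Qed.

Lemma Sylow_card_dvd (G P : {group {perm V}}) : (p.-Sylow(G) P)%g -> (p ^ 3 <= #|P|)%N ->
  (p ^ 3 %| #|G|)%N.
Proof.
move=> sylP; rewrite (card_Hall sylP) p_part leq_exp2l ?prime_gt1 //.
by rewrite -pfactor_dvdn.
Qed.

End Sylow.

Section Structure.

Variables (p : nat) (hp : prime p).
Local Notation F := 'F_p.
Local Notation V := (plane p).
Local Notation S := [set: {perm F}].
Variable G : {group {perm V}}.
Hypotheses (sG : forall v : V, shift v \in G) (clG : pair_closed G).

Lemma decomposable_structure : ~~ [primitive G, on [set: V] | 'P] ->
    ~~ (p ^ 3 %| #|G|)%N ->
  exists2 s : {perm V}, {morph s : x y / x + y} &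
    [\/ (G :^ s)%g = coord_prod S S,
        exists2 A : {group {perm F}}, A \proper AGL1 p & (G :^ s)%g = coord_prod S A
      | (G :^ s)%g \proper coord_prod (AGL1 p) (AGL1 p)].
Proof.
move=> npG p3; have [e e0 stL] := imprimitive_stable_line sG npG.
have [u ue uP] := stable_complement hp sG p3 e0 stL.
have [s [sD su se]] := exists_coordinates ue.
have eP g : g \in G -> forall x t, det2 e (g (x + scale2 t e) - g x) = 0.
  move=> gG x t; have := stL g gG x (x + scale2 t e).
  by rewrite !inE addrAC subrr add0r det2Zr det2vv mulr0 eqxx => /eqP.
have [||h|t tD tP] := @coord_prod_trichotomy p hp (G :^ s)%G.
- exact: shiftJ.
- exact: pair_closedJ.
- by case/imsetP=> g gG ->; apply: (coord_split sD ue su se); [apply: uP|apply: eP].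
exists (s * t)%g => [x y|]; first by rewrite !permM sD tD.
by rewrite conjsgM.
Qed.

Lemma wreath_structure : ~~ [primitive G, on [set: V] | 'P] -> (p ^ 3 %| #|G|)%N ->
  exists2 s : {perm V}, {morph s : x y / x + y} &
    exists G1 : {group {perm F}}, exists G2 : {group {perm F}},
      [/\ two_closed G1, two_closed G2 & (G :^ s)%g = imprimitive_wreath G1 G2].
Proof.
move=> npG p3; have [e e0 stL] := imprimitive_stable_line sG npG.
have [v ev] := exists_det2 e0.
have [h [al [hG al0 hE]]] := exists_transvection hp sG p3 e0 stL ev.
have ve : det2 v e != 0 by rewrite det2C ev oppr_eq0 oner_eq0.
have [s [sD sv se]] := exists_coordinates ve.
have eP g : g \in G -> forall x t, det2 e (g (x + scale2 t e) - g x) = 0.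
  move=> gG x t; have := stL g gG x (x + scale2 t e).
  by rewrite !inE addrAC subrr add0r det2Zr det2vv mulr0 eqxx => /eqP.
have block k : k \in (G :^ s)%G -> forall a b b', (k (a, b)).1 = (k (a, b')).1.
  by case/imsetP=> g gG ->; apply: coord_axis2; apply: (coord_parallel sD e0 se se); apply: eP.
have s1 x : (s x).1 = det2 e x.
  have ev0 : det2 e v != 0 by rewrite ev oner_eq0.
  rewrite [in LHS](plane_basis x ev0) sD !(additive_scale2 sD) se sv ev !divr1 /=.
  by rewrite mulr0 add0r mulr1.
have hsE x : (h ^ s)%g x = (x.1, x.2 + al * x.1).
  rewrite -[x](permKV s) permJ hE sD (additive_scale2 sD) se -s1.
  by apply: injective_projections; rewrite /= ?mulr0 ?addr0 ?mulr1.
have hsK : (h ^ s)%g \in (G :^ s)%G by rewrite memJ_conjg.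
have sK := shiftJ sD sG; have clK : pair_closed (G :^ s)%G by apply: pair_closedJ.
exists s => //.
exists (block_action_Group (G :^ s)%G), (fibre_action_Group (G :^ s)%G); split.
- exact: (two_closed_block sK clK al0 hsK hsE).
- exact: (two_closed_fibre sK clK al0 hsK hsE).
exact: (wreath_eq sK clK block al0 hsK hsE).
Qed.

End Structure.

Local Close Scope ring_scope.
Local Open Scope group_scope.

(** A single conjugation serves all the clauses, since primitivity, double transitivity and the
    order of [G] decide which of them are not vacuous. The alternative [p = 2] in the fourth clause
    is the group of translations of the plane over F_2: there S_2 is [AGL1 2], so S_2 x S_2 is the
    whole product of the affine groups and not a proper subgroup. *)
Theorem theorem14 (p : nat) (hp : prime p) (G : {group {perm (plane p)}})
    (hcl : two_closed G) (hreg : translations p \subset G) :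
  exists s : {perm (plane p)}, let H := (G :^ s)%G in
     (doubly_transitive H -> H = [set: {perm (plane p)}] :> {set _})
  /\ (simply_primitive H -> solvable H -> H \subset AGL2 p)
  /\ (simply_primitive H -> ~~ solvable H ->
        H \subset AGL2 p \/ H = product_wreath_S2 'F_p :> {set _})
  /\ (imprimitive H -> solvable H ->
        (exists2 P : {group {perm (plane p)}}, p.-Sylow(H) P & p.-abelem P) ->
        [\/ H \proper coord_prod (AGL1 p) (AGL1 p),
            p = 3 /\ H = coord_prod [set: {perm 'F_p}] [set: {perm 'F_p}]
                       :> {set _}
          | p = 2 /\ H = coord_prod [set: {perm 'F_p}] [set: {perm 'F_p}]
                       :> {set _}])
  /\ (imprimitive H -> ~~ solvable H ->
        (exists2 P : {group {perm (plane p)}}, p.-Sylow(H) P & p.-abelem P) ->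
        H = coord_prod [set: {perm 'F_p}] [set: {perm 'F_p}] :> {set _}
        \/ exists2 A : {group {perm 'F_p}}, A \proper AGL1 p
             & H = coord_prod [set: {perm 'F_p}] A :> {set _})
  /\ (imprimitive H ->
        (exists2 P : {group {perm (plane p)}}, p.-Sylow(H) P
           & (p ^ 3 <= #|P|)%N) ->
        exists G1 : {group {perm 'F_p}}, exists G2 : {group {perm 'F_p}},
          [/\ two_closed G1, two_closed G2
            & H = imprimitive_wreath G1 G2 :> {set _}]).
Proof.
have sG v : shift v \in G by apply: (subsetP hreg); apply/imsetP; exists v.
have clG : pair_closed G.
  by move=> g gP; have /andP[_ /eqP <-] := hcl; apply/two_closureP.
have x01 : (0 : plane p)%R != (1, 0)%R.
  by rewrite eq_sym plane_eq0.
have dtP (K : {group _}) := @doubly_transitiveP _ _ _ K x01.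
have nsimple (s : {perm plane p}) : {morph s : x y / (x + y)%R} -> ~~ [primitive G, on setT | 'P] ->
    [/\ ~~ doubly_transitive (G :^ s)%G & ~~ simply_primitive (G :^ s)%G].
  move=> sD npG; have np : ~~ [primitive G :^ s, on setT | 'P] by rewrite primitive_conj.
  split; last by rewrite negb_and np.
  apply: contra np => /dtP tH.
  exact: (two_transitive_primitive (shiftJ sD sG) tH).
have full_in (A : {group {perm 'F_p}}) (a : {perm 'F_p}) :
    prod_perm a 1 \in coord_prod [set: {perm 'F_p}] A.
  by apply/coord_prodP; exists a, 1; rewrite inE group1.
have [pG|npG] := boolP [primitive G, on setT | 'P]; last first.
  have [p3|p3] := boolP (p ^ 3 %| #|G|)%N.
    have [s sD wr] := wreath_structure hp sG clG npG p3.
    have [nd ns] := nsimple s sD npG; exists s => H.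
    have noabel : ~ (exists2 P : {group {perm (plane p)}}, p.-Sylow(H) P & p.-abelem P).
      case=> P sylP abP; have := abelem_Sylow_card hp (shiftJ sD sG) sylP (abelem_abelian abP).
      by rewrite cardJg p3.
    split; first by rewrite (negbTE nd).
    by do 2![split; first by rewrite (negbTE ns)]; do 2![split=> // _ _ /noabel].
  have [s sD st] := decomposable_structure hp sG clG npG p3.
  have [nd ns] := nsimple s sD npG; exists s => H.
  split; first by rewrite (negbTE nd).
  do 2![split; first by rewrite (negbTE ns)].
  split.
    move=> _ solH _; case: st => [HE|[A Ap HE]|Hp]; last by apply: Or31.
      have [|p2|p3'] := AGL1_full_prime hp.
      - by apply: (solvable_slice1_full hp) solH => a; rewrite /= HE (full_in setT%G).
      - by apply: Or33.
      - by apply: Or32.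
    apply: Or31; rewrite /= HE; apply: coord_prod_properl => //.
    by apply: (solvable_slice1_full hp) solH => a; rewrite /= HE full_in.
  split.
    move=> _ nsolH _; case: st => [HE|[A Ap HE]|Hp]; [by left|by right; exists A|].
    by case/negP: nsolH; apply: coord_AGL1_solvable (proper_sub Hp).
  move=> _ [P sylP p3P]; case/negP: p3; rewrite -(cardJg G s).
  exact: Sylow_card_dvd hp _ _ sylP p3P.
have pH (s : {perm plane p}) : {morph s : x y / (x + y)%R} -> ~~ imprimitive (G :^ s)%G.
  by move=> sD; rewrite negb_and negbK primitive_conj // pG orbT.
have [tG|ntG] := boolP (doubly_transitive G).
  exists 1; have -> : (G :^ 1)%G = G by apply: val_inj; rewrite /= conjsg1.
  move=> H.
  have pH1 : ~~ imprimitive H by rewrite negb_and negbK pG orbT.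
  split=> [_|]; first exact: (doubly_transitive_full x01).
  by rewrite /simply_primitive tG (negbTE pH1) andbF.
have ntG' : ~ two_transitive G by apply/dtP.
have [s sD st] := simply_primitive_structure hp sG clG (primitive_stableP sG pG) ntG'.
exists s => H; rewrite (negbTE (pH s sD)).
split; first by move/dtP/two_transitive_conj/ntG'.
split.
  (* A solvable wreath product forces S_p to be affine, so that it lies in [AGL2 p] as well. *)
  move=> _ solH; case: st => // HE.
  have AS : AGL1 p = [set: {perm 'F_p}].
    apply: (solvable_slice1_full hp) solH => a; rewrite /= HE.
    by apply/product_wreathP; left; exists a, 1.
  rewrite /= HE; apply/subsetP=> _ /product_wreathP[] [a [b ->]].
    by apply: prod_perm_AGL2; rewrite AS inE.
  by apply: swap_AGL2; rewrite AS inE.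
by split.
Qed.
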